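(* Let $u_0\in\mathcal{S}([0,\infty))$ and $g_0\in C^\infty([0,\infty))$, and let $u(x,t)$ be defined for $x>0$, $t>0$ by $$u(x,t)=\frac{1}{2\pi}\int_{-\infty}^{\infty}e^{i\lambda x-\lambda^2t}\,\hat u_0(\lambda)\,d\lambda-\frac{1}{2\pi}\int_{\Gamma}e^{i\lambda x-\lambda^2t}\,\hat u_0(-\lambda)\,d\lambda-\frac{i}{\pi}\int_{\Gamma}e^{i\lambda x-\lambda^2t}\,\lambda\,\tilde g_0(\lambda,t)\,d\lambda .$$ Then $u$ is $C^\infty$ on $Q=\{(x,t)\in\mathbb{R}^2:x>0,\ t>0\}$ and satisfies the following. (1) $u_t=u_{xx}$ for $x>0$ and $t>0$. (2) $\lim_{t\to0^+}u(x,t)=u_0(x)$ for each fixed $x>0$, and $\lim_{x\to0^+}u(x,t)=g_0(t)$ for each fixed $t>0$. (3) For each fixed $t>0$, the function $x\mapsto u(x,t)$ belongs to $C^\infty([0,\infty))$, and for every $n\in\mathbb{N}$ the function $g_n(t)=\lim_{x\to0^+}\frac{\partial^nu(x,t)}{\partial x^n}$, $t\in(0,\infty)$, is $C^\infty$ on $(0,\infty)$. (4) For each fixed $x>0$, the function $t\mapsto u(x,t)$ belongs to $C^\infty([0,\infty))$, and for every $n\in\mathbb{N}$ the function $u_n(x)=\lim_{t\to0^+}\frac{\partial^nu(x,t)}{\partial t^n}$, $x\in(0,\infty)$, is $C^\infty$ on $(0,\infty)$. (5) $u(x,t)$ is rapidly decreasing as $x\to+\infty$, uniformly for $t$ in compact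 subsets of $(0,\infty)$.
   Context: Function spaces: a $C^\infty$ function $f:(0,\infty)\to\mathbb{C}$ belongs to $C^\infty([0,\infty))$ if $\lim_{x\to0^+}\frac{d^Nf(x)}{dx^N}$ exists for every integer $N\ge0$ (equivalently, $f$ extends to a $C^\infty$ function on $\mathbb{R}$); values of $f$ and its derivatives at $0$ denote these limits. $f\in\mathcal{S}([0,\infty))$ means $f\in C^\infty([0,\infty))$ and $\sup_{x\ge0}\left|x^M\frac{d^Nf(x)}{dx^N}\right|<\infty$ for all integers $M,N\ge0$. A $C^\infty$ function $F:Q\to\mathbb{C}$ is rapidly decreasing as $x\to+\infty$, uniformly for $t$ in compact subsets of $(0,\infty)$, if for all integers $M,N\ge0$, $\lim_{x\to+\infty}\left|x^M\frac{\partial^NF(x,t)}{\partial x^N}\right|=0$ uniformly for $t$ in compact subsets of $(0,\infty)$. Transforms: $\hat u_0(\lambda)=\int_0^\infty u_0(x)e^{-i\lambda x}\,dx$ for $\lambda\in\mathbb{C}$ with $\operatorname{Im}\lambda\le0$; $\tilde g_0(\lambda,t)=\int_0^te^{\lambda^2\tau}g_0(\tau)\,d\tau$ for $\lambda\in\mathbb{C}$. Contour: $\Gamma=\{\lambda\in\mathbb{C}:\operatorname{Im}\lambda\ge0,\ \operatorname{Re}(\lambda^2)=0\}$ is the positively oriented boundary of $\Omega^-=\{\lambda\in\mathbb{C}:\operatorname{Im}\lambda\ge0,\ \operatorname{Re}(\lambda^2)\le0\}$, i.e. it comes in from infinity along the ray $\arg\lambda=3\pi/4$ to $0$ and then goes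 out to infinity along the ray $\arg\lambda=\pi/4$. *)

(* Defs.v *)
From HB Require Import structures.
From mathcomp Require Import all_boot all_order all_algebra.
From mathcomp Require Import complex.
From mathcomp Require Import all_classical all_reals all_analysis.
Set Warnings "-redundant-canonical-projection".
Set Implicit Arguments.
Unset Strict Implicit.
Unset Printing Implicit Defensive.
Import Order.TTheory GRing.Theory Num.Theory.
Import numFieldNormedType.Exports.
Local Open Scope classical_set_scope.
Local Open Scope ring_scope.

(* Complex numbers are [Rcomplex R], the alias of [R[i]] on which mathcomp's
   [complex] library puts a real-valued modulus and an R-module structure.  We
   complete it to a normed module over [R], with the topology of the modulus,
   so that limits and derivatives of complex-valued functions of a real variable
   are those of the library. *)
Section Rcomplex_normedModType.
Context {R : realType}.

HB.instance Definition _ :=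
  PseudoMetric.copy (Rcomplex R) (pseudoMetric_normed (Rcomplex R)).

HB.instance Definition _ := isPointed.Build (Rcomplex R) 0.

HB.instance Definition _ :=
  NormedZmod_PseudoMetric_eq.Build R (Rcomplex R) erefl.

Lemma Rcomplex_normrZ (a : R) (z : Rcomplex R) : `|a *: z| = `|a| * `|z|.
Proof.
case: z => x y; rewrite /Num.Def.normr /= !exprMn -mulrDr.
by rewrite sqrtrM ?sqr_ge0// sqrtr_sqr.
Qed.

HB.instance Definition _ :=
  PseudoMetricNormedZmod_Lmodule_isNormedModule.Build R (Rcomplex R)
    Rcomplex_normrZ.

End Rcomplex_normedModType.

Section complex_calculus.
Context {R : realType}.
Local Notation C := (Rcomplex R).

Definition Ci : C := Complex 0 1.

Definition RtoC (x : R) : C := Complex x 0.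

Definition expC (z : C) : C :=
  Complex (expR (complex.Re z) * cos (complex.Im z)) (expR (complex.Re z) * sin (complex.Im z)).

Definition Cintegral (A : set R) (f : R -> C) : C :=
  Complex (\int[lebesgue_measure]_(x in A) complex.Re (f x))
          (\int[lebesgue_measure]_(x in A) complex.Im (f x)).

(* Integral along the ray [arg lambda = theta], oriented from 0 to infinity. *)
Definition ray_integral (theta : R) (f : C -> C) : C :=
  let w := expC (theta *: Ci) in
  Cintegral `]0, +oo[ (fun s => f (s *: w) * w).

(* Gamma comes in from infinity along [arg lambda = 3 pi / 4] and goes out to
   infinity along [arg lambda = pi / 4]. *)
Definition Gamma_integral (f : C -> C) : C :=
  ray_integral (pi / 4) f - ray_integral (3 * pi / 4) f.

End complex_calculus.

Section function_spaces.
Context {R : realType}.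
Local Notation C := (Rcomplex R).

(* A function on (0, oo) is represented by a total function on [R]; the
   definitions below only depend on its values at positive reals. *)

Definition Cinfty_pos (f : R -> C) :=
  forall (n : nat) (x : R), 0 < x -> derivable (derive1n n f) x 1.

Definition Cinfty_halfline (f : R -> C) :=
  Cinfty_pos f /\ forall n : nat, cvg (derive1n n f x @[x --> 0^'+]).

Definition deriv_at0 (n : nat) (f : R -> C) : C := lim (derive1n n f x @[x --> 0^'+]).

Definition deriv_halfline (n : nat) (f : R -> C) (x : R) : C :=
  if 0 < x then derive1n n f x else deriv_at0 n f.

Definition Schwartz_halfline (f : R -> C) :=
  Cinfty_halfline f /\
  forall M N : nat,
    has_ubound [set `|x ^+ M *: deriv_halfline N f x| | x in `[0, +oo[].

Definition partial_x (F : R -> R -> C) (x t : R) : C := derive1 (F ^~ t) x.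

Definition partial_t (F : R -> R -> C) (x t : R) : C := derive1 (F x) t.

(* [true] stands for a derivative in x, [false] for one in t. *)
Definition iter_partial (s : seq bool) (F : R -> R -> C) : R -> R -> C :=
  foldr (fun b G => if b then partial_x G else partial_t G) F s.

Definition quadrant : set (R * R) := [set p | 0 < p.1 /\ 0 < p.2].

(* All the iterated partial derivatives, in any order, exist and are
   continuous on the open set Q. *)
Definition Cinfty_on (Q : set (R * R)) (F : R -> R -> C) :=
  forall (s : seq bool) (x t : R), Q (x, t) ->
    let G := iter_partial s F in
    [/\ derivable (G ^~ t) x 1, derivable (G x) t 1 &
        {for (x, t), continuous (fun p : R * R => G p.1 p.2)}].

Definition rapidly_decreasing (F : R -> R -> C) :=
  forall (M N : nat) (K : set R), compact K -> K `<=` `]0, +oo[ ->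
    forall e : R, 0 < e ->
      \forall x \near +oo, forall t, K t -> `|x ^+ M *: derive1n N (F ^~ t) x| < e.

End function_spaces.

Section transforms.
Context {R : realType}.
Local Notation C := (Rcomplex R).

Definition hat (f : R -> C) (lambda : C) : C :=
  Cintegral `]0, +oo[ (fun x => f x * expC (- (Ci * lambda * RtoC x))).

Definition tilde (g : R -> C) (lambda : C) (t : R) : C :=
  Cintegral `]0, t[ (fun tau => expC (lambda ^+ 2 * RtoC tau) * g tau).

Definition kernel_exp (x t : R) (lambda : C) : C :=
  expC (Ci * lambda * RtoC x - lambda ^+ 2 * RtoC t).

End transforms.

(* Main.v *)
Require Import Defs.
(** Inserting the definitions of the transforms and exchanging the integrals
  turns the formula for [u] into real integrals against the heat kernel
  K(x,t) = exp(-x^2/4t) / sqrt(4 pi t).  The line gives the convolution of u0 with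
  K(x-y,t), and the rays of Gamma, rotated to the real axis, give K(x+y,t) and
  the x-derivative of K:
    u(x,t) = int (K(x-y,t) - K(x+y,t)) u0(y) dy - 2 int_0^t K_x(x,t-s) g0(s) ds.
  All x-derivatives of these integrals form a sequence F_n with dF_n/dx = F_(n+1)
  and dF_n/dt = F_(n+2).  Integration by parts against the kernels bounds every
  F_n uniformly up to x = 0 for t in a compact subset of (0,oo), with rapid decay
  in x, and uniformly up to t = 0 for x in a compact subset of (0,oo).  Bounded
  derivatives give limits at the boundary, and Taylor's inequality differentiates
  these limits along it. *)
From mathcomp Require Import all_boot all_order all_algebra.
From mathcomp Require Import complex.
From mathcomp Require Import all_classical all_reals all_analysis.
From mathcomp Require Import measurable_realfun lebesgue_integral_under.
From mathcomp Require Import zify ring lra.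
Set Implicit Arguments.
Unset Strict Implicit.
Unset Printing Implicit Defensive.
Import Order.TTheory GRing.Theory Num.Theory.
Import numFieldNormedType.Exports.
Local Open Scope classical_set_scope.
Local Open Scope ring_scope.

(** * Differentiation under the integral, integration by parts *)

(** On Gamma the square of lambda is purely imaginary, so the exponential has modulus exp(-x Im
    lambda) and absolute convergence rests on x > 0. The contour formula therefore shows neither the
    boundary value nor the smoothness up to x = 0, and everything is moved to real kernels. The data
    need not be compatible at the corner (0,0), so derivatives cannot in general stay bounded near
    it; hence two separate sets of bounds, each away from the other edge. The index of the kernels
    starts one step below K, at the normal distribution function. It is bounded, becomes a step
    function as t tends to 0 and tends to 1/2 as x tends to 0, so integration by parts down to this
    level turns both limits into dominated convergence. For the line integral the parts are taken in
    y; for the boundary integral they are taken in time, where the heat equation trades one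
    t-derivative for two x-derivatives. The rotation of the rays is real analysis: the slope of the
    ray is a real parameter, and the derivative of the integrand in the slope is an exact derivative
    along the ray. *)

Section real_tools.
Context {R : realType}.
Implicit Types (f g h : R -> R) (x y a b c : R) (A B : set R).
Local Notation mu := (@lebesgue_measure R).
Local Notation integ A f := (mu.-integrable A (EFin \o f)).

Lemma is_deriveDf f g x df dg : is_derive x 1 f df -> is_derive x 1 g dg ->
  is_derive x 1 (fun y => f y + g y) (df + dg).
Proof. by move=> hf hg; exact: is_deriveD. Qed.

Lemma is_deriveNf f x df : is_derive x 1 f df ->
  is_derive x 1 (fun y => - f y) (- df).
Proof. by move=> hf; exact: is_deriveN. Qed.

Lemma is_deriveMf f g x df dg : is_derive x 1 f df -> is_derive x 1 g dg ->
  is_derive x 1 (fun y => f y * g y) (df * g x + f x * dg).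
Proof.
move=> hf hg; apply: is_derive_eq (is_deriveM hf hg) _.
by rewrite addrC /GRing.scale /= [g x * _]mulrC.
Qed.

Lemma is_derive_cf c x : is_derive x 1 (fun=> c) 0.
Proof. exact: is_derive_cst. Qed.

Lemma is_derive_idf x : is_derive x 1 (fun y => y) 1.
Proof. exact: is_derive_id. Qed.

Lemma is_derive_compf f g x df dg :
  is_derive (g x) 1 f df -> is_derive x 1 g dg ->
  is_derive x 1 (fun y => f (g y)) (df * dg).
Proof.
move=> hf hg; apply: is_derive_eq (is_derive1_comp hf hg) _.
by rewrite /GRing.scale /= mulrC.
Qed.

Lemma is_deriveVf f x df : f x != 0 -> is_derive x 1 f df ->
  is_derive x 1 (fun y => (f y)^-1) (- (f x) ^- 2 * df).
Proof. by move=> f0 hf; exact: (is_deriveV f0 hf). Qed.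

Lemma is_deriveXf n f x df : is_derive x 1 f df ->
  is_derive x 1 (fun y => f y ^+ n) (n%:R * f x ^+ n.-1 * df).
Proof. by move=> hf; have := is_deriveX n hf; rewrite exprfctE. Qed.

Lemma is_derive_cont f x df : is_derive x 1 f df -> {for x, continuous f}.
Proof. by move=> hf; apply/differentiable_continuous/derivable1_diffP. Qed.

Lemma integrable_dominated A f g : measurable A -> measurable_fun A f ->
  (forall x, A x -> `|f x| <= g x) -> integ A g -> integ A f.
Proof.
move=> mA mf fg; apply: le_integrable => //; first exact/measurable_EFinP.
move=> x Ax /=; rewrite lee_fin; apply: le_trans (fg _ Ax) _; exact: ler_norm.
Qed.

Lemma measurable_cont_on A f : measurable A -> open A ->
  {in A, continuous f} -> measurable_fun A f.
Proof. by move=> mA oA cf; exact: open_continuous_measurable_fun. Qed.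

Lemma derive_under_integral (f f' : R -> R -> R) A u v a (G : R -> R) :
  measurable A -> u < a < v ->
  (forall x, u < x < v -> integ A (f x)) ->
  (forall x y, u < x < v -> A y -> is_derive x 1 (f ^~ y) (f' x y)) ->
  (forall x y, u < x < v -> A y -> `|f' x y| <= G y) -> integ A G ->
  is_derive a 1 (fun x => \int[mu]_(y in A) f x y) (\int[mu]_(y in A) f' a y).
Proof.
move=> mA uav fi fd fb Gi.
have itvE x : `]u, v[%classic x = (u < x < v) by rewrite /= in_itv.
have aI : `]u, v[%classic a by rewrite itvE.
have E x y : u < x < v -> A y -> partial1of2 f x y = f' x y.
  by move=> ux Ay; rewrite partial1of2E; have := fd x y ux Ay => h; exact: derive_val.
have Gi' : integ A (fun y => `|G y|).
  by rewrite (_ : _ \o _ = abse \o (EFin \o G))//; exact: integrable_abse.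
have H1 : forall x, `]u, v[%classic x -> integ A (f x).
  by move=> x; rewrite itvE; exact: fi.
have H2 : forall x y, `]u, v[%classic x -> A y -> derivable (f ^~ y) x 1.
  by move=> x y; rewrite itvE => ux Ay; have := fd x y ux Ay => h.
have H3 : forall x y, `]u, v[%classic x -> A y -> `|partial1of2 f x y| <= `|G y|.
  move=> x y; rewrite itvE => ux Ay; rewrite E//.
  by apply: le_trans (fb _ _ ux Ay) _; exact: ler_norm.
apply: DeriveDef.
  exact: (@derivable_under_integral _ _ _ mu f A mA a u v aI H1 H2 _ _ Gi' H3).
rewrite -derive1E.
rewrite (@differentiation_under_integral _ _ _ mu f A mA a u v aI H1 H2 _ _ Gi' H3)//.
by apply: eq_Rintegral => y /set_mem Ay; rewrite E.
Qed.

Lemma dominated_Rintegral A (f : nat -> R -> R) (g G : R -> R) :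
  measurable A -> (forall n, measurable_fun A (f n)) ->
  (forall n y, A y -> `|f n y| <= G y) -> integ A G ->
  (forall y, A y -> f n y @[n --> \oo] --> g y) ->
  integ A g /\
  \int[mu]_(y in A) f n y @[n --> \oo] --> \int[mu]_(y in A) g y.
Proof.
move=> mA mf fG Gi fg.
have mg : measurable_fun A g by exact: (measurable_fun_cvg (h := f)).
have [] := @dominated_convergence _ _ _ mu A mA
  (fun n => EFin \o f n) (EFin \o g) (EFin \o G).
- by move=> n; apply/measurable_EFinP; exact: mf.
- exact/measurable_EFinP.
- by apply: aeW => x Ax; apply/fine_cvgP; split; [by apply: nearW|exact: fg].
- exact: Gi.
- by apply: aeW => x n Ax /=; rewrite lee_fin; exact: fG.
- move=> gi _ h; split => //.
  by apply: fine_cvg; rewrite fineK//; exact: integrable_fin_num.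
Qed.

Lemma dominated_at_right A (f : R -> R -> R) (g G : R -> R) d p : p < d ->
  measurable A -> (forall x, p < x < d -> measurable_fun A (f x)) ->
  (forall x y, p < x < d -> A y -> `|f x y| <= G y) -> integ A G ->
  (forall y, A y -> f x y @[x --> p^'+] --> g y) ->
  \int[mu]_(y in A) f x y @[x --> p^'+] --> \int[mu]_(y in A) g y.
Proof.
move=> pd mA mf fG Gi fg; apply/cvg_at_rightP => w [wp wcvg].
have [N _ wN] : \forall n \near \oo, w n < d.
  by apply: (cvgr_lt p) => //.
(* The bound holds only for [x < d], so the first [N] terms of the sequence are dropped. *)
rewrite -(cvg_shiftn N) /=.
apply: (dominated_Rintegral (G := G) mA _ _ Gi _).2.
- by move=> n; apply: mf; rewrite wp wN//= leq_addl.
- by move=> n y Ay; apply: fG; rewrite // wp wN//= leq_addl.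
- move=> y Ay; rewrite (cvg_shiftn N (fun n => f (w n) y)).
  by move/cvg_at_rightP : (fg y Ay); apply.
Qed.

End real_tools.

(** * Fundamental theorem of calculus, dominated integrability, Fubini *)

Section real_integration.
Context {R : realType}.
Implicit Types (f g h : R -> R) (x y a b c : R) (A B : set R).
Local Notation mu := (@lebesgue_measure R).
Local Notation integ A f := (mu.-integrable A (EFin \o f)).

(** The use of [min] and [max] spares every caller from ordering [a] and [b]. *)
Lemma mean_value_bound f (df : R -> R) c a b :
  (forall x, Num.min a b <= x <= Num.max a b -> is_derive x 1 f (df x)) ->
  (forall x, Num.min a b <= x <= Num.max a b -> `|df x| <= c) ->
  `|f b - f a| <= c * `|b - a|.
Proof.
wlog ab : a b / a <= b.
  move=> W; case/orP : (le_total a b) => [ab|ba]; first exact: W.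
  by rewrite minC maxC distrC [`|b - a|]distrC; exact: W.
rewrite (min_idPl ab) (max_idPr ab) => fd fb.
have H1 z : z \in `]a, b[ -> is_derive z 1 f (df z).
  by rewrite in_itv/= => /andP[az zb]; apply: fd; rewrite !ltW.
have H2 : {within `[a, b], continuous f}.
  apply: derivable_within_continuous => z; rewrite in_itv/= => zab.
  by have := fd z zab => h.
have [z zab ->] := MVT_segment ab H1 H2.
by rewrite normrM ler_wpM2r// fb//; move: zab; rewrite in_itv.
Qed.

(** Common core of the fundamental theorem on the half line, on a bounded open interval and on the
    line. It is applied on each compact interval of the exhaustion, and the restrictions of [f]
    converge under the bound given by the modulus of [f]. *)
Lemma Rintegral_exhaust A (f F : R -> R) (a_ b_ : nat -> R) la lb :
  measurable A -> integ A f -> (forall n, a_ n < b_ n) ->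
  (forall n x, a_ n <= x <= b_ n -> A x) ->
  (forall x, A x -> {for x, continuous f}) ->
  (forall x, A x -> is_derive x 1 F (f x)) ->
  (forall x, A x -> \forall n \near \oo, a_ n <= x <= b_ n) ->
  F (a_ n) @[n --> \oo] --> la -> F (b_ n) @[n --> \oo] --> lb ->
  \int[mu]_(x in A) f x = lb - la.
Proof.
move=> mA fi ab abA cf dF exh Fa Fb.
have fin n : \int[mu]_(x in `[a_ n, b_ n]) f x = F (b_ n) - F (a_ n).
  rewrite /Rintegral (@continuous_FTC2 R f F)//.
  - apply: continuous_in_subspaceT => x /set_mem/=; rewrite in_itv/= => xab.
    by apply: cf; exact: abA xab.
  - split.
    + move=> x; rewrite in_itv/= => /andP[ax xb].
      by have := dF x (abA n x _); rewrite !ltW// => /(_ isT) h.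
    + have /is_derive_cont h : is_derive (a_ n) 1 F (f (a_ n)).
        by apply: dF; apply: (abA n); rewrite lexx ltW.
      exact: cvg_at_right_filter.
    + have /is_derive_cont h : is_derive (b_ n) 1 F (f (b_ n)).
        by apply: dF; apply: (abA n); rewrite lexx ltW.
      exact: cvg_at_left_filter.
  - move=> x; rewrite in_itv/= => /andP[ax xb]; rewrite derive1E.
    have := dF x (abA n x _); rewrite !ltW// => /(_ isT) h.
    exact: derive_val.
have mf : measurable_fun A f by move/integrableP : fi => [/measurable_EFinP].
pose fn n := f \_ `[a_ n, b_ n].
have fi' : integ A (fun x => `|f x|).
  by rewrite (_ : _ \o _ = abse \o (EFin \o f))//; exact: integrable_abse.
have [|||_ H] := @dominated_Rintegral R A fn f (fun x => `|f x|) mA _ _ fi' _.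
- move=> n; apply/measurable_restrict => //.
  by apply: measurable_funS mf.
- move=> n y Ay; rewrite /fn patchE; case: ifP => _ //.
  by rewrite normr0.
- move=> y Ay; apply: (cvg_trans _ (@cvg_cst _ (f y) _ \oo _)).
  apply: near_eq_cvg; have := exh y Ay; apply: filterS => n nab.
  by rewrite /fn patchE mem_set//= in_itv.
have E n : \int[mu]_(x in A) fn n x = F (b_ n) - F (a_ n).
  rewrite -fin -Rintegral_mkcondr; congr (Rintegral _ _ _).
  apply/seteqP; split => [x []//|x xab]; split => //; apply: (abA n).
  by move: xab; rewrite /= in_itv.
move: H; under eq_fun do rewrite E.
move=> H; apply: (cvg_unique _ H) => //.
exact: cvgB.
Qed.

Lemma cvg_invS : (n.+1%:R^-1 : R) @[n --> \oo] --> (0 : R).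
Proof. exact: cvg_harmonic. Qed.

Lemma Rintegral_FTC_y (f F : R -> R) l0 ly : integ `]0, +oo[ f ->
  (forall x, 0 < x -> {for x, continuous f}) ->
  (forall x, 0 < x -> is_derive x 1 F (f x)) ->
  F x @[x --> 0^'+] --> l0 -> F x @[x --> +oo] --> ly ->
  \int[mu]_(x in `]0, +oo[) f x = ly - l0.
Proof.
move=> fi cf dF F0 Fy.
have P x : `]0, +oo[%classic x = (0 < x) by rewrite /= in_itv/= andbT.
apply: (@Rintegral_exhaust _ f F (fun n => n.+1%:R^-1) (fun n => n.+2%:R)) => //.
- move=> n; apply: (@le_lt_trans _ _ 1); last by rewrite ltr1n.
  by rewrite invf_le1// ler1n.
- move=> n x /andP[nx _]; rewrite P; apply: lt_le_trans nx.
  by rewrite invr_gt0.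
- by move=> x; rewrite P; exact: cf.
- by move=> x; rewrite P; exact: dF.
- move=> x; rewrite P => x0; near=> n; apply/andP; split.
    by near: n; apply: (cvgr_le 0 cvg_invS).
  apply: ltW; near: n.
  have := @cvgr_idn R => /cvgryPgt/(_ x); apply: filterS => n /lt_trans; apply.
  by rewrite ltr_nat ltnS leqW.
- move/cvg_at_rightP : F0; apply; split; last exact: cvg_invS.
  by move=> n; rewrite invr_gt0.
- apply: (cvg_comp _ _ _ Fy).
  apply/cvgryPgt => M; have := @cvgr_idn R => /cvgryPgt/(_ M).
  by apply: filterS => n /lt_trans; apply; rewrite ltr_nat ltnS leqW.
Unshelve. all: by end_near. Qed.

Lemma Rintegral_FTC_oo (f F : R -> R) t l0 lt : 0 < t -> integ `]0, t[ f ->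
  (forall x, 0 < x < t -> {for x, continuous f}) ->
  (forall x, 0 < x < t -> is_derive x 1 F (f x)) ->
  F x @[x --> 0^'+] --> l0 -> F x @[x --> t^'-] --> lt ->
  \int[mu]_(x in `]0, t[) f x = lt - l0.
Proof.
move=> t0 fi cf dF F0 Ft.
have P x : `]0, t[%classic x = (0 < x < t) by rewrite /= in_itv.
(* The factor [t / 3] ensures [e n < t - e n] already for [n = 0]. *)
pose e n : R := t / 3 * n.+1%:R^-1.
have e0 n : 0 < e n by rewrite mulr_gt0// ?invr_gt0// divr_gt0.
have e1 n : e n <= t / 3.
  apply: ler_piMr; first by rewrite ltW// divr_gt0.
  by rewrite invf_le1// ler1n.
have ecvg : e n @[n --> \oo] --> 0.
  by rewrite -(mulr0 (t / 3)); apply: cvgMr; exact: cvg_invS.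
apply: (@Rintegral_exhaust _ f F e (fun n => t - e n)) => //.
- by move=> n; have := e1 n; lra.
- by move=> n x; have := e0 n; have := e1 n; rewrite P; lra.
- move=> x; rewrite P => /andP[x0 xt]; near=> n.
  have : e n <= x by near: n; apply: (cvgr_le 0 ecvg).
  have : e n <= t - x by near: n; apply: (cvgr_le 0 ecvg); rewrite subr_gt0.
  by lra.
- by move/cvg_at_rightP : F0; apply; split.
- move/cvg_at_leftP : Ft; apply; split.
    by move=> n; have := e0 n; lra.
  by rewrite -[X in _ --> X]subr0; apply: cvgB => //; exact: cvg_cst.
Unshelve. all: by end_near. Qed.

(** This is the standard dominating function of the development: integrands on unbounded sets are
    compared with a multiple of it, which avoids a separate integrability proof for each. *)
Lemma integrable_oneDsqrV A : measurable A -> integ A (fun x => (1 + x ^+ 2)^-1).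
Proof.
move=> mA; apply: (@integrableS _ _ _ mu setT) => //.
have m1 : measurable_fun [set: R] (fun x : R => (1 + x ^+ 2)^-1).
  by apply: continuous_measurable_fun => x; exact: continuous_oneDsqrV.
apply/integrableP; split; first exact/measurable_EFinP.
apply/abse_integralP => //; first exact/measurable_EFinP.
rewrite (@ge0_symfun_integralT R (fun x => (1 + x ^+ 2)^-1)).
- rewrite (_ : [set x | _] = `[0, +oo[%classic); last first.
    by apply/seteqP; split => x/=; rewrite in_itv/= andbT.
  by have := @integral0y_oneDsqr R; rewrite /oneDsqr => ->; rewrite -EFinM ltry.
- by move=> x; rewrite invr_ge0 addr_ge0// sqr_ge0.
- by move=> x; exact: continuous_oneDsqrV.
- by move=> x /=; rewrite sqrrN.
Qed.

Lemma integrable_dominated_oneDsqrV A f c : measurable A -> measurable_fun A f ->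
  (forall x, A x -> `|f x| <= c * (1 + x ^+ 2)^-1) -> integ A f.
Proof.
move=> mA mf fc; apply: (integrable_dominated mA mf fc).
rewrite (_ : _ \o _ = fun x => c%:E * ((1 + x ^+ 2)^-1)%:E)%E; last first.
  by apply/funext => x; rewrite /= EFinM.
by apply: integrableZl => //; exact: integrable_oneDsqrV.
Qed.

Lemma integrable_dominated_itv a b f c : measurable_fun `]a, b[ f ->
  (forall x, a < x < b -> `|f x| <= c) -> integ `]a, b[ f.
Proof.
move=> mf fc; apply: (@integrable_dominated _ _ f (fun=> c)) => //.
apply/integrableP; split; first exact/measurable_EFinP.
rewrite /= integral_cst//= lebesgue_measure_itv/=; case: ifP => _.
  by rewrite -EFinB -EFinM ltry.
by rewrite mule0 ltry.
Qed.

(** From [expR (x / k) >= x / k], raised to the power [k]. For [k = 0] the right-hand side is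
    [0 ^+ 0 = 1]. *)
Lemma pow_expR_le k x : 0 <= x -> x ^+ k * expR (- x) <= k%:R ^+ k.
Proof.
case: k => [|k] x0; first by rewrite !expr0 mul1r -expR0 ler_expR oppr_le0.
rewrite expRN ler_pdivrMr ?expR_gt0//.
have -> : expR x = expR (x / k.+1%:R) ^+ k.+1.
  by rewrite -expRM_natr divfK// pnatr_eq0.
rewrite -exprMn lerXn2r ?nnegrE ?mulr_ge0 ?expR_ge0//.
rewrite -ler_pdivrMl// mulrC.
by apply: le_trans (expR_ge1Dx _); rewrite lerDr.
Qed.

(** The product bound gives absolute integrability by Tonelli, once all functions are extended by 0
    to the plane. The first conclusion is kept because linearity of the outer integral is used
    later. *)
Lemma Fubini_set A B (f : R -> R -> R) (a b : R -> R) :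
  measurable A -> measurable B ->
  measurable_fun (A `*` B) (fun p : R * R => f p.1 p.2) ->
  (forall x y, A x -> B y -> `|f x y| <= a x * b y) ->
  integ A a -> integ B b ->
  integ A (fun x => \int[mu]_(y in B) f x y) /\
  \int[mu]_(x in A) \int[mu]_(y in B) f x y =
  \int[mu]_(y in B) \int[mu]_(x in A) f x y.
Proof.
move=> mA mB mf fab ia ib.
pose F : R * R -> R := (fun p : R * R => f p.1 p.2) \_ (A `*` B).
have mAB : measurable (A `*` B) by exact: measurableX.
have mF : measurable_fun [set: R * R] F.
  by apply/(measurable_restrictT _ _).1.
pose a' := (fun x => `|a x|) \_ A; pose b' := (fun x => `|b x|) \_ B.
have ia' : integ setT a'.
  have := (@integrable_mkcond _ _ _ mu A (EFin \o (fun x => `|a x|)) mA).1.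
  by rewrite restrict_EFin; apply; exact: (integrable_abse ia).
have ib' : integ setT b'.
  have := (@integrable_mkcond _ _ _ mu B (EFin \o (fun x => `|b x|)) mB).1.
  by rewrite restrict_EFin; apply; exact: (integrable_abse ib).
have mFx x : measurable_fun setT (fun y => F (x, y)).
  by apply: (measurableT_comp mF); exact: pair1_measurable.
have mFy y : measurable_fun setT (fun x => F (x, y)).
  by apply: (measurableT_comp mF); exact: pair2_measurable.
have Fab x y : `|F (x, y)| <= a' x * b' y.
  rewrite /F /a' /b' !patchE.
  case: ifPn => [/set_mem[/= Ax By]|].
    rewrite !mem_set// -normrM; apply: le_trans (fab _ _ Ax By) _.
    exact: ler_norm.
  by rewrite normr0 => _; rewrite mulr_ge0//; case: ifP.
have ab_int x : mu.-integrable setT (fun y => (a' x)%:E * (b' y)%:E)%E.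
  by apply: integrableZl.
have ab_E x : (\int[mu]_y ((a' x)%:E * (b' y)%:E) =
    (a' x)%:E * (\int[mu]_y (b' y)%:E))%E.
  by rewrite integralZl.
have b_fin : (\int[mu]_y (b' y)%:E)%E \is a fin_num by exact: integrable_fin_num.
have a_int : mu.-integrable setT
    (fun x => \int[mu]_y ((a' x)%:E * (b' y)%:E))%E.
  under eq_fun do rewrite ab_E muleC -(fineK b_fin).
  exact: integrableZl.
have FI : (mu \x mu)%E.-integrable setT (EFin \o F).
  apply/integrable12ltyP; first exact/measurable_EFinP.
  apply: (@le_lt_trans _ _ (\int[mu]_x \int[mu]_y ((a' x)%:E * (b' y)%:E))%E).
    apply: ge0_le_integral => //.
    - by move=> x _; exact: integral_ge0.
    - apply: (measurable_fun_fubini_tonelli_F (m2 := mu) (fun p => `|(F p)%:E|%E)) => //.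
      by apply: measurableT_comp => //; exact/measurable_EFinP.
    - exact: (measurable_int mu).
    - move=> x _; apply: ge0_le_integral => //.
      + by apply: measurableT_comp => //; apply/measurable_EFinP; exact: mFx.
      + exact: (measurable_int mu).
      + by move=> y _; rewrite -EFinM lee_fin; exact: Fab.
  have := integrable_fin_num _ a_int; rewrite ge0_fin_numE; first by apply.
  apply: integral_ge0 => x _; apply: integral_ge0 => y _.
  by rewrite -EFinM lee_fin; apply: le_trans (Fab x y).
have Fx_int x : integ setT (fun y => F (x, y)).
  apply: (integrable_dominated (g := fun y => a' x * b' y)) => //.
  have := ab_int x; congr (integrable _ _ _).
have Fy_int y : integ setT (fun x => F (x, y)).
  apply: (integrable_dominated (g := fun x => b' y * a' x)) => //.
    by move=> x _; rewrite mulrC; exact: Fab.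
  exact: (integrableZl measurableT (b' y) ia').
have FE x : A x -> \int[mu]_(y in B) f x y = \int[mu]_y F (x, y).
  move=> Ax; rewrite Rintegral_mkcond; apply: eq_Rintegral => y _.
  rewrite /F !patchE; case: ifPn => [/set_mem By|yB]; first by rewrite mem_set.
  by rewrite memNset//= => -[_ By]; move: yB; rewrite mem_set.
have FE0 x : ~ A x -> \int[mu]_y F (x, y) = 0.
  move=> Ax; rewrite -[RHS](Rintegral_set0 mu (fun=> 0)) [RHS]Rintegral_mkcond.
  apply: eq_Rintegral => y _; rewrite /F !patchE in_set0 memNset//.
  by move=> /= -[].
have FyE y : B y -> \int[mu]_(x in A) f x y = \int[mu]_x F (x, y).
  move=> By; rewrite Rintegral_mkcond; apply: eq_Rintegral => x _.
  rewrite /F !patchE; case: ifPn => [/set_mem Ax|xA]; first by rewrite mem_set.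
  by rewrite memNset//= => -[Ax _]; move: xA; rewrite mem_set.
have FyE0 y : ~ B y -> \int[mu]_x F (x, y) = 0.
  move=> By; rewrite -[RHS](Rintegral_set0 mu (fun=> 0)) [RHS]Rintegral_mkcond.
  apply: eq_Rintegral => x _; rewrite /F !patchE in_set0 memNset//.
  by move=> /= -[].
have EX x : (\int[mu]_y F (x, y))%:E = (\int[mu]_y (F (x, y))%:E)%E.
  by rewrite /Rintegral fineK//; exact: (integrable_fin_num measurableT (Fx_int x)).
have EY y : (\int[mu]_x F (x, y))%:E = (\int[mu]_x (F (x, y))%:E)%E.
  by rewrite /Rintegral fineK//; exact: (integrable_fin_num measurableT (Fy_int y)).
have PA : (fun x => \int[mu]_(y in B) f x y) \_ A = fun x => \int[mu]_y F (x, y).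
  apply/funext => x; rewrite patchE; case: ifPn => [/set_mem|] Ax.
    exact: FE.
  by rewrite FE0// => ?; move: Ax; rewrite mem_set.
have PB : (fun y => \int[mu]_(x in A) f x y) \_ B = fun y => \int[mu]_x F (x, y).
  apply/funext => y; rewrite patchE; case: ifPn => [/set_mem|] By.
    exact: FyE.
  by rewrite FyE0// => ?; move: By; rewrite mem_set.
split.
  apply/(@integrable_mkcond _ _ _ mu A _ mA).2; rewrite restrict_EFin PA.
  rewrite (_ : _ \o _ = fun x => \int[mu]_y (F (x, y))%:E)%E; last exact/funext.
  exact: (integrable_fubini_F FI).
rewrite [LHS]Rintegral_mkcond [RHS]Rintegral_mkcond PA PB /Rintegral.
congr fine; under eq_integral do rewrite EX.
under [RHS]eq_integral do rewrite EY.
exact: (Fubini FI).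
Qed.

End real_integration.

(** * Automatic computation of derivatives *)

Lemma is_derive_eqf {R : realType} (f : R -> R) (x df df' : R) :
  is_derive x 1 f df -> df = df' -> is_derive x 1 f df'.
Proof. by move=> h <-. Qed.

(** A placeholder, redefined once the derivative of [Phi] is known so that [drv] handles it too. *)
Ltac drv_hook := fail.

(* [notypeclasses] keeps instance resolution from picking pointfree rules. *)
Ltac drv :=
  lazymatch goal with
  | |- is_derive _ _ (fun _ => ?c) _ => exact: is_derive_cf
  | |- is_derive _ _ (fun y => y) _ => exact: is_derive_idf
  | |- is_derive _ _ (fun y => @?a y + @?b y) _ =>
      notypeclasses refine (@is_deriveDf _ a b _ _ _ _ _); [drv|drv]
  | |- is_derive _ _ (fun y => - @?a y) _ =>
      notypeclasses refine (@is_deriveNf _ a _ _ _); drv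
  | |- is_derive _ _ (fun y => @?a y * @?b y) _ =>
      notypeclasses refine (@is_deriveMf _ a b _ _ _ _ _); [drv|drv]
  | |- is_derive _ _ (fun y => (@?a y)^-1) _ =>
      notypeclasses refine (@is_deriveVf _ a _ _ _ _); [|drv]
  | |- is_derive _ _ (fun y => @?a y ^+ ?n) _ =>
      notypeclasses refine (@is_deriveXf _ n a _ _ _); drv
  | |- is_derive _ _ (fun y => expR (@?a y)) _ =>
      notypeclasses refine (@is_derive_compf _ expR a _ _ _ _ _);
      [exact: is_derive_expR|drv]
  | |- is_derive _ _ (fun y => sin (@?a y)) _ =>
      notypeclasses refine (@is_derive_compf _ sin a _ _ _ _ _);
      [exact: is_derive_sin|drv]
  | |- is_derive _ _ (fun y => cos (@?a y)) _ =>
      notypeclasses refine (@is_derive_compf _ cos a _ _ _ _ _);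
      [exact: is_derive_cos|drv]
  | _ => first [drv_hook | try eassumption]
  end.

(** The derivative is computed as an unknown, and its equality with the expected one is left for
    [ring] or [field]. *)
Ltac drve := notypeclasses refine (@is_derive_eqf _ _ _ _ _ _ _); [drv|]; cbv beta.

(** * The heat kernel *)

Section normal_cdf.
Context {R : realType}.
Implicit Types (x s t a b c : R) (A : set R).
Local Notation mu := (@lebesgue_measure R).
Local Notation integ A f := (mu.-integrable A (EFin \o f)).

(** Since [gauss_fun x] is exp(-x^2), this is (1 + erf x) / 2, the distribution function of the
    centered normal law of variance 1/2. *)
Definition Phi x : R :=
  \int[mu]_(y in `]-oo, x]) gauss_fun y / Num.sqrt pi.

Lemma sqrt_pi_gt0 : 0 < Num.sqrt pi :> R.
Proof. by rewrite sqrtr_gt0 pi_gt0. Qed.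

Lemma integrable_gauss A : measurable A -> integ A gauss_fun.
Proof. by move=> mA; apply: (@integrableS _ _ _ mu setT) => //; exact: integrableT_gauss. Qed.

Lemma is_derive_Phi x : is_derive x 1 Phi (gauss_fun x / Num.sqrt pi).
Proof.
have [||||] := @continuous_FTC1 R gauss_fun -oo%O x (x + 1).
- by rewrite ltrDl.
- exact: integrable_gauss.
- exact: ltNyr.
- exact: continuous_gauss_fun.
move=> d1 d2.
have h : is_derive x 1 (fun x => \int[mu]_(y in `]-oo, x]) gauss_fun y) (gauss_fun x).
  by rewrite -d2 derive1E; exact: derivableP.
by rewrite /Phi; drve; rewrite mulr0 addr0.
Qed.

(** One dominated convergence serves both ends of the line: the truncations tend to [gauss_fun] or
    to 0. *)
Lemma Phi_seq (z : nat -> R) (g : R -> R) :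
  (forall y, (gauss_fun \_ `]-oo, z n]) y @[n --> \oo] --> g y) ->
  \int[mu]_(y in `]-oo, z n]) gauss_fun y @[n --> \oo] --> \int[mu]_y g y.
Proof.
move=> zg.
have H := (@dominated_Rintegral R setT (fun n => gauss_fun \_ `]-oo, z n]) g gauss_fun
  measurableT _ _ (integrable_gauss measurableT) _).2.
under eq_fun do rewrite Rintegral_mkcond.
apply: H => //.
- move=> n; apply/(measurable_restrictT _ _).1 => //.
  exact: measurable_funS (@measurable_gauss_fun R).
- move=> n y _; rewrite patchE; case: ifP => _; rewrite ?normr0 ?gauss_fun_ge0//.
  by rewrite ger0_norm ?gauss_fun_ge0.
Qed.

Lemma cvgy_Phi : Phi x @[x --> +oo] --> (1 : R).
Proof.
have -> : 1 = \int[mu]_y gauss_fun y / Num.sqrt pi :> R.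
  by rewrite /Rintegral integralT_gauss/= divff// gt_eqF// sqrt_pi_gt0.
apply: cvgMl; apply/cvg_pinftyP => z zy; apply: Phi_seq => y.
apply: (cvg_trans _ (@cvg_cst _ (gauss_fun y) _ \oo _)).
apply: near_eq_cvg; move/cvgryPge : zy => /(_ y); apply: filterS => n yz.
by rewrite patchE mem_set//= in_itv.
Qed.

Lemma cvgNy_Phi : Phi x @[x --> -oo] --> (0 : R).
Proof.
have E0 : \int[mu]_(y in setT) (0 : R) = 0 by rewrite Rintegral_cst// mul0r.
rewrite -[X in _ --> X](mul0r (Num.sqrt pi)^-1) -E0.
apply: cvgMl; apply/cvg_ninftyP => z zy; apply: Phi_seq => y.
apply: (cvg_trans _ (@cvg_cst _ (0 : R) _ \oo _)).
apply: near_eq_cvg; move/cvgrNyPlt : zy => /(_ y); apply: filterS => n yz.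
by rewrite patchE memNset//= in_itv/= leNgt yz.
Qed.

End normal_cdf.

Ltac drv_hook ::=
  lazymatch goal with
  | |- is_derive _ _ (fun y => Phi (@?a y)) _ =>
      notypeclasses refine (@is_derive_compf _ Phi a _ _ _ _ _);
      [exact: is_derive_Phi|drv]
  end.

Section normal_cdf_symmetry.
Context {R : realType}.
Implicit Types x : R.

(** The sum has derivative 0 because [gauss_fun] is even, and its limit at infinity is 1 + 0. *)
Lemma Phi_symm x : Phi x + Phi (- x) = 1.
Proof.
have d (z : R) : is_derive z 1 (fun z => Phi z + Phi (- z)) 0.
  by drve; rewrite /gauss_fun sqrrN; ring.
have l : (Phi z + Phi (- z)) @[z --> +oo] --> (1 + 0 : R).
  apply: cvgD; first exact: cvgy_Phi.
  by apply: (cvg_comp _ _ _ cvgNy_Phi); apply/cvgNry;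
    rewrite (_ : - _ = @id R) //; apply/funext => z; exact: opprK.
rewrite addr0 in l.
have E z : Phi z + Phi (- z) = Phi x + Phi (- x).
  exact: (is_derive_0_is_cst (f := fun z => Phi z + Phi (- z))).
move: l; under eq_fun do rewrite E.
by move=> /(cvg_unique _ (cvg_cst _)); apply.
Qed.

Lemma Phi_0 : Phi (0 : R) = 2^-1.
Proof. by have := Phi_symm (0 : R); rewrite oppr0; lra. Qed.

Lemma Phi_ge0 x : 0 <= Phi x.
Proof.
apply: mulr_ge0; last by rewrite invr_ge0 sqrtr_ge0.
by apply: Rintegral_ge0 => y _; exact: gauss_fun_ge0.
Qed.

Lemma Phi_le1 x : Phi x <= 1.
Proof. by have := Phi_symm x; have := Phi_ge0 (- x); lra. Qed.

End normal_cdf_symmetry.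

(** * Derivatives of the heat kernel and their bounds *)

Section heat_kernel.
Context {R : realType}.
Implicit Types (x s t a b c d : R).

(* [Hk 0] is an antiderivative in [x] of the heat kernel [Hk 1]; the Hermite-type
   recursion makes [d/dx] a shift by 1 and [d/ds] a shift by 2 of the index. *)
Fixpoint Hk (n : nat) x s : R :=
  match n with
  | 0 => Phi (x / (2 * Num.sqrt s))
  | S m => match m with
    | 0 => expR (- (x ^+ 2 / (4 * s))) / (2 * Num.sqrt pi * Num.sqrt s)
    | S k => - (2 * s)^-1 * (x * Hk m x s + k%:R * Hk k x s)
    end
  end.

Lemma HkSS n x s : Hk n.+2 x s = - (2 * s)^-1 * (x * Hk n.+1 x s + n%:R * Hk n x s).
Proof. by []. Qed.

Lemma gauss_Hk x s : 0 < s ->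
  gauss_fun (x / (2 * Num.sqrt s)) / Num.sqrt pi = 2 * Num.sqrt s * Hk 1 x s.
Proof.
move=> s0; have s1 : Num.sqrt s != 0 by rewrite gt_eqF// sqrtr_gt0.
have p1 : Num.sqrt pi != 0 :> R by rewrite gt_eqF// sqrt_pi_gt0.
rewrite /gauss_fun /= expr_div_n exprMn sqr_sqrtr ?ltW//.
have -> : (2 : R) ^+ 2 = 4 by ring.
by field; rewrite s1.
Qed.

Lemma Hk_dx n x s : 0 < s -> is_derive x 1 (Hk n ^~ s) (Hk n.+1 x s).
Proof.
move=> s0; have s1 : Num.sqrt s != 0 by rewrite gt_eqF// sqrtr_gt0.
have p1 : Num.sqrt pi != 0 :> R by rewrite gt_eqF// sqrt_pi_gt0.
have s2 : s != 0 by rewrite gt_eqF.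
(* The recursion reaches two steps back, so two consecutive orders are carried through the
   induction. *)
suff: is_derive x 1 (Hk n ^~ s) (Hk n.+1 x s) /\
      is_derive x 1 (Hk n.+1 ^~ s) (Hk n.+2 x s) by case.
elim: n => [|n [h1 h2]]; last first.
  split => //; rewrite (_ : Hk n.+2 ^~ s = fun y =>
    - (2 * s)^-1 * (y * Hk n.+1 y s + n%:R * Hk n y s))//.
  by drve; rewrite !HkSS -[n.+1%:R]natr1; field.
split.
  rewrite (_ : Hk 0 ^~ s = fun y => Phi (y / (2 * Num.sqrt s)))//.
  by drve; rewrite gauss_Hk// mulr0 addr0 mul1r; field; rewrite s1.
rewrite (_ : Hk 1 ^~ s = fun y =>
  expR (- (y ^+ 2 / (4 * s))) / (2 * Num.sqrt pi * Num.sqrt s))//.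
by drve; rewrite HkSS /=; field; rewrite ?s1 ?s2 ?p1.
Qed.

(** The heat equation. Orders 0 and 1 are computed by hand, and the Hermite recursion propagates
    it. *)
Lemma Hk_ds n x s : 0 < s -> is_derive s 1 (Hk n x) (Hk n.+2 x s).
Proof.
move=> s0; have s1 : Num.sqrt s != 0 by rewrite gt_eqF// sqrtr_gt0.
have p1 : Num.sqrt pi != 0 :> R by rewrite gt_eqF// sqrt_pi_gt0.
have s2 : s != 0 by rewrite gt_eqF.
have ss : Num.sqrt s ^+ 2 = s by rewrite sqr_sqrtr// ltW.
have dsq : is_derive s 1 Num.sqrt (2 * Num.sqrt s)^-1 by exact: is_derive1_sqrt.
have d0 : is_derive s 1 (Hk 0 x) (Hk 2 x s).
  rewrite (_ : Hk 0 x = fun s => Phi (x / (2 * Num.sqrt s)))//.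
  drve; first by rewrite mulf_neq0.
  rewrite gauss_Hk// HkSS; move: (Hk 1 x s) (Hk 0 x s) => E G.
  (* Replacing [s] by [q ^+ 2] makes the identity rational in [q]. *)
  by set q := Num.sqrt s in s1 ss *; rewrite -ss; field.
have d1 : is_derive s 1 (Hk 1 x) (Hk 3 x s).
  change (is_derive s 1 (fun s =>
    expR (- (x ^+ 2 / (4 * s))) / (2 * Num.sqrt pi * Num.sqrt s)) (Hk 3 x s)).
  drve; [by rewrite mulf_neq0|by rewrite !mulf_neq0|].
  rewrite !HkSS /=; set E := expR _.
  set q := Num.sqrt s in s1 ss *; rewrite -ss; field; rewrite s1 p1.
  done.
suff: is_derive s 1 (Hk n x) (Hk n.+2 x s) /\
      is_derive s 1 (Hk n.+1 x) (Hk n.+3 x s) by case.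
elim: n => [//|n [h1 h2]]; split => //.
rewrite (_ : Hk n.+2 x = fun s =>
    - (2 * s)^-1 * (x * Hk n.+1 x s + n%:R * Hk n x s))//.
drve; first by rewrite mulf_neq0.
rewrite [Hk n.+4 x s]HkSS [in LHS](HkSS n.+1) [in LHS](HkSS n) [in RHS](HkSS n.+1) [in RHS](HkSS n) -!natr1.
by field.
Qed.

(** Order 0 is excluded because [Phi] tends to 1 at infinity. Order 1 is a Gaussian, and each step
    of the recursion costs one power of [x] and a factor at most [(2 * a)^-1]. *)
Lemma Hk_bound_compact n M a b : 0 < a -> exists2 C, 0 <= C &
  forall s x, a <= s <= b -> `|x| ^+ M * `|Hk n.+1 x s| <= C.
Proof.
move=> a0.
suff: forall M, (exists2 C, 0 <= C &
    forall s x, a <= s <= b -> `|x| ^+ M * `|Hk n.+1 x s| <= C) /\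
   (exists2 C, 0 <= C &
    forall s x, a <= s <= b -> `|x| ^+ M * `|Hk n.+2 x s| <= C).
  by move=> /(_ M)[].
(* The weight [k%:R] makes the hypothesis trivial for [k = 0]: the recursion multiplies the
   non-decaying [Hk 0] by 0. *)
have step (m : nat) (P := fun k => forall M, exists2 C, 0 <= C &
    forall s x, a <= s <= b -> `|x| ^+ M * (k%:R * `|Hk k x s|) <= C) :
    P m -> P m.+1 -> forall M, exists2 C, 0 <= C &
    forall s x, a <= s <= b -> `|x| ^+ M * `|Hk m.+2 x s| <= C.
  move=> h1 h2 {}M; have [C1 C10 H1] := h1 M; have [C2 C20 H2] := h2 M.+1.
  exists ((2 * a)^-1 * (C2 + C1)).
    by rewrite mulr_ge0 ?addr_ge0// invr_ge0 mulr_ge0// ltW.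
  move=> s x sab; have s0 : 0 < s by lra.
  rewrite HkSS normrM mulrCA; apply: ler_pM => //.
  - rewrite normrN ger0_norm; last by rewrite invr_ge0; lra.
    by rewrite lef_pV2 ?posrE; lra.
  - apply: (@le_trans _ _ (`|x| ^+ M.+1 * (m.+1%:R * `|Hk m.+1 x s|) +
        `|x| ^+ M * (m%:R * `|Hk m x s|))); last by rewrite lerD// ?H1 ?H2.
    apply: (@le_trans _ _ (`|x| ^+ M * (`|x| * `|Hk m.+1 x s| + m%:R * `|Hk m x s|))).
      rewrite ler_wpM2l ?exprn_ge0//; apply: le_trans (ler_normD _ _) _.
      by rewrite !normrM [`|m%:R|]ger0_norm.
    rewrite mulrDr lerD2r mulrA exprSr ler_wpM2l ?mulr_ge0 ?exprn_ge0//.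
    by rewrite ler_peMl// ler1n.
have base M' : exists2 C, 0 <= C &
    forall s x, a <= s <= b -> `|x| ^+ M' * `|Hk 1 x s| <= C.
  pose c := (2 * Num.sqrt pi * Num.sqrt a)^-1.
  have c0 : 0 <= c by rewrite invr_ge0 !mulr_ge0 ?sqrtr_ge0.
  exists ((1 + `|4 * b| ^+ M' * M'%:R ^+ M') * c).
    by rewrite mulr_ge0// addr_ge0// mulr_ge0 ?exprn_ge0.
  move=> s x /andP[sa sb]; have s0 : 0 < s by apply: lt_le_trans sa.
  rewrite /= normrM [`|expR _|]ger0_norm ?expR_ge0// mulrA.
  apply: ler_pM => //.
    set r := x ^+ 2 / (4 * s).
    have r0 : 0 <= r by rewrite divr_ge0 ?sqr_ge0// mulr_ge0// ltW.
    have e1 : expR (- r) <= 1 by rewrite -expR0 ler_expR oppr_le0.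
    have E : `|x| ^+ M' ^+ 2 = (4 * s) ^+ M' * r ^+ M'.
      rewrite -exprMn /r mulrC divfK ?mulf_neq0 ?gt_eqF//.
      by rewrite -exprM mulnC exprM real_normK// num_real.
    (* The exponential controls powers of [r], that is, even powers of [x]; the weight is therefore
       replaced by 1 plus its square. *)
    apply: (@le_trans _ _ ((1 + `|x| ^+ M' ^+ 2) * expR (- r))).
      rewrite ler_wpM2r ?expR_ge0//.
      have := sqr_ge0 (`|x| ^+ M' - 1 / 2); set w := `|x| ^+ M'; nra.
    rewrite mulrDl mul1r lerD// E -mulrA; apply: ler_pM.
    - by rewrite exprn_ge0// mulr_ge0// ltW.
    - by rewrite mulr_ge0 ?exprn_ge0 ?expR_ge0.
    - rewrite lerXn2r ?nnegrE ?mulr_ge0 ?(ltW s0)//.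
      by apply: le_trans (ler_norm _); rewrite ler_pM2l.
    - exact: pow_expR_le.
  rewrite ger0_norm ?invr_ge0 ?mulr_ge0 ?sqrtr_ge0// /c.
  rewrite lef_pV2 ?posrE ?mulr_gt0 ?sqrtr_gt0 ?pi_gt0//.
  by rewrite ler_wpM2l ?mulr_ge0 ?sqrtr_ge0// ler_wsqrtr.
have scale k M' : (exists2 C, 0 <= C &
    forall s x, a <= s <= b -> `|x| ^+ M' * `|Hk k x s| <= C) ->
   exists2 C, 0 <= C &
    forall s x, a <= s <= b -> `|x| ^+ M' * (k%:R * `|Hk k x s|) <= C.
  move=> [C C0 HC]; exists (k%:R * C); first by rewrite mulr_ge0.
  by move=> s x sab; rewrite mulrCA ler_wpM2l// HC.
elim: n => [|n IH] {}M; last first.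
  split; first by have [] := IH M.
  by apply: step => M'; apply: scale; have [] := IH M'.
split; first exact: base.
apply: step => M'; last by apply: scale; exact: base.
by exists 0 => // s x _; rewrite mul0r mulr0.
Qed.

End heat_kernel.

Section heat_kernel_bounds.
Context {R : realType}.
Implicit Types (x s t a b c d : R).

(** Away from [x = 0] the factor exp(-x^2 / 4s) beats every negative power of [s], so the kernels
    vanish to infinite order at [s = 0]. *)
Lemma Hk_bound_small n M k d b : 0 < d -> exists2 C, 0 <= C &
  forall s x, 0 < s <= b -> d <= `|x| -> `|x| ^+ M * `|Hk n.+1 x s| <= C * s ^+ k.
Proof.
move=> d0.
pose P m := forall M k, exists2 C, 0 <= C & forall s x, 0 < s <= b -> d <= `|x| ->
  `|x| ^+ M * (m%:R * `|Hk m x s|) <= C * s ^+ k.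
pose Q m := forall M k, exists2 C, 0 <= C & forall s x, 0 < s <= b -> d <= `|x| ->
  `|x| ^+ M * `|Hk m x s| <= C * s ^+ k.
have QP m : Q m -> P m.
  move=> q M' k'; have [C C0 HC] := q M' k'; exists (m%:R * C); first by rewrite mulr_ge0.
  by move=> s x sb dx; rewrite mulrCA -mulrA ler_wpM2l// HC.
have step m : P m -> P m.+1 -> Q m.+2.
  (* The factor [(2 * s)^-1] of the recursion costs one power of [s], hence [k'.+1]. *)
  move=> h1 h2 M' k'; have [C1 C10 H1] := h1 M' k'.+1; have [C2 C20 H2] := h2 M'.+1 k'.+1.
  exists (C2 + C1); first by rewrite addr_ge0.
  move=> s x sb dx; have s0 : 0 < s by case/andP : sb.
  rewrite HkSS normrM mulrCA.
  have -> : (C2 + C1) * s ^+ k' = s^-1 * (C2 * s ^+ k'.+1 + C1 * s ^+ k'.+1).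
    by rewrite exprS; field; rewrite gt_eqF.
  apply: ler_pM => //.
  - rewrite normrN ger0_norm; last by rewrite invr_ge0; lra.
    by rewrite lef_pV2 ?posrE; lra.
  - apply: (@le_trans _ _ (`|x| ^+ M'.+1 * (m.+1%:R * `|Hk m.+1 x s|) +
        `|x| ^+ M' * (m%:R * `|Hk m x s|))); last by rewrite lerD// ?H1 ?H2.
    apply: (@le_trans _ _ (`|x| ^+ M' * (`|x| * `|Hk m.+1 x s| + m%:R * `|Hk m x s|))).
      rewrite ler_wpM2l ?exprn_ge0//; apply: le_trans (ler_normD _ _) _.
      by rewrite !normrM [`|m%:R|]ger0_norm.
    rewrite mulrDr lerD2r mulrA exprSr ler_wpM2l ?mulr_ge0 ?exprn_ge0//.
    by rewrite ler_peMl// ler1n.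
have base : Q 1.
  (* With [M' + L = 2 * K], the power [M' + L] of the modulus of [x] equals [(4 * s * r) ^+ K]; the
     [L] extra powers cost at most the inverse of [d ^+ L]. One power of [s] in [K] beyond [M' + k']
     pays for the square root in the denominator of the kernel, and the leftover powers of [s] are
     bounded through [b]. *)
  move=> M' k'; pose K := (M' + k'.+1)%N; pose L := (M' + k'.+1 + k'.+1)%N.
  pose c := (2 * Num.sqrt pi : R)^-1.
  have D0 : 0 <= (d ^+ L)^-1 by rewrite invr_ge0 exprn_ge0// ltW.
  have c0 : 0 <= c by rewrite invr_ge0 mulr_ge0 ?sqrtr_ge0.
  exists (4 ^+ K * K%:R ^+ K * (d ^+ L)^-1 * c * `|b| ^+ M' * Num.sqrt `|b|).
    by rewrite !mulr_ge0 ?sqrtr_ge0 ?exprn_ge0.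
  move=> s x /andP[s0 sb] dx.
  have q0 : 0 < Num.sqrt s by rewrite sqrtr_gt0.
  rewrite /= normrM [`|expR _|]ger0_norm ?expR_ge0// mulrA.
  set r := x ^+ 2 / (4 * s).
  have r0 : 0 <= r by rewrite divr_ge0 ?sqr_ge0// mulr_ge0// ltW.
  have E : `|x| ^+ M' * `|x| ^+ L = (4 * s) ^+ K * r ^+ K.
    rewrite -exprMn.
    have -> : 4 * s * r = x ^+ 2 by rewrite /r mulrC divfK ?mulf_neq0 ?gt_eqF.
    rewrite -exprD -[x ^+ 2]real_normK ?num_real// -exprM.
    by congr (_ ^+ _); rewrite /L /K; lia.
  have E1 : `|x| ^+ M' * expR (- r) <= (d ^+ L)^-1 * ((4 * s) ^+ K * K%:R ^+ K).
    rewrite ler_pdivlMl ?exprn_gt0//.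
    apply: (@le_trans _ _ (`|x| ^+ L * (`|x| ^+ M' * expR (- r)))).
      rewrite ler_wpM2r ?mulr_ge0 ?exprn_ge0 ?expR_ge0//.
      by rewrite lerXn2r ?nnegrE ?(ltW d0).
    rewrite mulrA [X in X * _]mulrC E -mulrA ler_wpM2l ?exprn_ge0 ?mulr_ge0 ?(ltW s0)//.
    exact: pow_expR_le.
  rewrite ger0_norm; last by rewrite invr_ge0 !mulr_ge0 ?sqrtr_ge0.
  rewrite invfM -/c.
  apply: (@le_trans _ _ ((d ^+ L)^-1 * ((4 * s) ^+ K * K%:R ^+ K) * (c / Num.sqrt s))).
    by rewrite ler_wpM2r// mulr_ge0 ?invr_ge0 ?sqrtr_ge0.
  have -> : (d ^+ L)^-1 * ((4 * s) ^+ K * K%:R ^+ K) * (c / Num.sqrt s) =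
      4 ^+ K * K%:R ^+ K * (d ^+ L)^-1 * c * (s ^+ M' * Num.sqrt s) * s ^+ k'.
    have -> : (4 * s) ^+ K = 4 ^+ K * (s ^+ M' * (s ^+ k' * Num.sqrt s ^+ 2)).
      by rewrite exprMn sqr_sqrtr ?ltW// -exprSr -exprD.
    by field; rewrite !gt_eqF ?exprn_gt0.
  have -> : 4 ^+ K * K%:R ^+ K / d ^+ L * c * `|b| ^+ M' * Num.sqrt `|b| * s ^+ k' =
     4 ^+ K * K%:R ^+ K / d ^+ L * c * (`|b| ^+ M' * Num.sqrt `|b|) * s ^+ k' by ring.
  have sb' : s <= `|b| by apply: le_trans sb (ler_norm _).
  rewrite ler_wpM2r ?exprn_ge0 ?(ltW s0)// ler_wpM2l//.
    by rewrite !mulr_ge0 ?sqrtr_ge0 ?exprn_ge0.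
  apply: ler_pM => //; rewrite ?exprn_ge0 ?sqrtr_ge0 ?(ltW s0)//.
    by rewrite lerXn2r ?nnegrE ?(ltW s0).
  by rewrite ler_wsqrtr.
suff: Q n.+1 /\ Q n.+2 by move=> [q _]; exact: q.
elim: n => [|n [IH1 IH2]]; split => //.
  apply: step; last exact: QP.
  by move=> M' k'; exists 0 => // s x _ _; rewrite !mul0r mulr0.
by apply: step; exact: QP.
Qed.

Lemma Hk0_ge0 x s : 0 <= Hk 0 x s. Proof. exact: Phi_ge0. Qed.

Lemma Hk0_le1 x s : Hk 0 x s <= 1. Proof. exact: Phi_le1. Qed.

Lemma cvg_inv_sqrt : (Num.sqrt s)^-1 @[s --> (0 : R)^'+] --> +oo.
Proof.
apply/cvgryPge => M.
have M0 : 0 < (`|M| + 1)^-1 ^+ 2 by rewrite exprn_gt0// invr_gt0; have := normr_ge0 M; lra.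
near=> s.
have s0 : 0 < s by near: s; exact: nbhs_right_gt.
have sM : s < (`|M| + 1)^-1 ^+ 2 by near: s; exact: nbhs_right_lt.
have : Num.sqrt s <= (`|M| + 1)^-1.
  have p : 0 < (`|M| + 1)^-1 by rewrite invr_gt0; have := normr_ge0 M; lra.
  by rewrite -(ger0_norm (ltW p)) -[`|_^-1|]sqrtr_sqr ler_wsqrtr// ltW.
move=> h; apply: (@le_trans _ _ (`|M| + 1)); first by have := ler_norm M; lra.
rewrite -[leLHS]invrK lef_pV2 ?posrE ?invr_gt0 ?sqrtr_gt0//.
Unshelve. all: by end_near. Qed.

(** As [s] tends to 0 the kernel [Hk 0] becomes the Heaviside step; this is how the initial datum is
    recovered. *)
Lemma Hk0_cvg1 x : 0 < x -> Hk 0 x s @[s --> 0^'+] --> (1 : R).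
Proof.
move=> x0; apply: (cvg_comp _ _ _ cvgy_Phi).
under eq_fun do rewrite invfM mulrA.
have p : 0 < x / 2 by rewrite divr_gt0.
exact: (gt0_cvgMry p cvg_inv_sqrt).
Qed.

Lemma Hk0_cvg0 x : x < 0 -> Hk 0 x s @[s --> 0^'+] --> (0 : R).
Proof.
move=> x0; have nx0 : 0 < - x by rewrite oppr_gt0.
have := Hk0_cvg1 nx0 => h.
rewrite -[X in _ --> X](subrr (1 : R)).
rewrite (_ : Hk 0 x = fun s => 1 - Hk 0 (- x) s); last first.
  by apply/funext => s; rewrite /= mulNr; have := Phi_symm (x / (2 * Num.sqrt s)); lra.
by apply: cvgB => //; exact: cvg_cst.
Qed.

Lemma Hk0_cvg_half s : 0 < s -> Hk 0 x s @[x --> (0 : R)^'+] --> (2^-1 : R).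
Proof.
move=> s0; have := is_derive_cont (Hk_dx 0 0 s0) => h.
have -> : (2^-1 : R) = Hk 0 0 s by rewrite /= mul0r Phi_0.
exact: cvg_at_right_filter.
Qed.

(* Subtracting 1 from [Hk 0] makes the extension by 0 smooth across [s = 0] when
   [0 < x]. *)
Definition Hz (n : nat) x s : R := if s <= 0 then 0 else Hk n x s - (n == 0%N)%:R.

Lemma Hz_pos n x s : 0 < s -> Hz n x s = Hk n x s - (n == 0%N)%:R.
Proof. by rewrite /Hz leNgt => ->. Qed.

Lemma HzS_pos n x s : 0 < s -> Hz n.+1 x s = Hk n.+1 x s.
Proof. by move=> s0; rewrite Hz_pos//= subr0. Qed.

Lemma Hz_nonpos n x s : s <= 0 -> Hz n x s = 0.
Proof. by rewrite /Hz => ->. Qed.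

Lemma Hz_dx n x s : is_derive x 1 (Hz n ^~ s) (Hz n.+1 x s).
Proof.
have [s0|s0] := lerP s 0.
  rewrite Hz_nonpos// (_ : Hz n ^~ s = fun=> 0); first exact: is_derive_cf.
  by apply/funext => y; rewrite Hz_nonpos.
rewrite (_ : Hz n ^~ s = fun y => Hk n y s - (n == 0%N)%:R); last first.
  by apply/funext => y; rewrite Hz_pos.
by have := Hk_dx n x s0 => h; drve; rewrite HzS_pos// addr0.
Qed.

Lemma Hz_ds_pos n x s : 0 < s -> is_derive s 1 (Hz n x) (Hz n.+2 x s).
Proof.
move=> s0; apply: (@near_eq_is_derive _ _ _ (fun s => Hk n x s - (n == 0%N)%:R)).
  by near=> y; rewrite Hz_pos//; near: y; exact: lt_nbhsr.
by have := Hk_ds n x s0 => h; drve; rewrite HzS_pos// addr0.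
Unshelve. all: by end_near. Qed.

Lemma Hz_bound_small n M k d b : 0 < d -> exists2 C, 0 <= C &
  forall s x, s <= b -> d <= `|x| -> `|x| ^+ M * `|Hz n.+1 x s| <= C * `|s| ^+ k.
Proof.
move=> d0; have [C C0 HC] := Hk_bound_small n M k b d0; exists C => // s x sb dx.
have [s0|s0] := lerP s 0; first by rewrite Hz_nonpos// normr0 mulr0 mulr_ge0 ?exprn_ge0.
by rewrite HzS_pos// [`|s|]gtr0_norm// HC// s0.
Qed.

(** Only [s = 0] is delicate: there the kernel is of order [s ^+ 2], so the difference quotient
    tends to 0. *)
Lemma Hz_ds n x s : 0 < x -> is_derive s 1 (Hz n.+1 x) (Hz n.+3 x s).
Proof.
move=> x0; have [s0|s0|<-] := ltgtP 0 s; first exact: Hz_ds_pos.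
  rewrite [in X in is_derive _ _ _ X]Hz_nonpos; last exact: ltW.
  apply: (@near_eq_is_derive _ _ _ (fun=> 0 : R)).
  by near=> y; rewrite Hz_nonpos// ltW//; near: y; exact: lt_nbhsl.
rewrite [in X in is_derive _ _ _ X]Hz_nonpos//.
have [C C0 HC] := @Hz_bound_small n 0 2 x 1 x0.
have HC' s' : s' <= 1 -> `|Hz n.+1 x s'| <= C * `|s'| ^+ 2.
  by move=> s1; have := HC s' x s1 (ler_norm x); rewrite expr0 mul1r.
have L : C * `|h| @[h --> (0 : R)^'] --> (0 : R).
  have c0 : C * `|h| @[h --> (0 : R)] --> (C * `|0 : R|).
    by apply: cvgMr; exact: norm_continuous.
  by rewrite normr0 mulr0 in c0; move=> A /c0/nbhs_dnbhs.
have lim0 : h^-1 *: (Hz n.+1 x (h + 0) - Hz n.+1 x 0) @[h --> 0^'] --> (0 : R).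
  apply: (@squeeze_cvgr _ _ _ _ (fun h => - (C * `|h|)) (fun h => C * `|h|)).
  - near=> h; have h0 : h != 0 by near: h; exact: nbhs_dnbhs_neq.
    have h1 : h <= 1.
      near: h; apply: nbhs_dnbhs; have := @lt_nbhsl R 0 1 ltr01.
      by apply: filterS => z /ltW.
    rewrite -ler_norml addr0 [Hz _ _ 0]Hz_nonpos// subr0 normrM normfV.
    rewrite ler_pdivrMl ?normr_gt0//; apply: le_trans (HC' _ h1) _.
    by rewrite expr2 mulrCA.
  - by rewrite -[X in _ --> X]oppr0; exact: cvgN L.
  - exact: L.
have E : (fun h : R => h^-1 *: (Hz n.+1 x (h *: 1 + 0) - Hz n.+1 x 0)) =
   (fun h : R => h^-1 *: (Hz n.+1 x (h + 0) - Hz n.+1 x 0)).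
  by apply/funext => h; rewrite [h *: 1]mulr1.
apply: DeriveDef.
  by apply/cvg_ex; exists 0; rewrite E.
by rewrite /derive E; apply/cvg_lim.
Unshelve. all: by end_near. Qed.

Lemma Hz0_cvg x : 0 < x -> Hz 0 x s @[s --> (0 : R)^'+] --> (0 : R).
Proof.
move=> x0; rewrite -[X in _ --> X](subrr (1 : R)).
apply: (@cvg_trans _ ((fun s => Hk 0 x s - 1) @ (0 : R)^'+)).
  apply: near_eq_cvg; near=> s; rewrite Hz_pos//.
by apply: cvgB; [exact: Hk0_cvg1|exact: cvg_cst].
Unshelve. all: by end_near. Qed.

Lemma Hz0_norm x s : `|Hz 0 x s| <= 1.
Proof.
rewrite /Hz; case: ifP => _; first by rewrite normr0.
by rewrite ler_norml; have := Hk0_ge0 x s; have := Hk0_le1 x s; rewrite /=; lra.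
Qed.

End heat_kernel_bounds.

Arguments Hk : simpl never.
Arguments Hz : simpl never.

(** * Initial data *)

Section convolution_tools.
Context {R : realType}.
Implicit Types (f g h : R -> R) (x y s t a b c d : R) (A : set R).
Local Notation mu := (@lebesgue_measure R).
Local Notation integ A f := (mu.-integrable A (EFin \o f)).

Lemma Rintegral_bound A f (G : R -> R) : measurable A -> measurable_fun A f ->
  (forall y, A y -> `|f y| <= G y) -> integ A G ->
  `|\int[mu]_(y in A) f y| <= \int[mu]_(y in A) G y.
Proof.
move=> mA mf fG iG; have fi := integrable_dominated mA mf fG iG.
have h1 := @le_normr_Rintegral _ _ _ mu A f mA fi.
have h2 : \int[mu]_(y in A) `|f y| <= \int[mu]_(y in A) G y.
  apply: le_Rintegral => //.
  by rewrite (_ : _ \o _ = abse \o (EFin \o f))//; exact: integrable_abse.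
exact: (le_trans h1 h2).
Qed.

Definition Icauchy := \int[mu]_(y in `]0, +oo[) (1 + y ^+ 2)^-1.

Lemma integrable_scale A c h : measurable A -> integ A h -> integ A (fun y => c * h y).
Proof.
move=> mA hi; rewrite (_ : _ \o _ = fun y => c%:E * (h y)%:E)%E; last first.
  by apply/funext => y; rewrite /= EFinM.
exact: integrableZl.
Qed.

Lemma integrable_sub A f g : measurable A -> integ A f -> integ A g ->
  integ A (fun y => f y - g y).
Proof. by move=> mA hf hg; exact: (@integrableB _ _ _ mu A mA _ _ hf hg). Qed.

Lemma Rintegral_bound_oneDsqrV f c : measurable_fun (`]0, +oo[ : set R) f ->
  (forall y, 0 < y -> `|f y| <= c * (1 + y ^+ 2)^-1) ->
  `|\int[mu]_(y in `]0, +oo[) f y| <= c * Icauchy.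
Proof.
move=> mf fc; have iV := @integrable_oneDsqrV R `]0, +oo[ (measurable_itv _).
rewrite /Icauchy -RintegralZl//; apply: Rintegral_bound => //.
  by move=> y; rewrite /= in_itv/= andbT; exact: fc.
exact: integrable_scale.
Qed.

Lemma Rintegral_bound_itv f c t : 0 <= t -> measurable_fun `]0, t[ f ->
  (forall y, 0 < y < t -> `|f y| <= c) ->
  `|\int[mu]_(y in `]0, t[) f y| <= c * t.
Proof.
move=> t0 mf fc.
apply: (@le_trans _ _ (\int[mu]_(y in `]0, t[) c)).
  apply: Rintegral_bound => //.
  apply: (@integrable_dominated_itv R 0 t (fun=> c) `|c|) => //.
rewrite Rintegral_cst//= lebesgue_measure_itv/= lte_fin.
by move: t0; rewrite le_eqVlt => /predU1P[<-|->]; rewrite ?ltxx//= subr0.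
Qed.

Lemma Hk_bounded n a b : 0 < a -> exists2 C, 0 <= C &
  forall s x, a <= s <= b -> `|Hk n x s| <= C.
Proof.
move=> a0; case: n => [|n].
  exists 1 => // s x _; rewrite ger0_norm ?Hk0_le1//; exact: Hk0_ge0.
have [C C0 HC] := Hk_bound_compact n 0 b a0; exists C => // s x sab.
by have := HC s x sab; rewrite expr0 mul1r.
Qed.

Lemma Hk_bound_small0 n d b : 0 < d -> exists2 C, 0 <= C &
  forall s x, 0 < s <= b -> d <= `|x| -> `|Hk n.+1 x s| <= C.
Proof.
move=> d0; have [C C0 HC] := Hk_bound_small n 0 0 b d0; exists C => // s x sb dx.
by have := HC s x sb dx; rewrite !expr0 mul1r mulr1.
Qed.

Lemma Hk_cont_x n s : 0 < s -> continuous (Hk n ^~ s).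
Proof. by move=> s0 x; exact: is_derive_cont (Hk_dx n x s0). Qed.

(* [e = -1] and [e = 1] give convolution with the kernel and with its
   reflection at the boundary. *)
Definition heat_conv e n h x t := \int[mu]_(y in `]0, +oo[) (Hk n (x + e * y) t * h y).

Definition dominated h := measurable_fun (`]0, +oo[ : set R) h /\
  exists2 C, 0 <= C & forall y, 0 < y -> `|h y| <= C * (1 + y ^+ 2)^-1.

Lemma measurable_Hk e n x t : 0 < t ->
  measurable_fun (`]0, +oo[ : set R) (fun y => Hk n (x + e * y) t).
Proof.
move=> t0; apply: (measurable_funS measurableT) => //.
apply: (measurableT_comp (f := Hk n ^~ t)).
  by apply: continuous_measurable_fun; exact: Hk_cont_x.
by apply: measurable_funD => //; exact: measurable_funM.
Qed.

Lemma measurable_heat_conv e n h x t : 0 < t -> dominated h ->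
  measurable_fun (`]0, +oo[ : set R) (fun y => Hk n (x + e * y) t * h y).
Proof. by move=> t0 [mh _]; apply: measurable_funM => //; exact: measurable_Hk. Qed.

Lemma integrable_heat_conv e n h x t : 0 < t -> dominated h ->
  integ `]0, +oo[ (fun y => Hk n (x + e * y) t * h y).
Proof.
move=> t0 dh; have [C C0 HC] := Hk_bounded n t t0.
have [mh [D D0 HD]] := dh.
apply: (@integrable_dominated_oneDsqrV _ _ _ (C * D)) => //; first exact: measurable_heat_conv.
move=> y; rewrite /= in_itv/= andbT => y0; rewrite normrM -mulrA.
by apply: ler_pM => //; [apply: HC; rewrite lexx|exact: HD].
Qed.

Lemma heat_conv_dx e n h x t : 0 < t -> dominated h ->
  is_derive x 1 (heat_conv e n h ^~ t) (heat_conv e n.+1 h x t).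
Proof.
move=> t0 dh; have [C C0 HC] := Hk_bounded n.+1 t t0.
have [mh [D D0 HD]] := dh.
apply: (@derive_under_integral R (fun x y => Hk n (x + e * y) t * h y)
   (fun x y => Hk n.+1 (x + e * y) t * h y) _ (x - 1) (x + 1) x
   (fun y => C * D * (1 + y ^+ 2)^-1)) => //.
- lra.
- by move=> z _; exact: integrable_heat_conv.
- move=> z y _ _; have h1 := Hk_dx n (z + e * y) t0.
  have h2 : is_derive z 1 (fun z => z + e * y) 1 by drve; rewrite addr0.
  have h3 := @is_derive_compf _ (Hk n ^~ t) (fun z => z + e * y) z _ _ h1 h2.
  by drve; rewrite mulr0 addr0 mulr1.
- move=> z y _; rewrite /= in_itv/= andbT => y0; rewrite normrM -mulrA.
  by apply: ler_pM => //; [apply: HC; rewrite lexx|exact: HD].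
- by apply: integrable_scale => //; exact: integrable_oneDsqrV.
Qed.

Lemma heat_conv_dt e n h x t : 0 < t -> dominated h ->
  is_derive t 1 (heat_conv e n h x) (heat_conv e n.+2 h x t).
Proof.
move=> t0 dh; have t2 : 0 < t / 2 by rewrite divr_gt0.
have [C C0 HC] := Hk_bounded n.+2 (2 * t) t2.
have [mh [D D0 HD]] := dh.
apply: (@derive_under_integral R (fun t y => Hk n (x + e * y) t * h y)
   (fun t y => Hk n.+2 (x + e * y) t * h y) _ (t / 2) (2 * t) t
   (fun y => C * D * (1 + y ^+ 2)^-1)) => //.
- lra.
- by move=> z /andP[z0 _]; apply: integrable_heat_conv => //; lra.
- move=> z y /andP[z0 _] _; have z1 : 0 < z by lra.
  have h1 := Hk_ds n (x + e * y) z1.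
  by drve; rewrite mulr0 addr0.
- move=> z y zt; rewrite /= in_itv/= andbT => y0; rewrite normrM -mulrA.
  by apply: ler_pM => //; [apply: HC; lra|exact: HD].
- by apply: integrable_scale => //; exact: integrable_oneDsqrV.
Qed.

Lemma power_sum_le (M : nat) x y : `|x + y| ^+ M <= 2 ^+ M * (`|x| ^+ M + `|y| ^+ M).
Proof.
wlog xy : x y / `|x| <= `|y|.
  move=> W; case/orP : (le_total `|x| `|y|) => h; first exact: W.
  by rewrite addrC [X in _ * X]addrC; exact: W.
apply: (@le_trans _ _ ((2 * `|y|) ^+ M)).
  rewrite lerXn2r ?nnegrE ?mulr_ge0//.
  by apply: le_trans (ler_normD _ _) _; lra.
by rewrite exprMn ler_wpM2l ?exprn_ge0// lerDr exprn_ge0.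
Qed.

(** Writing [x] as the difference of [x + e * y] and [e * y] shares the weight between the decay of
    the kernel and that of the datum. *)
Lemma heat_conv_bound_compact e n M h a b : `|e| = 1 -> 0 < a -> dominated h ->
  dominated (fun y => y ^+ M * h y) -> exists2 C, 0 <= C &
  forall x t, a <= t <= b -> `|x| ^+ M * `|heat_conv e n.+1 h x t| <= C.
Proof.
move=> e1 a0 dh [_ [D' D'0 HD']].
have [C C0 HC] := Hk_bounded n.+1 b a0.
have [C' C'0 HC'] := Hk_bound_compact n M b a0.
have [mh [D D0 HD]] := dh.
have I0 : 0 <= Icauchy.
  by apply: Rintegral_ge0 => y _; rewrite invr_ge0 addr_ge0// sqr_ge0.
exists (2 ^+ M * (C' * D + C * D') * Icauchy).
  by rewrite !mulr_ge0 ?exprn_ge0 ?addr_ge0 ?mulr_ge0.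
move=> x t tab; have t0 : 0 < t by lra.
rewrite -[`|x| ^+ M]ger0_norm ?exprn_ge0// -normrM -RintegralZl//; last first.
  exact: integrable_heat_conv.
apply: Rintegral_bound_oneDsqrV.
  by apply: measurable_funM => //; exact: measurable_heat_conv.
move=> y y0; set w := (1 + y ^+ 2)^-1.
rewrite normrM [`|_ ^+ M|]ger0_norm ?exprn_ge0//.
have H : `|x| ^+ M <= 2 ^+ M * (`|x + e * y| ^+ M + `|y| ^+ M).
  rewrite -[in leLHS](addrK (e * y) x); apply: le_trans (power_sum_le _ _ _) _.
  by rewrite normrN normrM e1 mul1r.
apply: le_trans (ler_wpM2r _ H) _ => //.
rewrite -!mulrA ler_wpM2l ?exprn_ge0// mulrDl mulrDl; apply: lerD.
  rewrite normrM mulrA -mulrA [X in _ <= X](_ : _ = C' * (D * w)); last by ring.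
  rewrite mulrA; apply: ler_pM => //.
    exact: HC'.
  exact: HD.
rewrite normrM mulrCA -mulrA; apply: ler_pM => //.
- exact: HC.
- by have := HD' y y0; rewrite normrM normrX.
Qed.

(** The argument [x + y] stays above [a], so the singularity of the kernel at the origin is never
    met. *)
Lemma heat_conv_bound_reflected n h a b : 0 < a -> dominated h -> exists2 C, 0 <= C &
  forall x t, a <= x -> 0 < t <= b -> `|heat_conv 1 n.+1 h x t| <= C.
Proof.
move=> a0 dh; have [C C0 HC] := Hk_bound_small0 n b a0.
have [mh [D D0 HD]] := dh.
have I0 : 0 <= Icauchy.
  by apply: Rintegral_ge0 => y _; rewrite invr_ge0 addr_ge0// sqr_ge0.
exists (C * D * Icauchy); first by rewrite !mulr_ge0.
move=> x t ax tb; have t0 : 0 < t by case/andP : tb.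
apply: Rintegral_bound_oneDsqrV; first exact: measurable_heat_conv.
move=> y y0; rewrite normrM -mulrA; apply: ler_pM => //; last exact: HD.
apply: HC => //; rewrite ger0_norm; lra.
Qed.

(* The sequence of derivatives of a function on the half line together with the
   sequence of their limits at 0. *)
Definition schwartz_jet (h : nat -> R -> R) (h0 : nat -> R) :=
  [/\ forall n x, 0 < x -> is_derive x 1 (h n) (h n.+1 x),
      forall n, h n x @[x --> 0^'+] --> h0 n &
      forall M n, exists C, forall x, 0 < x -> `|x ^+ M * h n x| <= C].

Lemma schwartz_jetS (h : nat -> R -> R) (h0 : nat -> R) : schwartz_jet h h0 ->
  schwartz_jet (fun n => h n.+1) (fun n => h0 n.+1).
Proof. by move=> [h1 h2 h3]; split => *; [exact: h1|exact: h2|exact: h3]. Qed.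

Lemma schwartz_jet_measurable (h : nat -> R -> R) (h0 : nat -> R) n : schwartz_jet h h0 ->
  measurable_fun (`]0, +oo[ : set R) (h n).
Proof.
move=> [h1 _ _]; apply: measurable_cont_on => // x.
by rewrite inE/= in_itv/= andbT => x0; exact: is_derive_cont (h1 n x x0).
Qed.

Lemma schwartz_jet_dominated (h : nat -> R -> R) (h0 : nat -> R) M n : schwartz_jet h h0 ->
  dominated (fun y => y ^+ M * h n y).
Proof.
move=> hS; have mh := schwartz_jet_measurable n hS; have [h1 h2 h3] := hS.
split; first by apply: measurable_funM => //; exact: measurable_funX.
have [C1 H1] := h3 M n; have [C2 H2] := h3 M.+2 n.
exists (C1 + C2).
  by have := H1 1 ltr01; have := H2 1 ltr01; have := normr_ge0 (1 ^+ M * h n 1);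
    have := normr_ge0 (1 ^+ M.+2 * h n 1); lra.
move=> y y0; rewrite ler_pdivlMr; last by rewrite ltr_wpDr ?sqr_ge0.
rewrite mulrDr mulr1; apply: lerD; first exact: H1.
rewrite -[X in _ * X]ger0_norm ?sqr_ge0// -normrM.
have -> : y ^+ M * h n y * y ^+ 2 = y ^+ M.+2 * h n y by rewrite !exprS; ring.
exact: H2.
Qed.

Lemma schwartz_jet_dominated0 (h : nat -> R -> R) (h0 : nat -> R) n :
  schwartz_jet h h0 -> dominated (h n).
Proof.
move=> /(@schwartz_jet_dominated _ _ 0 n); congr dominated.
by apply/funext => y; rewrite expr0 mul1r.
Qed.

Lemma schwartz_jet_cvgy (h : nat -> R -> R) (h0 : nat -> R) n :
  schwartz_jet h h0 -> h n x @[x --> +oo] --> (0 : R).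
Proof.
move=> [_ _ /(_ 1%N n)[C HC]]; apply/cvgrPdist_le => e e0; near=> x.
have x0 : 0 < x by near: x; exact: nbhs_pinfty_gt.
rewrite sub0r normrN; have := HC x x0.
rewrite expr1 normrM (gtr0_norm x0) -ler_pdivlMl// => /le_trans; apply.
rewrite ler_pdivrMl// -ler_pdivrMr//.
Unshelve. all: by end_near. Qed.

(** Integration by parts in [y] moves one derivative from the kernel to the datum. Only the end
    [y = 0] leaves a boundary term, since the datum vanishes at infinity and the kernel is
    bounded. *)
Lemma heat_conv_parts n (h : nat -> R -> R) (h0 : nat -> R) x t : 0 < t -> schwartz_jet h h0 ->
  heat_conv (-1) n.+1 (h 0%N) x t = Hk n x t * h0 0%N + heat_conv (-1) n (h 1%N) x t.
Proof.
move=> t0 hS; have d0 := schwartz_jet_dominated0 0 hS.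
have d1 := schwartz_jet_dominated0 1 hS; have [h1 h2 h3] := hS.
have i1 := integrable_heat_conv (-1) n.+1 x t0 d0.
have i2 := integrable_heat_conv (-1) n x t0 d1.
have cH k y : {for y, continuous (fun y => Hk k (x + -1 * y) t)}.
  apply: (@continuous_comp _ _ _ (fun y => x + -1 * y) (Hk k ^~ t)).
    by apply: cvgD; [exact: cvg_cst|apply: cvgM; [exact: cvg_cst|exact: cvg_id]].
  exact: Hk_cont_x.
have : \int[mu]_(y in `]0, +oo[) (Hk n (x + -1 * y) t * h 1%N y
    - Hk n.+1 (x + -1 * y) t * h 0%N y) = 0 - Hk n x t * h0 0%N.
  apply: (@Rintegral_FTC_y R _ (fun y => Hk n (x + -1 * y) t * h 0%N y)).
  - exact: integrable_sub.
  - move=> y y0; apply: cvgB; apply: cvgM; try exact: cH.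
      exact: is_derive_cont (h1 1%N y y0).
    exact: is_derive_cont (h1 0%N y y0).
  - move=> y y0; have g1 := Hk_dx n (x + -1 * y) t0; have g2 := h1 0%N y y0.
    have g3 : is_derive y 1 (fun z => x + -1 * z) (-1).
      by drve; rewrite add0r mul0r add0r mulr1.
    have g4 := @is_derive_compf _ (Hk n ^~ t) (fun z => x + -1 * z) y _ _ g1 g3.
    by drve; ring.
  - apply: cvgM; last exact: h2.
    apply: cvg_at_right_filter.
    have : Hk n (x + -1 * z) t @[z --> (0 : R)] --> Hk n (x + -1 * 0) t := cH n 0.
    by rewrite mulr0 addr0.
  - have [C C0 HC] := Hk_bounded n t t0.
    apply/cvgrPdist_le => e e0; near=> y; rewrite sub0r normrN normrM.
    (* [C + 1] in place of [C] keeps the divisor positive when [C = 0]. *)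
    apply: (@le_trans _ _ ((C + 1) * (e / (C + 1)))); last first.
      by rewrite mulrC divfK// gt_eqF// ltr_wpDl.
    apply: ler_pM => //.
      by apply: le_trans (HC _ _ _) _; [rewrite lexx|rewrite lerDl].
    near: y; have C1 : 0 < e / (C + 1) by rewrite divr_gt0// ltr_wpDl.
    have := schwartz_jet_cvgy 0 hS => /cvgrPdist_le/(_ _ C1).
    by apply: filterS => y; rewrite sub0r normrN.
rewrite RintegralB// -/(heat_conv (-1) n (h 1%N) x t) -/(heat_conv (-1) n.+1 (h 0%N) x t).
lra.
Unshelve. all: by end_near. Qed.

Lemma heat_conv0_bound e h : dominated h -> exists2 C, 0 <= C &
  forall x t, 0 < t -> `|heat_conv e 0 h x t| <= C.
Proof.
move=> dh; have [mh [D D0 HD]] := dh.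
have I0 : 0 <= Icauchy.
  by apply: Rintegral_ge0 => y _; rewrite invr_ge0 addr_ge0// sqr_ge0.
exists (D * Icauchy); first by rewrite mulr_ge0.
move=> x t t0; apply: Rintegral_bound_oneDsqrV; first exact: measurable_heat_conv.
move=> y y0; rewrite normrM; apply: le_trans (HD y y0).
by rewrite ler_piMl// ger0_norm ?Hk0_le1// Hk0_ge0.
Qed.

(** For small [t] the kernel is singular at [y = x], so all derivatives are moved to the datum until
    the bounded [Hk 0] remains. The boundary terms are harmless because they are kernels evaluated
    at [x >= a]. *)
Lemma heat_conv_bound_small n (h : nat -> R -> R) (h0 : nat -> R) a b : 0 < a ->
  schwartz_jet h h0 -> exists2 C, 0 <= C &
  forall x t, a <= x -> 0 < t <= b -> `|heat_conv (-1) n (h 0%N) x t| <= C.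
Proof.
move=> a0; elim: n h h0 => [|n IH] h h0 hS.
  have [C C0 HC] := heat_conv0_bound (-1) (schwartz_jet_dominated0 0 hS).
  by exists C => // x t _ /andP[t0 _]; exact: HC.
have [C C0 HC] := IH _ _ (schwartz_jetS hS).
have [D D0 HD] : exists2 D, 0 <= D &
    forall x t, a <= x -> 0 < t <= b -> `|Hk n x t| <= D.
  case: n {IH HC} => [|n].
    by exists 1 => // x t _ _; rewrite ger0_norm ?Hk0_le1// Hk0_ge0.
  have [D D0 HD] := Hk_bound_small0 n b a0; exists D => // x t ax tb.
  by apply: HD => //; apply: le_trans (ler_norm _).
exists (D * `|h0 0%N| + C); first by rewrite addr_ge0 ?mulr_ge0.
move=> x t ax tb; rewrite (heat_conv_parts n x _ hS); last by case/andP : tb.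
apply: le_trans (ler_normD _ _) _; apply: lerD; last exact: HC.
by rewrite normrM ler_wpM2r// HD.
Qed.

End convolution_tools.

(** * Boundary data *)

Section duhamel_integral.
Context {R : realType}.
Implicit Types (x y s t a b c d T : R) (A : set R).
Local Notation mu := (@lebesgue_measure R).
Local Notation integ A f := (mu.-integrable A (EFin \o f)).

(** Unlike [schwartz_jet] there is no control at infinity: the boundary datum enters only through
    bounded time intervals. *)
Definition smooth_jet (g : nat -> R -> R) (g0 : nat -> R) :=
  (forall n x, 0 < x -> is_derive x 1 (g n) (g n.+1 x)) /\
  (forall n, g n x @[x --> 0^'+] --> g0 n).

Lemma schwartz_jet_smooth (h : nat -> R -> R) (h0 : nat -> R) :
  schwartz_jet h h0 -> smooth_jet h h0.
Proof. by case. Qed.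

Lemma smooth_jetS (g : nat -> R -> R) (g0 : nat -> R) : smooth_jet g g0 ->
  smooth_jet (fun n => g n.+1) (fun n => g0 n.+1).
Proof. by move=> [h1 h2]; split => *; [exact: h1|exact: h2]. Qed.

Lemma smooth_jet_cont (g : nat -> R -> R) (g0 : nat -> R) n x : smooth_jet g g0 ->
  0 < x -> {for x, continuous (g n)}.
Proof. by move=> [h1 _] x0; exact: is_derive_cont (h1 n x x0). Qed.

Lemma smooth_jet_measurable (g : nat -> R -> R) (g0 : nat -> R) n T : smooth_jet g g0 ->
  measurable_fun `]0, T[ (g n).
Proof.
move=> gS; apply: measurable_cont_on => // x.
by rewrite inE/= in_itv/= => /andP[x0 _]; exact: smooth_jet_cont gS x0.
Qed.

(** The limit at 0 gives a bound near 0, and compactness gives one on the remaining closed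
    interval. *)
Lemma smooth_jet_bounded (g : nat -> R -> R) (g0 : nat -> R) n T : smooth_jet g g0 ->
  exists2 C, 0 <= C & forall x, 0 < x < T -> `|g n x| <= C.
Proof.
move=> gS; have := gS.2 n => /cvgrPdist_le/(_ _ ltr01).
move=> -[d /= d0 Hd].
have H1 x : 0 < x -> x < d -> `|g n x| <= `|g0 n| + 1.
  move=> x0 xd; have := Hd x; rewrite /ball_/= sub0r normrN gtr0_norm// => /(_ xd x0).
  move=> h; rewrite -lerBlDl; apply: le_trans h.
  by rewrite distrC; exact: lerB_dist.
pose e := d / 2; have e0 : 0 < e by rewrite divr_gt0.
have ed : e < d by rewrite /e; lra.
have [Te|eT] := ltP T e.
  exists (`|g0 n| + 1); first by rewrite addr_ge0.
  by move=> x /andP[x0 xT]; apply: H1 => //; lra.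
have cg x : 0 < x -> {for x, continuous (fun x => `|g n x|)}.
  move=> x0; apply: (@continuous_comp _ _ _ (g n) (fun r => `|r|)).
    exact: smooth_jet_cont gS x0.
  exact: norm_continuous.
have cn : {within `[e, T], continuous (fun x => `|g n x|)}.
  apply: continuous_in_subspaceT => x; rewrite inE/= in_itv/= => /andP[ex xT].
  by apply: cg; exact: lt_le_trans ex.
have [c _ Hc] := EVT_max eT cn.
exists (`|g0 n| + 1 + `|g n c|); first by rewrite !addr_ge0.
move=> x /andP[x0 xT]; have [xe|ex] := ltP x e.
  by apply: le_trans (H1 x x0 _) _; [lra|rewrite lerDl].
apply: le_trans (Hc x _) _; first by rewrite in_itv/= ex ltW.
by rewrite lerDr addr_ge0.
Qed.

Definition duhamel n (g : R -> R) x t := \int[mu]_(y in `]0, t[) (Hz n x (t - y) * g y).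

(** [Hz] vanishes at nonpositive times. A fixed upper limit allows differentiation in [t] under the
    integral, with no boundary term. *)
Lemma duhamel_extend n g x t T : t <= T ->
  duhamel n g x t = \int[mu]_(y in `]0, T[) (Hz n x (t - y) * g y).
Proof.
move=> tT; rewrite /duhamel [LHS]Rintegral_mkcond [RHS]Rintegral_mkcond.
apply: eq_Rintegral => y _; rewrite !patchE.
have [yt|] := boolP (y \in `]0, t[%classic).
  rewrite mem_set//; move/set_mem : yt; rewrite /= !in_itv/= => /andP[-> yt].
  exact: lt_le_trans tT.
have [yT|//] := boolP (y \in `]0, T[%classic).
move/set_mem : yT; rewrite /= in_itv/= => /andP[y0 yT] yt.
rewrite Hz_nonpos ?mul0r// subr_le0 leNgt; apply/negP => h.
by move/negP : yt; apply; rewrite mem_set//= in_itv/= y0.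
Qed.

Lemma Hz_cont n x s : 0 < x -> {for s, continuous (Hz n.+1 x)}.
Proof. by move=> x0; exact: is_derive_cont (Hz_ds n s x0). Qed.

Lemma measurable_Hz n x t T : 0 < x -> measurable_fun `]0, T[ (fun y => Hz n.+1 x (t - y)).
Proof.
move=> x0; apply: measurable_cont_on => // y _.
apply: (@continuous_comp _ _ _ (fun y => t - y) (Hz n.+1 x)).
  by apply: cvgB; [exact: cvg_cst|exact: cvg_id].
exact: Hz_cont.
Qed.

(** Here [t - y] is positive, which covers order 0 and every real [x]. *)
Lemma measurable_Hz_lt n x t : measurable_fun `]0, t[ (fun y => Hz n x (t - y)).
Proof.
apply: measurable_cont_on => // y; rewrite inE/= in_itv/= => /andP[y0 yt].
apply: (@continuous_comp _ _ _ (fun y => t - y) (Hz n x)).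
  by apply: cvgB; [exact: cvg_cst|exact: cvg_id].
by apply: (is_derive_cont (Hz_ds_pos n x _)); rewrite subr_gt0.
Qed.

Lemma Hz_bound_small0 n d b : 0 < d -> exists2 C, 0 <= C &
  forall s x, s <= b -> d <= x -> `|Hz n.+1 x s| <= C.
Proof.
move=> d0; have [C C0 HC] := Hz_bound_small n 0 0 b d0; exists C => // s x sb dx.
have := HC s x sb; rewrite !expr0 mul1r mulr1; apply.
exact: le_trans (ler_norm _).
Qed.

Lemma integrable_duhamel n (g : nat -> R -> R) (g0 : nat -> R) k x t T :
  0 < x -> smooth_jet g g0 -> integ `]0, T[ (fun y => Hz n.+1 x (t - y) * g k y).
Proof.
move=> x0 gS; have [C C0 HC] := Hz_bound_small0 n t x0.
have [D D0 HD] := smooth_jet_bounded k T gS.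
apply: (@integrable_dominated_itv R 0 T _ (C * D)).
  by apply: measurable_funM; [exact: measurable_Hz|exact: smooth_jet_measurable gS].
move=> y y0; rewrite normrM; apply: ler_pM => //; last exact: HD.
by apply: HC => //; lra.
Qed.

Lemma integrable_cst_itv T c : integ `]0, T[ (fun=> c).
Proof. exact: (@integrable_dominated_itv R 0 T (fun=> c) `|c|). Qed.

Lemma duhamel_dx n (g : nat -> R -> R) (g0 : nat -> R) k x t : 0 < x -> smooth_jet g g0 ->
  is_derive x 1 (duhamel n.+1 (g k) ^~ t) (duhamel n.+2 (g k) x t).
Proof.
move=> x0 gS; have x2 : 0 < x / 2 by rewrite divr_gt0.
have [C C0 HC] := Hz_bound_small0 n.+1 t x2.
have [D D0 HD] := smooth_jet_bounded k t gS.
apply: (@derive_under_integral R (fun x y => Hz n.+1 x (t - y) * g k y)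
   (fun x y => Hz n.+2 x (t - y) * g k y) _ (x / 2) (2 * x) x (fun=> C * D)) => //.
- lra.
- by move=> z zx; apply: integrable_duhamel gS; lra.
- by move=> z y _ _; have h := Hz_dx n.+1 z (t - y); drve; rewrite mulr0 addr0.
- move=> z y zx; rewrite /= in_itv/= => yt; rewrite normrM.
  by apply: ler_pM => //; [apply: HC; lra|exact: HD].
- exact: integrable_cst_itv.
Qed.

Lemma duhamel_dt n (g : nat -> R -> R) (g0 : nat -> R) k x t : 0 < x -> 0 < t ->
  smooth_jet g g0 -> is_derive t 1 (duhamel n.+1 (g k) x) (duhamel n.+3 (g k) x t).
Proof.
move=> x0 t0 gS.
have [C C0 HC] := Hz_bound_small0 n.+2 (2 * t) x0.
have [D D0 HD] := smooth_jet_bounded k (2 * t) gS.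
apply: (@near_eq_is_derive _ _ _
   (fun t' => \int[mu]_(y in `]0, 2 * t[) (Hz n.+1 x (t' - y) * g k y))).
  near=> z; rewrite -duhamel_extend// ltW//; near: z; apply: lt_nbhsl; lra.
rewrite (@duhamel_extend _ _ _ _ (2 * t)); last lra.
apply: (@derive_under_integral R (fun t' y => Hz n.+1 x (t' - y) * g k y)
   (fun t' y => Hz n.+3 x (t' - y) * g k y) _ (t / 2) (2 * t) t (fun=> C * D)) => //.
- lra.
- by move=> z zx; exact: integrable_duhamel gS.
- move=> z y _ _; have h1 := Hz_ds n (z - y) x0.
  have h2 : is_derive z 1 (fun z => z - y) 1 by drve; rewrite addr0.
  have h3 := @is_derive_compf _ (Hz n.+1 x) (fun z => z - y) z _ _ h1 h2.
  by drve; rewrite mulr0 addr0 mulr1.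
- move=> z y zx; rewrite /= in_itv/= => yt; rewrite normrM.
  by apply: ler_pM => //; [apply: HC; lra|exact: HD].
- exact: integrable_cst_itv.
Unshelve. all: by end_near. Qed.

Lemma integrable_duhamel0 n (g : nat -> R -> R) (g0 : nat -> R) k x t : 0 < x ->
  smooth_jet g g0 -> integ `]0, t[ (fun y => Hz n x (t - y) * g k y).
Proof.
move=> x0 gS; case: n => [|n]; last exact: integrable_duhamel gS.
have [D D0 HD] := smooth_jet_bounded k t gS.
apply: (@integrable_dominated_itv R 0 t _ D).
  by apply: measurable_funM; [exact: measurable_Hz_lt|exact: smooth_jet_measurable gS].
move=> y y0; rewrite normrM; apply: le_trans (HD y y0).
by rewrite ler_piMl// Hz0_norm.
Qed.

Lemma Hz_cvg0 n x : 0 < x -> Hz n x s @[s --> (0 : R)^'+] --> (0 : R).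
Proof.
move=> x0; case: n => [|n]; first exact: Hz0_cvg.
rewrite -[X in _ --> X](Hz_nonpos n.+1 x (lexx 0)).
by apply: cvg_at_right_filter; exact: Hz_cont.
Qed.

(** By the heat equation, integration by parts in time lowers the order of the kernel by 2. The term
    at [y = t] disappears because [Hz n x s] tends to 0 with [s]; for [n = 0] this is where the
    subtracted 1 matters. *)
Lemma duhamel_parts n (g : nat -> R -> R) (g0 : nat -> R) x t : 0 < x -> 0 < t ->
  smooth_jet g g0 ->
  duhamel n.+2 (g 0%N) x t = Hz n x t * g0 0%N + duhamel n (g 1%N) x t.
Proof.
move=> x0 t0 gS; have [h1 h2] := gS.
have i1 := integrable_duhamel0 n.+2 0 t x0 gS.
have i2 := integrable_duhamel0 n 1 t x0 gS.
have dH k y : y < t -> is_derive y 1 (fun y => Hz k x (t - y)) (- Hz k.+2 x (t - y)).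
  move=> yt; have g1 : is_derive (t - y) 1 (Hz k x) (Hz k.+2 x (t - y)).
    by apply: Hz_ds_pos; rewrite subr_gt0.
  have g2 : is_derive y 1 (fun y => t - y) (- 1) by drve; rewrite add0r.
  have := @is_derive_compf _ (Hz k x) (fun y => t - y) y _ _ g1 g2.
  by rewrite mulrN1.
have : \int[mu]_(y in `]0, t[) (Hz n x (t - y) * g 1%N y
    - Hz n.+2 x (t - y) * g 0%N y) = 0 - Hz n x t * g0 0%N.
  apply: (@Rintegral_FTC_oo R _ (fun y => Hz n x (t - y) * g 0%N y)) => //.
  - exact: integrable_sub.
  - move=> y /andP[y0 yt]; apply: cvgB; apply: cvgM.
    + exact: is_derive_cont (dH n y yt).
    + exact: smooth_jet_cont gS y0.
    + exact: is_derive_cont (dH n.+2 y yt).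
    + exact: smooth_jet_cont gS y0.
  - move=> y /andP[y0 yt]; have d1 := dH n y yt; have d2 := h1 0%N y y0.
    by drve; ring.
  - apply: cvgM; last exact: h2.
    have : Hz n x (t - z) @[z --> (0 : R)] --> Hz n x (t - 0).
      exact: is_derive_cont (dH n 0 t0).
    by rewrite subr0; exact: cvg_at_right_filter.
  - rewrite -(mul0r (g 0%N t)); apply: cvgM; last first.
      by apply: cvg_at_left_filter; exact: smooth_jet_cont gS t0.
    apply/cvg_at_leftP => w [wt wcvg].
    move/cvg_at_rightP : (Hz_cvg0 n x0); apply; split.
      by move=> k; rewrite subr_gt0.
    by rewrite -(subrr t); apply: cvgB => //; exact: cvg_cst.
rewrite RintegralB// -/(duhamel n (g 1%N) x t) -/(duhamel n.+2 (g 0%N) x t).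
lra.
Qed.

Lemma measurable_duhamel n (g : nat -> R -> R) (g0 : nat -> R) k x t :
  smooth_jet g g0 -> measurable_fun `]0, t[ (fun y => Hz n x (t - y) * g k y).
Proof.
by move=> gS; apply: measurable_funM; [exact: measurable_Hz_lt|exact: smooth_jet_measurable gS].
Qed.

(** The kernel is bounded for [x >= d], and the factor [t] is the length of the interval; it makes
    the integral vanish at the initial time. *)
Lemma duhamel_bound_small n (g : nat -> R -> R) (g0 : nat -> R) k M d b : 0 < d ->
  smooth_jet g g0 -> exists2 C, 0 <= C &
  forall x t, d <= x -> 0 < t <= b -> x ^+ M * `|duhamel n.+1 (g k) x t| <= C * t.
Proof.
move=> d0 gS; have [C C0 HC] := Hz_bound_small n M 0 b d0.
have [D D0 HD] := smooth_jet_bounded k b gS.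
exists (C * D); first by rewrite mulr_ge0.
move=> x t dx /andP[t0 tb]; have x0 : 0 < x by lra.
rewrite -[x ^+ M]ger0_norm ?exprn_ge0 ?(ltW x0)// -normrM -RintegralZl//; last first.
  exact: integrable_duhamel0 gS.
apply: Rintegral_bound_itv; first exact: ltW.
  by apply: measurable_funM => //; exact: measurable_duhamel gS.
move=> y /andP[y0 yt]; rewrite normrM normrX normrM mulrA; apply: ler_pM => //.
- have := HC (t - y) x; rewrite expr0 mulr1; apply; first lra.
  by apply: le_trans dx (ler_norm _).
- by apply: HD; lra.
Qed.

(* Integration by parts lowers the order by 2, down to the bounded kernel [Hz 0];
   the kernels themselves are not integrable in [t], uniformly as [x --> 0^'+]. *)
Lemma duhamel_bound_even m (g : nat -> R -> R) (g0 : nat -> R) a b : 0 < a ->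
  smooth_jet g g0 -> exists2 C, 0 <= C &
  forall x t, 0 < x -> a <= t <= b -> `|duhamel m.*2 (g 0%N) x t| <= C.
Proof.
move=> a0; elim: m g g0 => [|m IH] g g0 gS.
  have [D D0 HD] := smooth_jet_bounded 0 b gS.
  exists (D * `|b|); first by rewrite mulr_ge0.
  move=> x t x0 /andP[at_ tb]; have t0 : 0 <= t by lra.
  apply: (@le_trans _ _ (D * t)); last first.
    by rewrite ler_wpM2l//; apply: le_trans tb (ler_norm _).
  apply: Rintegral_bound_itv => //; first exact: measurable_duhamel gS.
  move=> y /andP[y0 yt]; rewrite normrM; apply: le_trans (HD y _); last lra.
  by rewrite ler_piMl// Hz0_norm.
have [C C0 HC] := IH _ _ (smooth_jetS gS).
have [D D0 HD] := Hk_bounded m.*2 b a0.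
(* [D] bounds [Hk]; the extra 1 is the constant that [Hz 0] subtracts. *)
exists ((D + 1) * `|g0 0%N| + C); first by rewrite addr_ge0 ?mulr_ge0 ?addr_ge0.
move=> x t x0 tab; have t0 : 0 < t by lra.
rewrite doubleS (duhamel_parts m.*2 x0 t0 gS).
apply: le_trans (ler_normD _ _) _; apply: lerD; last exact: HC.
rewrite normrM ler_wpM2r// Hz_pos//; apply: le_trans (ler_normB _ _) _.
by apply: lerD; [exact: HD|case: (_ == _); rewrite ?normr0 ?normr1].
Qed.

(* An odd order is recovered from the next even one by the mean value inequality
   between [x] and 1. *)
Lemma duhamel_bound_boundary n (g : nat -> R -> R) (g0 : nat -> R) a b : 0 < a ->
  smooth_jet g g0 -> exists2 C, 0 <= C &
  forall x t, 0 < x <= 1 -> a <= t <= b -> `|duhamel n.+2 (g 0%N) x t| <= C.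
Proof.
move=> a0 gS; rewrite -[n.+2]odd_double_half; set k := n.+2./2.
have [C C0 HC] := duhamel_bound_even k b a0 gS.
case: (boolP (odd n.+2)) => _; rewrite ?add0n; last first.
  by exists C => // x t /andP[x0 _] tab; exact: HC.
have [k0 E] : exists k0, k = k0.+1 by exists n./2.
rewrite E doubleS !add1n.
have [C1 C10 HC1] := duhamel_bound_even k0.+2 b a0 gS.
have [C2 C20 HC2] := duhamel_bound_small (k0.*2.+2) 0 0 b ltr01 gS.
exists (C2 * `|b| + C1); first by rewrite addr_ge0 ?mulr_ge0.
move=> x t /andP[x0 x1] tab.
have t0 : 0 < t by lra.
have tb : t <= `|b| by have := ler_norm b; lra.
have H1 : `|duhamel k0.*2.+3 (g 0%N) 1 t| <= C2 * `|b|.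
  have := HC2 1 t (lexx _); rewrite expr0 mul1r => h.
  by apply: le_trans (h _) _; [lra|rewrite ler_wpM2l].
have H2 : `|duhamel k0.*2.+3 (g 0%N) 1 t - duhamel k0.*2.+3 (g 0%N) x t| <= C1 * `|1 - x|.
  apply: (@mean_value_bound R (duhamel k0.*2.+3 (g 0%N) ^~ t)
      (fun x => duhamel k0.*2.+4 (g 0%N) x t)) => z; rewrite (min_idPl x1) (max_idPr x1).
    by move=> zx; apply: duhamel_dx gS; lra.
  by move=> zx; rewrite -!doubleS; apply: HC1 => //; lra.
rewrite -[duhamel _ _ x t](subKr (duhamel k0.*2.+3 (g 0%N) 1 t)).
apply: le_trans (ler_normB _ _) _; apply: lerD => //.
apply: le_trans H2 _; rewrite ler_piMr// ger0_norm; lra.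
Qed.

(** Two regimes are glued at [x = 1]: below it the weight is at most 1, above it the kernel itself
    decays. *)
Lemma duhamel_bound_compact n M (g : nat -> R -> R) (g0 : nat -> R) a b : 0 < a ->
  smooth_jet g g0 -> exists2 C, 0 <= C &
  forall x t, 0 < x -> a <= t <= b -> x ^+ M * `|duhamel n.+2 (g 0%N) x t| <= C.
Proof.
move=> a0 gS; have [C C0 HC] := duhamel_bound_boundary n b a0 gS.
have [D D0 HD] := duhamel_bound_small n.+1 0 M b ltr01 gS.
exists (C + D * `|b|); first by rewrite addr_ge0 ?mulr_ge0.
move=> x t x0 tab; have [x1|x1] := leP x 1.
  apply: (@le_trans _ _ C); last by rewrite lerDl mulr_ge0.
  rewrite -[leRHS]mul1r; apply: ler_pM => //; rewrite ?exprn_ge0 ?(ltW x0)//.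
    by rewrite exprn_ile1// ltW.
  by apply: HC => //; rewrite x0.
apply: (@le_trans _ _ (D * t)); first by apply: HD; [exact: ltW|lra].
apply: (@le_trans _ _ (D * `|b|)); last by rewrite lerDr.
by rewrite ler_wpM2l//; have := ler_norm b; lra.
Qed.

End duhamel_integral.

(** * Limits at the initial time and at the boundary *)

Section initial_boundary_limits.
Context {R : realType}.
Implicit Types (x y s t a b c d T : R) (A : set R).
Local Notation mu := (@lebesgue_measure R).
Local Notation integ A f := (mu.-integrable A (EFin \o f)).

(** The jump relation of the double layer potential. After integration by parts the kernel [Hz 0]
    tends to 1/2 - 1 = -1/2, and g(0) plus the integral of g' over (0,t) is g(t). *)
Lemma duhamel_cvg_boundary (g : nat -> R -> R) (g0 : nat -> R) t : 0 < t -> smooth_jet g g0 ->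
  duhamel 2 (g 0%N) x t @[x --> 0^'+] --> - 2^-1 * g 0%N t.
Proof.
move=> t0 gS; have [h1 h2] := gS.
have [D D0 HD] := smooth_jet_bounded 1 t gS.
have Hlim s : 0 < s -> Hz 0 x s @[x --> 0^'+] --> (- 2^-1 : R).
  move=> s0; rewrite (_ : (fun x => Hz 0 x s) = fun x => Hk 0 x s - 1); last first.
    by apply/funext => x; rewrite Hz_pos.
  rewrite (_ : - 2^-1 = 2^-1 - 1 :> R); last by lra.
  by apply: cvgB; [exact: Hk0_cvg_half|exact: cvg_cst].
have gi : integ `]0, t[ (g 1%N).
  apply: (@integrable_dominated_itv R 0 t _ D); last exact: HD.
  exact: smooth_jet_measurable gS.
have E0 : \int[mu]_(y in `]0, t[) g 1%N y = g 0%N t - g0 0%N.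
  apply: (@Rintegral_FTC_oo R (g 1%N) (g 0%N)) => //.
  - by move=> y /andP[y0 _]; exact: smooth_jet_cont gS y0.
  - by move=> y /andP[y0 _]; exact: h1.
  - by apply: cvg_at_left_filter; exact: smooth_jet_cont gS t0.
have E1 : \int[mu]_(y in `]0, t[) (- 2^-1 * g 1%N y) =
    - 2^-1 * \int[mu]_(y in `]0, t[) g 1%N y by apply: RintegralZl.
have -> : - 2^-1 * g 0%N t = - 2^-1 * g0 0%N +
    \int[mu]_(y in `]0, t[) (- 2^-1 * g 1%N y).
  by rewrite E1 E0; ring.
apply: (@cvg_trans _ ((fun x => Hz 0 x t * g0 0%N + duhamel 0 (g 1%N) x t) @ 0^'+)).
  apply: near_eq_cvg; near=> x; rewrite (duhamel_parts 0 _ t0 gS)//.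
apply: cvgD; first by apply: cvgMl; exact: Hlim.
apply: (@dominated_at_right R _ (fun x y => Hz 0 x (t - y) * g 1%N y) _ (fun=> D) 1) => //.
- by move=> x _; exact: measurable_duhamel gS.
- move=> x y _; rewrite /= in_itv/= => yt; rewrite normrM; apply: le_trans (HD y yt).
  by rewrite ler_piMl// Hz0_norm.
- exact: integrable_cst_itv.
- move=> y; rewrite /= in_itv/= => /andP[y0 yt]; apply: cvgMl; apply: Hlim.
  by rewrite subr_gt0.
Unshelve. all: by end_near. Qed.

Lemma duhamel_cvg_initial n (g : nat -> R -> R) (g0 : nat -> R) k x : 0 < x -> smooth_jet g g0 ->
  duhamel n.+1 (g k) x t @[t --> 0^'+] --> (0 : R).
Proof.
move=> x0 gS; have [C C0 HC] := duhamel_bound_small n k 0 1 x0 gS.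
apply/cvgrPdist_le => e e0; near=> t; rewrite sub0r normrN.
have t0 : 0 < t by near: t; exact: nbhs_right_gt.
have t1 : t <= 1 by near: t; exact: nbhs_right_le.
have := HC x t (lexx x); rewrite expr0 mul1r t0 t1 => /(_ isT) /le_trans; apply.
apply: (@le_trans _ _ ((C + 1) * t)); first by rewrite ler_wpM2r ?(ltW t0)// lerDl.
rewrite -ler_pdivlMl ?ltr_wpDl//; near: t; apply: nbhs_right_le.
by rewrite mulr_gt0// invr_gt0 ltr_wpDl.
Unshelve. all: by end_near. Qed.

(** After one integration by parts the kernel tends to 1 for [y < x] and to 0 for [y > x], so the
    limit is h(0) plus the integral of h' over (0,x), which is h(x). The half line is split at [x],
    where the kernel has neither limit. *)
Lemma heat_conv_cvg_initial (h : nat -> R -> R) (h0 : nat -> R) x : 0 < x -> schwartz_jet h h0 ->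
  heat_conv (-1) 1 (h 0%N) x t @[t --> 0^'+] --> h 0%N x.
Proof.
move=> x0 hS; have [h1 h2 h3] := hS; have gS := schwartz_jet_smooth hS.
have d1 := schwartz_jet_dominated0 1 hS; have [m1 [D D0 HD]] := d1.
have itvE y : `]0, +oo[%classic y = (0 < y) by rewrite /= in_itv/= andbT.
have split_int f : integ `]0, +oo[ f -> \int[mu]_(y in `]0, +oo[) f y =
    \int[mu]_(y in `]0, x[) f y + \int[mu]_(y in `]x, +oo[) f y.
  move=> fi.
  have fi' : integ `]0, x[ f.
    by apply: integrableS fi => // y; rewrite /= !in_itv/= => /andP[-> _].
  have E : \int[mu]_(y in `]0, x[) f y = \int[mu]_(y in `]0, x]) f y.
    exact: Rintegral_itv_bndo_bndc.
  have S : \int[mu]_(y in `]0, +oo[) f y - \int[mu]_(y in `]0, x]) f y =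
      \int[mu]_(y in `]x, +oo[) f y.
    by apply: Rintegral_itvB => //; rewrite bnd_simp ltW.
  by rewrite E -S addrC subrK.
have hi : integ `]0, +oo[ (h 1%N).
  by apply: (integrable_dominated_oneDsqrV _ m1 (c := D)) => // y; rewrite itvE; exact: HD.
have hix : integ `]0, x[ (h 1%N).
  by apply: integrableS hi => // y; rewrite /= !in_itv/= => /andP[-> _].
have Gi A : measurable A -> integ A (fun y => D * (1 + y ^+ 2)^-1).
  by move=> mA; apply: integrable_scale => //; exact: integrable_oneDsqrV.
have bnd t y : 0 < y -> `|Hk 0 (x + -1 * y) t * h 1%N y| <= D * (1 + y ^+ 2)^-1.
  move=> y0; rewrite normrM; apply: le_trans (HD y y0).
  by rewrite ler_piMl// ger0_norm ?Hk0_le1// Hk0_ge0.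
have E0 : \int[mu]_(y in `]0, x[) h 1%N y = h 0%N x - h0 0%N.
  apply: (@Rintegral_FTC_oo R (h 1%N) (h 0%N)) => //.
  - by move=> y /andP[y0 _]; exact: smooth_jet_cont gS y0.
  - by move=> y /andP[y0 _]; exact: h1.
  - by apply: cvg_at_left_filter; exact: smooth_jet_cont gS x0.
have E1 : \int[mu]_(y in `]x, +oo[) 0 = 0 :> R by rewrite Rintegral_cst// mul0r.
have -> : h 0%N x = 1 * h0 0%N + (\int[mu]_(y in `]0, x[) h 1%N y + \int[mu]_(y in `]x, +oo[) 0).
  by rewrite E0 E1; ring.
pose f t y := Hk 0 (x + -1 * y) t * h 1%N y.
apply: (@cvg_trans _ ((fun t => Hk 0 x t * h0 0%N + (\int[mu]_(y in `]0, x[) f t y +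
    \int[mu]_(y in `]x, +oo[) f t y)) @ 0^'+)).
  apply: near_eq_cvg; near=> t.
  have t0 : 0 < t by near: t; exact: nbhs_right_gt.
  by rewrite (heat_conv_parts 0 x t0 hS) -split_int//; exact: integrable_heat_conv.
apply: cvgD; first by apply: cvgMl; exact: Hk0_cvg1.
apply: cvgD.
- apply: (@dominated_at_right R _ f _ (fun y => D * (1 + y ^+ 2)^-1) 1) => //.
  + move=> t /andP[t0 _]; apply: measurable_funS (measurable_heat_conv (-1) 0 x t0 d1) => //.
    by move=> y; rewrite /= !in_itv/= => /andP[-> _].
  + by move=> t y _; rewrite /= in_itv/= => /andP[y0 _]; exact: bnd.
  + exact: Gi.
  + move=> y; rewrite /= in_itv/= => /andP[y0 yx]; rewrite -[X in _ --> X]mul1r.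
    by apply: cvgMl; apply: Hk0_cvg1; lra.
- apply: (@dominated_at_right R _ f _ (fun y => D * (1 + y ^+ 2)^-1) 1) => //.
  + move=> t /andP[t0 _]; apply: measurable_funS (measurable_heat_conv (-1) 0 x t0 d1) => //.
    by move=> y; rewrite /= !in_itv/= !andbT; exact: lt_trans.
  + by move=> t y _; rewrite /= in_itv/= andbT => xy; apply: bnd; exact: lt_trans xy.
  + exact: Gi.
  + move=> y; rewrite /= in_itv/= andbT => xy.
    rewrite -[X in _ --> X](mul0r (h 1%N y)).
    by apply: cvgMl; apply: Hk0_cvg0; lra.
Unshelve. all: by end_near. Qed.

(** Since [x + y >= x > 0], [Hk_bound_small] applies with exponent 1 and the whole integral is of
    order [t]. *)
Lemma heat_conv_reflected_cvg_initial (h : R -> R) x : 0 < x -> dominated h ->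
  heat_conv 1 1 h x t @[t --> 0^'+] --> (0 : R).
Proof.
move=> x0 dh; have [C C0 HC] := Hk_bound_small 0 0 1 1 x0.
have [mh [D D0 HD]] := dh.
have I0 : 0 <= Icauchy :> R.
  by apply: Rintegral_ge0 => y _; rewrite invr_ge0 addr_ge0// sqr_ge0.
set E := C * D * Icauchy; have E0 : 0 <= E by rewrite !mulr_ge0.
apply/cvgrPdist_le => e e0; near=> t; rewrite sub0r normrN.
have t0 : 0 < t by near: t; exact: nbhs_right_gt.
have t1 : t <= 1 by near: t; exact: nbhs_right_le.
have : `|heat_conv 1 1 h x t| <= (C * t * D) * Icauchy.
  apply: Rintegral_bound_oneDsqrV; first exact: measurable_heat_conv.
  move=> y y0; rewrite normrM.
  rewrite [leRHS](_ : _ = (C * t) * (D * (1 + y ^+ 2)^-1)); last by rewrite !mulrA.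
  apply: ler_pM; [by []|by []| |exact: HD].
  have := HC t (x + 1 * y); rewrite expr0 expr1 mul1r [1 * `|_|]mul1r t0 t1; apply => //.
  by rewrite ger0_norm; lra.
move=> /le_trans; apply; rewrite (_ : C * t * D * _ = E * t); last by rewrite /E; ring.
apply: (@le_trans _ _ ((E + 1) * t)); first by rewrite ler_wpM2r ?(ltW t0)// lerDl.
rewrite -ler_pdivlMl ?ltr_wpDl//; near: t; apply: nbhs_right_le.
by rewrite mulr_gt0// invr_gt0 ltr_wpDl.
Unshelve. all: by end_near. Qed.

Lemma heat_conv_cvg_boundary e n (h : R -> R) t : 0 < t -> dominated h ->
  heat_conv e n h x t @[x --> 0^'+] --> heat_conv e n h 0 t.
Proof.
move=> t0 dh; apply: cvg_at_right_filter.
exact: is_derive_cont (heat_conv_dx e n 0 t0 dh).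
Qed.

Lemma Hk1_even x t : Hk 1 (- x) t = Hk 1 x t.
Proof. by rewrite /Hk sqrrN. Qed.

(** By evenness of the kernel, the initial datum contributes nothing to the boundary value: this is
    the effect of the odd reflection. *)
Lemma heat_conv_boundary_eq (h : R -> R) t : heat_conv (-1) 1 h 0 t = heat_conv 1 1 h 0 t.
Proof.
by apply: eq_Rintegral => y _; rewrite !add0r mulN1r mul1r Hk1_even.
Qed.

End initial_boundary_limits.

(** * Contour rotation of Gaussian integrals *)

Section gaussian_domination.
Context {R : realType}.
Implicit Types (x y s t z m : R) (A : set R).
Local Notation mu := (@lebesgue_measure R).
Local Notation integ A f := (mu.-integrable A (EFin \o f)).

Lemma pow_exp_dominated k m : 0 < m -> exists2 C, 0 <= C &
  forall s, 0 <= s -> s ^+ k * expR (- (m * s)) <= C * (1 + s ^+ 2)^-1.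
Proof.
move=> m0.
have H j s : 0 <= s -> s ^+ j * expR (- (m * s)) <= (m ^+ j)^-1 * j%:R ^+ j.
  move=> s0; rewrite ler_pdivlMl ?exprn_gt0// mulrA -exprMn.
  by apply: pow_expR_le; rewrite mulr_ge0// ltW.
have P j : 0 <= (m ^+ j)^-1 * j%:R ^+ j.
  by rewrite mulr_ge0 ?exprn_ge0// invr_ge0 exprn_ge0// ltW.
exists ((m ^+ k)^-1 * k%:R ^+ k + (m ^+ k.+2)^-1 * k.+2%:R ^+ k.+2).
  by rewrite addr_ge0.
move=> s s0; rewrite ler_pdivlMr; last by rewrite ltr_wpDr ?sqr_ge0.
rewrite mulrDr mulr1; apply: lerD; first exact: H.
by rewrite mulrC mulrA -exprD add2n; exact: H.
Qed.

Lemma pow_gauss_dominated k t : 0 < t -> exists2 C, 0 <= C &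
  forall s, `|s| ^+ k * expR (- (t * s ^+ 2)) <= C * (1 + s ^+ 2)^-1.
Proof.
move=> t0.
have H j s : (s ^+ 2) ^+ j * expR (- (t * s ^+ 2)) <= (t ^+ j)^-1 * j%:R ^+ j.
  rewrite ler_pdivlMl ?exprn_gt0// mulrA -exprMn.
  by apply: pow_expR_le; rewrite mulr_ge0 ?sqr_ge0// ltW.
have P j : 0 <= (t ^+ j)^-1 * j%:R ^+ j.
  by rewrite mulr_ge0 ?exprn_ge0// invr_ge0 exprn_ge0// ltW.
pose B j := (t ^+ j)^-1 * j%:R ^+ j.
exists ((B 0%N + B k) + (B 1%N + B k.+1)); first by rewrite !addr_ge0 ?P.
move=> s; rewrite ler_pdivlMr; last by rewrite ltr_wpDr ?sqr_ge0.
have h1 : `|s| ^+ k <= 1 + (s ^+ 2) ^+ k.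
  have -> : (s ^+ 2) ^+ k = (`|s| ^+ k) ^+ 2 by rewrite -[s ^+ 2]real_normK ?num_real// -!exprM mulnC.
  have := sqr_ge0 (`|s| ^+ k - 1 / 2); set w := `|s| ^+ k; nra.
apply: (@le_trans _ _ ((1 + (s ^+ 2) ^+ k) * expR (- (t * s ^+ 2)) * (1 + s ^+ 2))).
  by rewrite ler_wpM2r ?addr_ge0 ?sqr_ge0// ler_wpM2r ?expR_ge0.
rewrite [leLHS](_ : _ = ((s ^+ 2) ^+ 0 * expR (- (t * s ^+ 2)) +
    (s ^+ 2) ^+ k * expR (- (t * s ^+ 2))) +
    ((s ^+ 2) ^+ 1 * expR (- (t * s ^+ 2)) + (s ^+ 2) ^+ k.+1 * expR (- (t * s ^+ 2)))).
  by do 2!apply: lerD; exact: H.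
by rewrite expr0 expr1 [(s ^+ 2) ^+ k.+1]exprS; ring.
Qed.

Lemma dominated_cvgy (F : R -> R) C :
  (forall s, 0 < s -> `|F s| <= C * (1 + s ^+ 2)^-1) -> F s @[s --> +oo] --> (0 : R).
Proof.
move=> FC.
have C0 : 0 <= C.
  have := FC 1 ltr01; rewrite expr1n => h.
  have : 0 <= C * (1 + 1)^-1 by apply: le_trans h.
  by rewrite pmulr_lge0// invr_gt0.
apply/cvgrPdist_le => e e0; near=> s; rewrite sub0r normrN.
have s0 : 0 < s by near: s; exact: nbhs_pinfty_gt.
have s1 : 1 <= s by near: s; exact: nbhs_pinfty_ge.
have sC : C / e <= s by near: s; apply: nbhs_pinfty_ge; exact: num_real.
apply: le_trans (FC s s0) _.
rewrite ler_pdivrMr; last by rewrite ltr_wpDr ?sqr_ge0.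
rewrite ler_pdivrMr// mulrC in sC; apply: le_trans sC _.
by rewrite ler_wpM2l ?(ltW e0)//; nra.
Unshelve. all: by end_near. Qed.

Lemma cvgy_natS : (n.+1%:R : R) @[n --> \oo] --> +oo.
Proof.
apply/cvgryPgt => M; have := @cvgr_idn R => /cvgryPgt/(_ M).
by apply: filterS => n /lt_trans; apply; rewrite ltr_nat.
Qed.

Lemma Rintegral_FTC_T (f F : R -> R) l l' : integ setT f ->
  (forall x, {for x, continuous f}) -> (forall x, is_derive x 1 F (f x)) ->
  F x @[x --> +oo] --> l -> F (- x) @[x --> +oo] --> l' ->
  \int[mu]_(x in setT) f x = l - l'.
Proof.
move=> fi cf dF Fl Fl'.
apply: (@Rintegral_exhaust R _ f F (fun n => - n.+1%:R) (fun n => n.+1%:R)) => //.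
- by move=> n; apply: (@lt_trans _ _ 0); rewrite ?oppr_lt0 ltr0n.
- move=> x _; near=> n; rewrite -ler_norml; near: n.
  have := cvgy_natS => /cvgryPge/(_ `|x|); exact.
- exact: (cvg_comp _ _ cvgy_natS Fl').
- exact: (cvg_comp _ _ cvgy_natS Fl).
Unshelve. all: by end_near. Qed.

End gaussian_domination.

(** * Fourier integrals of the Gaussian *)

Section gaussian_fourier.
Context {R : realType}.
Implicit Types (x y s t z m : R) (A : set R).
Local Notation mu := (@lebesgue_measure R).
Local Notation integ A f := (mu.-integrable A (EFin \o f)).

(** The product of [f] with exp(z^2 / 4t) has derivative 0. *)
Lemma gauss_ode (f : R -> R) t z : 0 < t ->
  (forall z, is_derive z 1 f (- (z / (2 * t)) * f z)) ->
  f z = f 0 * expR (- (z ^+ 2 / (4 * t))).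
Proof.
move=> t0 hf.
have d (y : R) : is_derive y 1 (fun y => f y * expR (y ^+ 2 / (4 * t))) 0.
  have h := hf y; drve; field.
  by rewrite gt_eqF.
have := is_derive_0_is_cst z 0 d; rewrite expr0n mul0r expR0 mulr1 => <-.
by rewrite expRN mulfK// gt_eqF// expR_gt0.
Qed.

Lemma continuous_measurable A (f : R -> R) : measurable A -> continuous f -> measurable_fun A f.
Proof.
by move=> mA cf; apply: (measurable_funS measurableT) => //; exact: continuous_measurable_fun.
Qed.

Lemma norm_cos_le1 x : `|cos x| <= 1 :> R.
Proof. by rewrite ler_norml cos_geN1 cos_le1. Qed.

Lemma norm_sin_le1 x : `|sin x| <= 1 :> R.
Proof. by rewrite ler_norml sin_geN1 sin_le1. Qed.

(** [gcos] and [gsin] are the real and imaginary parts of s^k exp(i z s - t s^2). *)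
Definition gcos k t z s := s ^+ k * expR (- (t * s ^+ 2)) * cos (z * s).
Definition gsin k t z s := s ^+ k * expR (- (t * s ^+ 2)) * sin (z * s).

Lemma continuous_gcos k t z : continuous (gcos k t z).
Proof.
move=> s; have [d hd] : exists d, is_derive s 1 (gcos k t z) d.
  by eexists; rewrite /gcos; drv.
exact: is_derive_cont hd.
Qed.

Lemma continuous_gsin k t z : continuous (gsin k t z).
Proof.
move=> s; have [d hd] : exists d, is_derive s 1 (gsin k t z) d.
  by eexists; rewrite /gsin; drv.
exact: is_derive_cont hd.
Qed.

Lemma gcos_dominated k t : 0 < t -> exists2 C, 0 <= C &
  forall z s, `|gcos k t z s| <= C * (1 + s ^+ 2)^-1.
Proof.
move=> t0; have [C C0 HC] := pow_gauss_dominated k t0; exists C => // z s.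
rewrite normrM normrM normrX [`|expR _|]ger0_norm ?expR_ge0//.
apply: le_trans (HC s); rewrite ler_piMr ?norm_cos_le1//.
Qed.

Lemma gsin_dominated k t : 0 < t -> exists2 C, 0 <= C &
  forall z s, `|gsin k t z s| <= C * (1 + s ^+ 2)^-1.
Proof.
move=> t0; have [C C0 HC] := pow_gauss_dominated k t0; exists C => // z s.
rewrite normrM normrM normrX [`|expR _|]ger0_norm ?expR_ge0//.
apply: le_trans (HC s); rewrite ler_piMr ?norm_sin_le1//.
Qed.

Lemma integrable_gcos A k t z : measurable A -> 0 < t -> integ A (gcos k t z).
Proof.
move=> mA t0; have [C C0 HC] := gcos_dominated k t0.
apply: (integrable_dominated_oneDsqrV mA _ (c := C)) => //.
by apply: continuous_measurable => //; exact: continuous_gcos.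
Qed.

Lemma integrable_gsin A k t z : measurable A -> 0 < t -> integ A (gsin k t z).
Proof.
move=> mA t0; have [C C0 HC] := gsin_dominated k t0.
apply: (integrable_dominated_oneDsqrV mA _ (c := C)) => //.
by apply: continuous_measurable => //; exact: continuous_gsin.
Qed.

Lemma gcos_dz A t z : measurable A -> 0 < t ->
  is_derive z 1 (fun z => \int[mu]_(s in A) gcos 0 t z s)
    (\int[mu]_(s in A) (- 1 * gsin 1 t z s)).
Proof.
move=> mA t0; have [C C0 HC] := gsin_dominated 1 t0.
apply: (@derive_under_integral R (gcos 0 t) (fun z s => - 1 * gsin 1 t z s)
  A (z - 1) (z + 1) z (fun s => C * (1 + s ^+ 2)^-1)) => //.
- lra.
- by move=> y _; exact: integrable_gcos.
- by move=> y s _ _; rewrite /gcos /gsin; drve; rewrite expr0 expr1; ring.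
- by move=> y s _ _; rewrite mulN1r normrN; exact: HC.
- by apply: integrable_scale => //; exact: integrable_oneDsqrV.
Qed.

Lemma gsin_dz A t z : measurable A -> 0 < t ->
  is_derive z 1 (fun z => \int[mu]_(s in A) gsin 0 t z s)
    (\int[mu]_(s in A) gcos 1 t z s).
Proof.
move=> mA t0; have [C C0 HC] := gcos_dominated 1 t0.
apply: (@derive_under_integral R (gsin 0 t) (gcos 1 t)
  A (z - 1) (z + 1) z (fun s => C * (1 + s ^+ 2)^-1)) => //.
- lra.
- by move=> y _; exact: integrable_gsin.
- by move=> y s _ _; rewrite /gcos /gsin; drve; rewrite expr0 expr1; ring.
- by apply: integrable_scale => //; exact: integrable_oneDsqrV.
Qed.

Lemma gsin_ds t z s :
  is_derive s 1 (gsin 0 t z) (z * gcos 0 t z s - 2 * t * gsin 1 t z s).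
Proof. by rewrite /gsin /gcos; drve; rewrite !expr0 expr1; ring. Qed.

Lemma gcos_ds t z s :
  is_derive s 1 (gcos 0 t z) (- z * gsin 0 t z s - 2 * t * gcos 1 t z s).
Proof. by rewrite /gsin /gcos; drve; rewrite !expr0 expr1; ring. Qed.

(** The hypothesis says that the [s]-derivative of [gsin 0 t z] has integral 0; combined with
    differentiation in [z] it yields the equation of [gauss_ode]. Leaving [A] free serves both the
    half line and the line. *)
Lemma gcos_integral_ode A t z : measurable A -> 0 < t ->
  (forall z, \int[mu]_(s in A) (z * gcos 0 t z s - 2 * t * gsin 1 t z s) = 0) ->
  \int[mu]_(s in A) gcos 0 t z s =
  (\int[mu]_(s in A) gcos 0 t 0 s) * expR (- (z ^+ 2 / (4 * t))).
Proof.
move=> mA t0 H; apply: (gauss_ode (f := fun z => \int[mu]_(s in A) gcos 0 t z s)) => // y.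
have i1 := integrable_gcos 0 y mA t0; have i2 := integrable_gsin 1 y mA t0.
have E1 : \int[mu]_(s in A) (- 1 * gsin 1 t y s) = - 1 * \int[mu]_(s in A) gsin 1 t y s.
  by apply: RintegralZl.
have := H y.
have -> : \int[mu]_(s in A) (y * gcos 0 t y s - 2 * t * gsin 1 t y s) =
    \int[mu]_(s in A) (y * gcos 0 t y s) - \int[mu]_(s in A) (2 * t * gsin 1 t y s).
  by apply: RintegralB => //; exact: integrable_scale.
have -> : \int[mu]_(s in A) (y * gcos 0 t y s) = y * \int[mu]_(s in A) gcos 0 t y s.
  by apply: RintegralZl.
have -> : \int[mu]_(s in A) (2 * t * gsin 1 t y s) = 2 * t * \int[mu]_(s in A) gsin 1 t y s.
  by apply: RintegralZl.
have := gcos_dz y mA t0; rewrite E1.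
move: (\int[mu]_(s in A) gcos 0 t y s) (\int[mu]_(s in A) gsin 1 t y s) => a b h e.
have tn : 2 * t != 0 by rewrite mulf_neq0 ?gt_eqF.
have -> : - (y / (2 * t)) * a = - 1 * b.
  have ya : y * a = 2 * t * b by lra.
  by rewrite mulN1r mulNr mulrAC ya; field; rewrite gt_eqF.
exact: h.
Qed.

Lemma gauss_Phi t s : 0 < t ->
  is_derive s 1 (fun s => Num.sqrt pi / Num.sqrt t * Phi (Num.sqrt t * s)) (gcos 0 t 0 s).
Proof.
move=> t0; have q0 : Num.sqrt t != 0 by rewrite gt_eqF// sqrtr_gt0.
have p0 : Num.sqrt pi != 0 :> R by rewrite gt_eqF// sqrt_pi_gt0.
drve; rewrite /gcos /gauss_fun [0 * s]mul0r cos0 expr0 exprMn sqr_sqrtr ?(ltW t0)//.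
by field; rewrite q0 p0.
Qed.

Lemma Phi_scale_cvgy t : 0 < t ->
  (Num.sqrt pi / Num.sqrt t * Phi (Num.sqrt t * s)) @[s --> +oo] -->
  (Num.sqrt pi / Num.sqrt t : R).
Proof.
move=> t0; rewrite -[X in _ --> X]mulr1; apply: cvgMr.
apply: (cvg_comp _ _ _ cvgy_Phi).
have q0 : 0 < Num.sqrt t by rewrite sqrtr_gt0.
exact: (gt0_cvgMry q0 (@cvg_id _ _)).
Qed.

Lemma Phi_scale_cvgNy t : 0 < t ->
  (Num.sqrt pi / Num.sqrt t * Phi (Num.sqrt t * - s)) @[s --> +oo] --> (0 : R).
Proof.
move=> t0; have := Phi_scale_cvgy t0 => h.
rewrite (_ : (fun s => _) = fun s => Num.sqrt pi / Num.sqrt t -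
    Num.sqrt pi / Num.sqrt t * Phi (Num.sqrt t * s)).
  by rewrite -[X in _ --> X](subrr (Num.sqrt pi / Num.sqrt t)); apply: cvgB => //; exact: cvg_cst.
apply/funext => s; have := Phi_symm (Num.sqrt t * s); rewrite mulrN => e.
by rewrite -[X in X - _]mulr1 -mulrBr; congr (_ * _); lra.
Qed.

Lemma gauss_prefactor t z : 0 < t ->
  Num.sqrt pi / Num.sqrt t * expR (- (z ^+ 2 / (4 * t))) = 2 * pi * Hk 1 z t.
Proof.
move=> t0; have q0 : Num.sqrt t != 0 by rewrite gt_eqF// sqrtr_gt0.
have p0 : Num.sqrt pi != 0 :> R by rewrite gt_eqF// sqrt_pi_gt0.
rewrite /Hk -[X in 2 * X * _](sqr_sqrtr (ltW (pi_gt0 R))).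
by field; rewrite q0 p0.
Qed.

Lemma gcos_integral_half t z : 0 < t ->
  \int[mu]_(s in `]0, +oo[) gcos 0 t z s = pi * Hk 1 z t.
Proof.
move=> t0; have mA : measurable (`]0, +oo[ : set R) by [].
rewrite gcos_integral_ode//; last first.
  move=> y; have [C C0 HC] := gsin_dominated 0 t0.
  rewrite -[RHS](subrr 0); apply: (@Rintegral_FTC_y R _ (gsin 0 t y)).
  - apply: integrable_sub => //; apply: integrable_scale => //.
      exact: integrable_gcos.
    exact: integrable_gsin.
  - move=> s _; apply: cvgB; apply: cvgM; try exact: cvg_cst.
      exact: continuous_gcos.
    exact: continuous_gsin.
  - by move=> s _; exact: gsin_ds.
  - apply: cvg_at_right_filter; rewrite -[X in _ --> X](_ : gsin 0 t y 0 = 0).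
      exact: continuous_gsin.
    by rewrite /gsin mulr0 sin0 mulr0.
  - by apply: (dominated_cvgy (C := C)) => s _; exact: HC.
have -> : \int[mu]_(s in `]0, +oo[) gcos 0 t 0 s =
    Num.sqrt pi / Num.sqrt t - Num.sqrt pi / Num.sqrt t * 2^-1.
  apply: (@Rintegral_FTC_y R (gcos 0 t 0)
      (fun s => Num.sqrt pi / Num.sqrt t * Phi (Num.sqrt t * s))
      (Num.sqrt pi / Num.sqrt t * 2^-1) (Num.sqrt pi / Num.sqrt t)).
  - exact: integrable_gcos.
  - by move=> s _; exact: continuous_gcos.
  - by move=> s _; exact: gauss_Phi.
  - apply: cvg_at_right_filter; rewrite -Phi_0 -[X in Phi X](mulr0 (Num.sqrt t)).
    exact: is_derive_cont (gauss_Phi 0 t0).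
  - exact: Phi_scale_cvgy.
rewrite [X in X * _](_ : _ = Num.sqrt pi / Num.sqrt t / 2); last by lra.
by rewrite mulrAC gauss_prefactor//; lra.
Qed.

Lemma gcos_integral t z : 0 < t ->
  \int[mu]_(s in setT) gcos 0 t z s = 2 * pi * Hk 1 z t.
Proof.
move=> t0; rewrite gcos_integral_ode//; last first.
  move=> y; have [C C0 HC] := gsin_dominated 0 t0.
  rewrite -[RHS](subrr 0); apply: (@Rintegral_FTC_T R _ (gsin 0 t y)).
  - apply: integrable_sub => //; apply: integrable_scale => //.
      exact: integrable_gcos.
    exact: integrable_gsin.
  - move=> s; apply: cvgB; apply: cvgM; try exact: cvg_cst.
      exact: continuous_gcos.
    exact: continuous_gsin.
  - by move=> s; exact: gsin_ds.
  - by apply: (dominated_cvgy (C := C)) => s _; exact: HC.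
  - by apply: (dominated_cvgy (C := C)) => s _; have := HC y (- s); rewrite sqrrN.
have -> : \int[mu]_(s in setT) gcos 0 t 0 s = Num.sqrt pi / Num.sqrt t - 0.
  apply: (@Rintegral_FTC_T R (gcos 0 t 0)
      (fun s => Num.sqrt pi / Num.sqrt t * Phi (Num.sqrt t * s)) (Num.sqrt pi / Num.sqrt t) 0).
  - exact: integrable_gcos.
  - by move=> s; exact: continuous_gcos.
  - by move=> s; exact: gauss_Phi.
  - exact: Phi_scale_cvgy.
  - exact: Phi_scale_cvgNy.
by rewrite subr0 gauss_prefactor.
Qed.

(** The same differential equation with initial value 0. It is specific to the full line: on the
    half line [gcos] would leave a boundary term at [s = 0]. *)
Lemma gsin_integral t z : 0 < t -> \int[mu]_(s in setT) gsin 0 t z s = 0.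
Proof.
move=> t0; have mA : measurable (setT : set R) by [].
suff -> : \int[mu]_(s in setT) gsin 0 t z s =
    (\int[mu]_(s in setT) gsin 0 t 0 s) * expR (- (z ^+ 2 / (4 * t))).
  rewrite (_ : gsin 0 t 0 = fun=> 0); last first.
    by apply/funext => s; rewrite /gsin mul0r sin0 mulr0.
  by rewrite Rintegral_cst// !mul0r.
apply: (gauss_ode (f := fun z => \int[mu]_(s in setT) gsin 0 t z s)) => // y.
have i1 := integrable_gsin 0 y mA t0; have i2 := integrable_gcos 1 y mA t0.
have : \int[mu]_(s in setT) (- y * gsin 0 t y s - 2 * t * gcos 1 t y s) = 0.
  have [C C0 HC] := gcos_dominated 0 t0.
  rewrite -[RHS](subrr 0); apply: (@Rintegral_FTC_T R _ (gcos 0 t y)).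
  - by apply: integrable_sub => //; exact: integrable_scale.
  - move=> s; apply: cvgB; apply: cvgM; try exact: cvg_cst.
      exact: continuous_gsin.
    exact: continuous_gcos.
  - by move=> s; exact: gcos_ds.
  - by apply: (dominated_cvgy (C := C)) => s _; exact: HC.
  - by apply: (dominated_cvgy (C := C)) => s _; have := HC y (- s); rewrite sqrrN.
have -> : \int[mu]_(s in setT) (- y * gsin 0 t y s - 2 * t * gcos 1 t y s) =
    \int[mu]_(s in setT) (- y * gsin 0 t y s) - \int[mu]_(s in setT) (2 * t * gcos 1 t y s).
  by apply: RintegralB => //; exact: integrable_scale.
have -> : \int[mu]_(s in setT) (- y * gsin 0 t y s) = - y * \int[mu]_(s in setT) gsin 0 t y s.
  by apply: RintegralZl.
have -> : \int[mu]_(s in setT) (2 * t * gcos 1 t y s) = 2 * t * \int[mu]_(s in setT) gcos 1 t y s.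
  by apply: RintegralZl.
have := gsin_dz y mA t0.
move: (\int[mu]_(s in setT) gsin 0 t y s) (\int[mu]_(s in setT) gcos 1 t y s) => a b h e.
have tn : 2 * t != 0 by rewrite mulf_neq0 ?gt_eqF.
have -> : - (y / (2 * t)) * a = b.
  have ya : y * a = - (2 * t * b) by lra.
  by rewrite mulNr mulrAC ya; field; rewrite gt_eqF.
exact: h.
Qed.

End gaussian_fourier.

(** * Cauchy's theorem on a rotating ray *)

Section contour_rotation.
Context {R : realType}.
Variables (z t : R).
Hypotheses (z0 : 0 < z) (t0 : 0 < t).
Local Notation mu := (@lebesgue_measure R).
Local Notation integ A f := (mu.-integrable A (EFin \o f)).
Implicit Types (a s : R).

(* Modulus and argument of exp(i l z - l^2 t) at l = s (1 + i a). *)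
Let E a s := expR (- (z * a * s) - t * (1 - a ^+ 2) * s ^+ 2).
Let phi a s := z * s - 2 * a * t * s ^+ 2.

(* Real part of exp(i l z - l^2 t) dl/ds along the ray l = s (1 + i a). *)
Definition ray_re a s :=
  expR (- (z * a * s) - t * (1 - a ^+ 2) * s ^+ 2) *
  (cos (z * s - 2 * a * t * s ^+ 2) - a * sin (z * s - 2 * a * t * s ^+ 2)).

(** With f(l) = exp(i l z - l^2 t) and l = s (1 + i a), one has d/da (f(l) dl/ds) = d/ds (i s f(l)).
    [chi] is the real part of i s f(l), so [dchi] is both the [a]-derivative of [ray_re] and the
    [s]-derivative of [chi]. *)
Let chi a s := - (s * E a s * sin (phi a s)).
Let dchi a s := E a s * (sin (phi a s) * (z * a * s + 2 * t * (1 - a ^+ 2) * s ^+ 2 - 1)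
  + cos (phi a s) * (4 * a * t * s ^+ 2 - z * s)).

Let ray_re_da a s : is_derive a 1 (ray_re ^~ s) (dchi a s).
Proof. by rewrite /ray_re /dchi /E /phi; drve; ring. Qed.

Let chi_ds a s : is_derive s 1 (chi a) (dchi a s).
Proof. by rewrite /chi /dchi /E /phi; drve; ring. Qed.

Let continuous_ray_re a : continuous (ray_re a).
Proof.
move=> s; have [d hd] : exists d, is_derive s 1 (ray_re a) d.
  by eexists; rewrite /ray_re; drv.
exact: is_derive_cont hd.
Qed.

Let continuous_dchi a : continuous (dchi a).
Proof.
move=> s; have [d hd] : exists d, is_derive s 1 (dchi a) d.
  by eexists; rewrite /dchi /E /phi; drv.
exact: is_derive_cont hd.
Qed.

Let m := Num.min z t.

Let m0 : 0 < m. Proof. by rewrite /m lt_min z0 t0. Qed.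

(** The bound is uniform in the slope, although Gaussian decay is lost at [a = 1] and the decay from
    [z] at [a = 0]. As a^2 <= a, minus the exponent is at least m (a s + (1 - a) s^2), hence at
    least m s when s >= 1; for s <= 1 the factor [expR m] compensates. *)
Let E_bound a s : 0 <= a <= 1 -> 0 <= s -> E a s <= expR m * expR (- (m * s)).
Proof.
move=> /andP[a0 a1] s0; rewrite -expRD ler_expR.
have mz : m <= z by rewrite /m ge_min lexx.
have mt : m <= t by rewrite /m ge_min lexx orbT.
have h1 : m * a * s <= z * a * s by rewrite !ler_wpM2r.
have aa : a ^+ 2 <= a by rewrite expr2 ler_piMl.
have h2 : m * (1 - a) * s ^+ 2 <= t * (1 - a ^+ 2) * s ^+ 2.
  by rewrite ler_wpM2r ?sqr_ge0//; apply: ler_pM => //; [exact: ltW|lra|lra].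
have [s1|s1] := leP s 1.
  have : 0 <= m * (1 - s) by rewrite mulr_ge0 ?(ltW m0)//; lra.
  have : 0 <= m * a * s by rewrite !mulr_ge0// ltW.
  have : 0 <= m * (1 - a) * s ^+ 2 by rewrite !mulr_ge0 ?sqr_ge0 ?(ltW m0)//; lra.
  lra.
have h3 : m * (1 - a) * s <= m * (1 - a) * s ^+ 2.
  rewrite ler_wpM2l//; first by rewrite mulr_ge0 ?(ltW m0)//; lra.
  by rewrite expr2 ler_peMl// ltW.
have := m0; lra.
Qed.

Let E_ge0 a s : 0 <= E a s. Proof. exact: expR_ge0. Qed.

Let E_dominated k : exists2 C, 0 <= C & forall a s, 0 <= a <= 1 -> 0 <= s ->
  s ^+ k * E a s <= C * (1 + s ^+ 2)^-1.
Proof.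
have [C C0 HC] := pow_exp_dominated k m0.
exists (expR m * C); first by rewrite mulr_ge0// expR_ge0.
move=> a s a01 s0; apply: (@le_trans _ _ (s ^+ k * (expR m * expR (- (m * s))))).
  by rewrite ler_wpM2l ?exprn_ge0// E_bound.
by rewrite mulrCA -mulrA ler_wpM2l ?expR_ge0// HC.
Qed.

Let ray_re_dominated : exists2 C, 0 <= C & forall a s, 0 <= a <= 1 -> 0 <= s ->
  `|ray_re a s| <= C * (1 + s ^+ 2)^-1.
Proof.
have [C C0 HC] := E_dominated 0; exists (C * 2); first by rewrite mulr_ge0.
move=> a s a01 s0; rewrite normrM [`|expR _|]ger0_norm ?expR_ge0// [leRHS]mulrAC.
apply: ler_pM => //.
  by have := HC a s a01 s0; rewrite expr0 mul1r.
apply: le_trans (ler_normB _ _) _; rewrite normrM.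
have h1 := norm_cos_le1 (z * s - 2 * a * t * s ^+ 2).
have h2 := norm_sin_le1 (z * s - 2 * a * t * s ^+ 2).
have : `|a| * `|sin (z * s - 2 * a * t * s ^+ 2)| <= 1 * 1.
  by apply: ler_pM => //; rewrite ger0_norm; lra.
lra.
Qed.

Let dchi_dominated : exists2 C, 0 <= C & forall a s, 0 <= a <= 1 -> 0 <= s ->
  `|dchi a s| <= C * (1 + s ^+ 2)^-1.
Proof.
have [C0 C00 H0] := E_dominated 0; have [C1 C10 H1] := E_dominated 1.
have [C2 C20 H2] := E_dominated 2.
have zt0 : 0 <= 2 * z by rewrite mulr_ge0 ?(ltW z0).
have tt0 : 0 <= 6 * t by rewrite mulr_ge0 ?(ltW t0).
exists (C0 + 2 * z * C1 + 6 * t * C2); first by rewrite !addr_ge0// mulr_ge0.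
move=> a s a01 s0; rewrite normrM ger0_norm//.
have B : `|sin (phi a s) * (z * a * s + 2 * t * (1 - a ^+ 2) * s ^+ 2 - 1)
    + cos (phi a s) * (4 * a * t * s ^+ 2 - z * s)| <= 1 + 2 * z * s + 6 * t * s ^+ 2.
  have zs : 0 <= z * s by rewrite mulr_ge0// ltW.
  have ts : 0 <= t * s ^+ 2 by rewrite mulr_ge0 ?sqr_ge0// ltW.
  have za : 0 <= a * (z * s) <= z * s.
    by rewrite mulr_ge0 ?ler_piMl//; lra.
  have ta : 0 <= a * (t * s ^+ 2) <= t * s ^+ 2.
    by rewrite mulr_ge0 ?ler_piMl//; lra.
  have a2 : 0 <= a ^+ 2 <= 1.
    by rewrite sqr_ge0 expr_le1//; lra.
  have ta2 : 0 <= a ^+ 2 * (t * s ^+ 2) <= t * s ^+ 2.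
    by rewrite mulr_ge0 ?ler_piMl//; lra.
  apply: le_trans (ler_normD _ _) _; rewrite !normrM.
  apply: (@le_trans _ _ (1 * (1 + z * s + 2 * (t * s ^+ 2)) +
      1 * (4 * (t * s ^+ 2) + z * s))); last by lra.
  apply: lerD; apply: ler_pM => //; rewrite ?norm_sin_le1 ?norm_cos_le1// ler_norml.
    have -> : z * a * s + 2 * t * (1 - a ^+ 2) * s ^+ 2 - 1 = a * (z * s) +
      2 * (t * s ^+ 2) - 2 * (a ^+ 2 * (t * s ^+ 2)) - 1 by ring.
    lra.
  have -> : 4 * a * t * s ^+ 2 - z * s = 4 * (a * (t * s ^+ 2)) - z * s by ring.
  lra.
apply: (@le_trans _ _ (E a s * (1 + 2 * z * s + 6 * t * s ^+ 2))).
  by rewrite ler_wpM2l.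
have -> : E a s * (1 + 2 * z * s + 6 * t * s ^+ 2) = s ^+ 0 * E a s +
    2 * z * (s ^+ 1 * E a s) + 6 * t * (s ^+ 2 * E a s) by rewrite expr0 expr1; ring.
set w := (1 + s ^+ 2)^-1.
rewrite [leRHS](_ : _ = C0 * w + 2 * z * (C1 * w) + 6 * t * (C2 * w)); last by ring.
apply: lerD; last by apply: ler_wpM2l; [exact: tt0|exact: H2].
by apply: lerD; [exact: H0|apply: ler_wpM2l; [exact: zt0|exact: H1]].
Qed.

Let J a := \int[mu]_(s in `]0, +oo[) ray_re a s.

Let ray_re_measurable a : measurable_fun (`]0, +oo[ : set R) (ray_re a).
Proof. by apply: continuous_measurable => //; exact: continuous_ray_re. Qed.

Let integrable_ray_re a : 0 <= a <= 1 -> integ `]0, +oo[ (ray_re a).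
Proof.
move=> a01; have [C C0 HC] := ray_re_dominated.
apply: (integrable_dominated_oneDsqrV (c := C)) => // s; rewrite /= in_itv/= andbT => s0.
by apply: HC => //; exact: ltW.
Qed.

(* The derivative in [a] is a total derivative in [s]: this is Cauchy's theorem
   for the rotation of the ray. *)
Let J_da a : 0 < a < 1 -> is_derive a 1 J 0.
Proof.
move=> a01; have [C C0 HC] := dchi_dominated.
have -> : 0 = \int[mu]_(s in `]0, +oo[) dchi a s.
  have [C1 C10 HC1] := E_dominated 1.
  rewrite -[LHS](subrr 0); symmetry; apply: (@Rintegral_FTC_y R _ (chi a)).
  - apply: (integrable_dominated_oneDsqrV (c := C)) => //.
      by apply: continuous_measurable => //; exact: continuous_dchi.
    move=> s; rewrite /= in_itv/= andbT => s0; apply: HC; [lra|exact: ltW].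
  - by move=> s _; exact: continuous_dchi.
  - by move=> s _; exact: chi_ds.
  - apply: cvg_at_right_filter; rewrite -[X in _ --> X](_ : chi a 0 = 0).
      exact: is_derive_cont (chi_ds a 0).
    by rewrite /chi !mul0r oppr0.
  - apply: (dominated_cvgy (C := C1)) => s s0; rewrite normrN normrM.
    rewrite ger0_norm; last by rewrite mulr_ge0// ltW.
    apply: (@le_trans _ _ (s ^+ 1 * E a s)); last by apply: HC1; [lra|exact: ltW].
    by rewrite expr1 ler_piMr ?norm_sin_le1// mulr_ge0// ltW.
apply: (@derive_under_integral R ray_re dchi _ 0 1 a (fun s => C * (1 + s ^+ 2)^-1)) => //.
- by move=> y y01; apply: integrable_ray_re; lra.
- move=> y s y01; rewrite /= in_itv/= andbT => s0; apply: HC; [lra|exact: ltW].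
- by apply: integrable_scale => //; exact: integrable_oneDsqrV.
Qed.

Let J_cst a b : 0 < a < 1 -> 0 < b < 1 -> J a = J b.
Proof.
move=> a01 b01; apply/esym/eqP; rewrite -subr_eq0 -normr_le0.
rewrite -(mul0r `|b - a|); apply: (@mean_value_bound R J (fun=> 0)).
  move=> x /andP[]; rewrite ge_min le_max => h1 h2; apply: J_da.
  by case/orP : h1 => h1; case/orP : h2 => h2; lra.
by move=> x _; rewrite normr0.
Qed.

(** Differentiation needs an open interval of slopes, so the ends 0 (the real half line) and 1 (the
    ray at pi/4) are reached by continuity. *)
Let J_cvg0 : J a @[a --> 0^'+] --> J 0.
Proof.
have [C C0 HC] := ray_re_dominated.
apply: (@dominated_at_right R _ ray_re _ (fun s => C * (1 + s ^+ 2)^-1) 1) => //.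
- by move=> x s x01; rewrite /= in_itv/= andbT => s0; apply: HC; [lra|exact: ltW].
- by apply: integrable_scale => //; exact: integrable_oneDsqrV.
- by move=> s _; apply: cvg_at_right_filter; exact: is_derive_cont (ray_re_da 0 s).
Qed.

Let J_cvg1 : J (1 - a) @[a --> 0^'+] --> J 1.
Proof.
have [C C0 HC] := ray_re_dominated.
apply: (@dominated_at_right R _ (fun a => ray_re (1 - a)) _ (fun s => C * (1 + s ^+ 2)^-1) 1) => //.
- by move=> x s x01; rewrite /= in_itv/= andbT => s0; apply: HC; [lra|exact: ltW].
- by apply: integrable_scale => //; exact: integrable_oneDsqrV.
- move=> s _; apply: cvg_at_right_filter; rewrite -{2}[1](subr0 1).
  apply: (@continuous_comp _ _ _ (fun a : R => 1 - a) (ray_re ^~ s)).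
    by apply: cvgB; [exact: cvg_cst|exact: cvg_id].
  exact: is_derive_cont (ray_re_da _ s).
Qed.

Lemma ray_re_integral : \int[mu]_(s in `]0, +oo[) ray_re 1 s = pi * Hk 1 z t.
Proof.
have e0 : J 0 = J (1 / 2).
  apply: (cvg_unique _ J_cvg0) => //.
  apply: (cvg_trans _ (@cvg_cst _ (J (1 / 2)) _ 0^'+ _)).
  apply: near_eq_cvg; near=> a; apply: J_cst; first lra.
  by apply/andP; split => //; near: a; exact: nbhs_right_lt.
have e1 : J 1 = J (1 / 2).
  apply: (cvg_unique _ J_cvg1) => //.
  apply: (cvg_trans _ (@cvg_cst _ (J (1 / 2)) _ 0^'+ _)).
  apply: near_eq_cvg; near=> a; apply: J_cst; first lra.
  have a0 : 0 < a by near: a; exact: nbhs_right_gt.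
  have a1 : a < 1 by near: a; exact: nbhs_right_lt.
  lra.
rewrite -[LHS]/(J 1) e1 -e0 -gcos_integral_half//.
apply: eq_Rintegral => s _; rewrite /ray_re /gcos expr0 mul1r expr0n/=.
rewrite (_ : - (z * 0 * s) - t * (1 - 0) * s ^+ 2 = - (t * s ^+ 2)); last by ring.
rewrite (_ : z * s - 2 * 0 * t * s ^+ 2 = z * s); last by ring.
by rewrite mul0r subr0.
Unshelve. all: by end_near. Qed.

End contour_rotation.

(** * Boundary values from uniform bounds *)

Section boundary_values.
Context {R : realType}.
Implicit Types (x y s t a b e r C : R).

Lemma boundary_cvg (f df : R -> R) r C : 0 < r ->
  (forall x, 0 < x <= r -> is_derive x 1 f (df x)) ->
  (forall x, 0 < x <= r -> `|df x| <= C) ->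
  exists L, f x @[x --> 0^'+] --> (L : R).
Proof.
move=> r0 fd fb.
have C0 : 0 <= C by apply: le_trans (fb r _); rewrite ?normr_ge0// r0 lexx.
suff cf : cvg (f x @[x --> 0^'+]) by exists (lim (f x @[x --> 0^'+])).
apply: cauchy_cvg; apply/cauchyP => e e0.
(* [f x0] is the centre of a Cauchy ball: on []0, x0]] the function varies by at most
   [C * x0 < e]. *)
pose x0 := Num.min r (e / (2 * (C + 1))).
have x00 : 0 < x0.
  by rewrite /x0 lt_min r0/= divr_gt0// mulr_gt0// ltr_wpDl.
have x0r : x0 <= r by rewrite /x0 ge_min lexx.
have x0e : 2 * (C * x0) < 2 * e.
  have : x0 <= e / (2 * (C + 1)) by rewrite /x0 ge_min lexx orbT.
  rewrite ler_pdivlMr; last by rewrite mulr_gt0// ltr_wpDl.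
  by have := x00; lra.
exists (f x0); suff: \forall x \near 0^'+, ball (f x0) e (f x) by [].
near=> x.
have xp : 0 < x by near: x; exact: nbhs_right_gt.
have xx0 : x <= x0 by near: x; exact: nbhs_right_le.
rewrite /ball/=; apply: (@le_lt_trans _ _ (C * `|x0 - x|)).
  apply: (@mean_value_bound R f df) => z; rewrite (min_idPl xx0) (max_idPr xx0) => zx.
    by apply: fd; lra.
  by apply: fb; lra.
apply: (@le_lt_trans _ _ (C * x0)); last by lra.
by rewrite ler_wpM2l// ger0_norm; lra.
Unshelve. all: by end_near. Qed.

Lemma derive_of_quadratic (L : R -> R) t l r C : 0 < r -> 0 <= C ->
  (forall h, `|h| <= r -> `|L (t + h) - L t - h * l| <= C * `|h| ^+ 2) ->
  is_derive t 1 L l.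
Proof.
move=> r0 C0 HL.
have lim : h^-1 *: (L (h *: (1 : R) + t) - L t) @[h --> 0^'] --> l.
  apply/cvgrPdist_le => e e0; near=> h.
  have h0 : h != 0 by near: h; exact: nbhs_dnbhs_neq.
  have hr : `|h| <= r by near: h; exact: dnbhs0_le.
  have he : `|h| <= e / (C + 1) by near: h; apply: dnbhs0_le; rewrite divr_gt0// ltr_wpDl.
  have -> : h%:A = h :> R by exact: mulr1.
  rewrite distrC.
  have -> : h^-1 *: (L (h + t) - L t) - l = h^-1 * (L (t + h) - L t - h * l).
    by rewrite [h + t]addrC /GRing.scale/=; field.
  rewrite normrM normfV ler_pdivrMl ?normr_gt0//; apply: le_trans (HL h hr) _.
  rewrite expr2 mulrCA ler_wpM2l//.
  rewrite ler_pdivlMr ?ltr_wpDl// in he; apply: le_trans he.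
  by rewrite mulrDr mulr1 mulrC lerDl.
apply: DeriveDef; first by apply/cvg_ex; exists l.
by rewrite /derive; apply/cvg_lim.
Unshelve. all: by end_near. Qed.

(* Taylor's inequality is uniform in [x], so it survives the limit [x --> 0^'+]. *)
Lemma boundary_derive (f0 f1 f2 : R -> R -> R) (L0 : R -> R) t l r C : 0 < r ->
  (forall x s, 0 < x <= 1 -> `|s - t| <= r -> is_derive s 1 (f0 x) (f1 x s)) ->
  (forall x s, 0 < x <= 1 -> `|s - t| <= r -> is_derive s 1 (f1 x) (f2 x s)) ->
  (forall x s, 0 < x <= 1 -> `|s - t| <= r -> `|f2 x s| <= C) ->
  (forall s, `|s - t| <= r -> f0 x s @[x --> 0^'+] --> L0 s) ->
  f1 x t @[x --> 0^'+] --> l -> is_derive t 1 L0 l.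
Proof.
move=> r0 d0 d1 b2 c0 c1.
have C0 : 0 <= C.
  by apply: le_trans (b2 1 t _ _); rewrite ?normr_ge0 ?subrr ?normr0 ?(ltW r0)// ltr01 lexx.
have between h s : Num.min t (t + h) <= s <= Num.max t (t + h) -> `|s - t| <= `|h|.
  move=> /andP[]; rewrite ge_min le_max => /orP[] h1 /orP[] h2; rewrite ler_norml;
    have := ler_norm h; have := ler_norm (- h); rewrite normrN; lra.
have taylor x h : 0 < x <= 1 -> `|h| <= r ->
    `|f0 x (t + h) - f0 x t - h * f1 x t| <= C * `|h| ^+ 2.
  move=> x01 hr.
  have -> : f0 x (t + h) - f0 x t - h * f1 x t =
      (f0 x (t + h) - (t + h) * f1 x t) - (f0 x t - t * f1 x t) by ring.
  have hE : h = t + h - t by rewrite addrC addKr.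
  rewrite expr2 mulrA [in X in _ <= _ * X]hE.
  (* Two mean value inequalities are nested: the inner one bounds the derivative [f1 x s - f1 x t]
     by [C] times the modulus of [h]. *)
  apply: (@mean_value_bound R (fun s => f0 x s - s * f1 x t) (fun s => f1 x s - f1 x t)).
    move=> s /between hs; have d := d0 x s x01 (le_trans hs hr).
    by drve; ring.
  move=> s /between hs; apply: (@le_trans _ _ (C * `|s - t|)); last by rewrite ler_wpM2l.
  apply: (@mean_value_bound R (f1 x) (f2 x)) => y; rewrite -{1 2}(addrNK t s) [s - t + t]addrC;
    move=> /between hy; [apply: d1 => //|apply: b2 => //]; exact: le_trans hy (le_trans hs hr).
apply: (@derive_of_quadratic L0 t l r C) => // h hr.
have ct : `|f0 x (t + h) - f0 x t - h * f1 x t| @[x --> 0^'+] -->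
    `|L0 (t + h) - L0 t - h * l|.
  apply: cvg_norm; apply: cvgB; first apply: cvgB.
  - by apply: c0; rewrite addrC addKr.
  - by apply: c0; rewrite subrr normr0 ltW.
  - by apply: cvgMr.
apply: (cvgr_to_le ct); near=> x; apply: taylor => //; apply/andP; split.
  by near: x; exact: nbhs_right_gt.
by near: x; exact: nbhs_right_le.
Unshelve. all: by end_near. Qed.

End boundary_values.

(** * Consequences of the two sets of bounds *)

Section heat_family.
Context {R : realType}.
Implicit Types (x y s t a b e r C : R).

(** The interface between the kernel estimates and the regularity statements, instantiated by the
    real and by the imaginary part of the solution. [heat_decay] holds up to [x = 0] and at infinity
    at once, [heat_initial] up to [t = 0]; both stay away from the corner. *)
Record heat_family (F : nat -> R -> R -> R) := HeatFamily {
  heat_dx : forall n x t, 0 < x -> 0 < t -> is_derive x 1 (F n ^~ t) (F n.+1 x t);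
  heat_dt : forall n x t, 0 < x -> 0 < t -> is_derive t 1 (F n x) (F n.+2 x t);
  heat_decay : forall n M a b, 0 < a -> exists2 C, 0 <= C &
    forall x t, 0 < x -> a <= t <= b -> x ^+ M * `|F n x t| <= C;
  heat_initial : forall n a b, 0 < a -> exists2 C, 0 <= C &
    forall x t, a <= x <= b -> 0 < t <= b -> `|F n x t| <= C }.

Variables (F : nat -> R -> R -> R) (HF : heat_family F).

Lemma heat_family_bounded n a b : 0 < a -> exists2 C, 0 <= C &
    forall x t, 0 < x -> a <= t <= b -> `|F n x t| <= C.
Proof.
move=> a0; have [C C0 HC] := heat_decay HF n 0 b a0; exists C => // x t x0 tab.
by have := HC x t x0 tab; rewrite expr0 mul1r.
Qed.

(** Joint continuity follows from locally bounded partial derivatives, moving first in time at fixed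
    [x] and then in space at time [p.2]. *)
Lemma heat_family_continuous n x t : 0 < x -> 0 < t ->
  {for (x, t), continuous (fun p : R * R => F n p.1 p.2)}.
Proof.
move=> x0 t0; have t2 : 0 < t / 2 by rewrite divr_gt0.
have x2 : 0 < x / 2 by rewrite divr_gt0.
have [C1 C10 H1] := heat_family_bounded n.+1 (2 * t) t2.
have [C2 C20 H2] := heat_family_bounded n.+2 (2 * t) t2.
have c1 : p.1 @[p --> (x, t)] --> x by exact: cvg_fst.
have c2 : p.2 @[p --> (x, t)] --> t by exact: cvg_snd.
apply/cvgrPdist_le => e e0 /=; near=> p.
have p1 : `|x - p.1| <= x / 2.
  by near: p; move/cvgrPdist_le : c1; apply.
have p2 : `|t - p.2| <= t / 2.
  by near: p; move/cvgrPdist_le : c2; apply.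
have q1 : `|x - p.1| <= e / 2 / (C1 + 1).
  by near: p; move/cvgrPdist_le : c1; apply; rewrite !divr_gt0// ltr_wpDl.
have q2 : `|t - p.2| <= e / 2 / (C2 + 1).
  by near: p; move/cvgrPdist_le : c2; apply; rewrite !divr_gt0// ltr_wpDl.
have := p1; rewrite ler_norml => p1'; have := p2; rewrite ler_norml => p2'.
have b1 : `|F n x p.2 - F n p.1 p.2| <= C1 * `|x - p.1|.
  apply: (@mean_value_bound R (F n ^~ p.2) (fun x => F n.+1 x p.2)) => z;
    move=> /andP[]; rewrite ge_min le_max => h1 h2.
    by apply: (heat_dx HF); clear -x0 t0 p1' p2' h1 h2; case/orP : h1 => h1; lra.
  by apply: H1; clear -x0 t0 p1' p2' h1 h2; case/orP : h1 => h1; lra.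
have b2 : `|F n x t - F n x p.2| <= C2 * `|t - p.2|.
  apply: (@mean_value_bound R (F n x) (F n.+2 x)) => z;
    move=> /andP[]; rewrite ge_min le_max => h1 h2.
    by apply: (heat_dt HF) => //; clear -x0 t0 p1' p2' h1 h2; case/orP : h1 => h1; lra.
  by apply: H2 => //; clear -x0 t0 p1' p2' h1 h2; case/orP : h1 => h1; case/orP : h2 => h2; lra.
have r1 : C1 * `|x - p.1| <= e / 2.
  rewrite ler_pdivlMr ?ltr_wpDl// in q1; apply: le_trans q1.
  by rewrite mulrDr mulr1 mulrC lerDl.
have r2 : C2 * `|t - p.2| <= e / 2.
  rewrite ler_pdivlMr ?ltr_wpDl// in q2; apply: le_trans q2.
  by rewrite mulrDr mulr1 mulrC lerDl.
rewrite -[_ - _](subrKA (F n x p.2)); apply: le_trans (ler_normD _ _) _.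
have -> : e = e / 2 + e / 2 by lra.
by apply: lerD; [exact: le_trans b2 r2|exact: le_trans b1 r1].
Unshelve. all: by end_near. Qed.

Lemma heat_family_boundary : exists2 L : nat -> R -> R,
  forall n t, 0 < t -> F n x t @[x --> 0^'+] --> L n t &
  forall n t, 0 < t -> is_derive t 1 (L n) (L n.+2 t).
Proof.
have cv n t : 0 < t -> exists l, F n x t @[x --> 0^'+] --> (l : R).
  move=> t0; have [C C0 HC] := heat_family_bounded n.+1 t t0.
  apply: (@boundary_cvg R (F n ^~ t) (fun x => F n.+1 x t) 1 C) => // x /andP[x0 _].
    exact: (heat_dx HF).
  by apply: HC => //; rewrite lexx.
pose L n t := lim (F n x t @[x --> 0^'+]).
have cL n t : 0 < t -> F n x t @[x --> 0^'+] --> L n t.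
  by move=> t0; have [l hl] := cv n t t0; apply: (cvgP l hl).
exists L => // n t t0; have t2 : 0 < t / 2 by rewrite divr_gt0.
have [C C0 HC] := heat_family_bounded n.+4 (2 * t) t2.
have pos s : `|s - t| <= t / 2 -> 0 < s by rewrite ler_norml; lra.
apply: (@boundary_derive R (F n) (F n.+2) (F n.+4) (L n) t (L n.+2 t) (t / 2) C) => //.
- by move=> x s /andP[x0 _] /pos s0; exact: (heat_dt HF).
- by move=> x s /andP[x0 _] /pos s0; exact: (heat_dt HF).
- by move=> x s /andP[x0 _]; rewrite ler_norml => hs; apply: HC => //; lra.
- by move=> s /pos s0; exact: cL.
- exact: cL.
Qed.

Lemma heat_family_initial : exists2 L : nat -> R -> R,
  forall n x, 0 < x -> F n x t @[t --> 0^'+] --> L n x &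
  forall n x, 0 < x -> is_derive x 1 (L n) (L n.+1 x).
Proof.
have cv n x : 0 < x -> exists l, F n x t @[t --> 0^'+] --> (l : R).
  move=> x0; have [C C0 HC] := heat_initial HF n.+2 (x + 1) x0.
  apply: (@boundary_cvg R (F n x) (F n.+2 x) 1 C) => // t t01.
    by apply: (heat_dt HF) => //; lra.
  by apply: HC => //; lra.
pose L n x := lim (F n x t @[t --> 0^'+]).
have cL n x : 0 < x -> F n x t @[t --> 0^'+] --> L n x.
  by move=> x0; have [l hl] := cv n x x0; apply: (cvgP l hl).
exists L => // n x x0; have x2 : 0 < x / 2 by rewrite divr_gt0.
(* [2 * x + 1] bounds both the space variable, which stays below [3 * x / 2], and the time variable,
   at most 1, since [heat_initial] has a single upper bound. *)
have [C C0 HC] := heat_initial HF n.+2 (2 * x + 1) x2.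
have pos y : `|y - x| <= x / 2 -> 0 < y by rewrite ler_norml; lra.
(* The roles of space and time are exchanged: the variable that tends to 0 is now [t]. *)
apply: (@boundary_derive R (fun t y => F n y t) (fun t y => F n.+1 y t)
   (fun t y => F n.+2 y t) (L n) x (L n.+1 x) (x / 2) C) => //.
- by move=> t y /andP[t0 _] /pos y0; exact: (heat_dx HF).
- by move=> t y /andP[t0 _] /pos y0; exact: (heat_dx HF).
- by move=> t y t01; rewrite ler_norml => hy; apply: HC; lra.
- by move=> y /pos y0; exact: cL.
- exact: cL.
Qed.

End heat_family.

(** * The explicit solution is a heat family *)

Section half_line_solution.
Context {R : realType}.
Implicit Types (x y s t a b e r C : R).

(* Odd reflection of the initial datum plus the double layer potential of the
   boundary datum, differentiated [n] times in [x]. *)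
Definition heat_solution (h g : nat -> R -> R) n x t :=
  heat_conv (-1) n.+1 (h 0%N) x t - heat_conv 1 n.+1 (h 0%N) x t - 2 * duhamel n.+2 (g 0%N) x t.

Variables (h g : nat -> R -> R) (h0 g0 : nat -> R).
Hypotheses (hS : schwartz_jet h h0) (gS : smooth_jet g g0).

Lemma heat_solution_family : heat_family (heat_solution h g).
Proof.
have d0 := schwartz_jet_dominated0 0 hS.
split.
- move=> n x t x0 t0; have d1 := heat_conv_dx (-1) n.+1 x t0 d0.
  have d2 := heat_conv_dx 1 n.+1 x t0 d0; have d3 := duhamel_dx n.+1 0 t x0 gS.
  by rewrite /heat_solution; drve; rewrite mul0r add0r.
- move=> n x t x0 t0; have d1 := heat_conv_dt (-1) n.+1 x t0 d0.
  have d2 := heat_conv_dt 1 n.+1 x t0 d0; have d3 := duhamel_dt n.+1 0 x0 t0 gS.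
  by rewrite /heat_solution; drve; rewrite mul0r add0r.
- move=> n M a b a0; have dM := schwartz_jet_dominated M 0 hS.
  have [C1 C10 H1] := @heat_conv_bound_compact R (-1) n M (h 0%N) a b (normrN1 _) a0 d0 dM.
  have [C2 C20 H2] := @heat_conv_bound_compact R 1 n M (h 0%N) a b (normr1 _) a0 d0 dM.
  have [C3 C30 H3] := duhamel_bound_compact n M b a0 gS.
  exists (C1 + C2 + 2 * C3); first by rewrite !addr_ge0// mulr_ge0.
  move=> x t x0 tab; have xM : 0 <= x ^+ M by rewrite exprn_ge0// ltW.
  apply: (@le_trans _ _ (x ^+ M * (`|heat_conv (-1) n.+1 (h 0%N) x t| +
      `|heat_conv 1 n.+1 (h 0%N) x t| + 2 * `|duhamel n.+2 (g 0%N) x t|))).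
    rewrite ler_wpM2l//; apply: le_trans (ler_normB _ _) _; apply: lerD.
      exact: ler_normB.
    by rewrite normrM ger0_norm.
  have := H1 x t tab; have := H2 x t tab; have := H3 x t x0 tab.
  by rewrite (gtr0_norm x0) !mulrDr mulrCA; lra.
- move=> n a b a0.
  have [C1 C10 H1] := heat_conv_bound_small n.+1 b a0 hS.
  have [C2 C20 H2] := heat_conv_bound_reflected n b a0 d0.
  have [C3 C30 H3] := duhamel_bound_small n.+1 0 0 b a0 gS.
  exists (C1 + C2 + 2 * (C3 * `|b|)).
    by rewrite !addr_ge0// !mulr_ge0.
  move=> x t /andP[ax xb] tb.
  have h1 := H1 x t ax tb; have h2 := H2 x t ax tb.
  have h3 : `|duhamel n.+2 (g 0%N) x t| <= C3 * `|b|.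
    have := H3 x t ax tb; rewrite expr0 mul1r => /le_trans; apply.
    by rewrite ler_wpM2l//; have := ler_norm b; lra.
  apply: le_trans (ler_normB _ _) _; apply: lerD.
    by apply: le_trans (ler_normB _ _) _; exact: lerD.
  by rewrite normrM ger0_norm// ler_wpM2l.
Qed.

Lemma heat_solution_initial x : 0 < x ->
  heat_solution h g 0 x t @[t --> 0^'+] --> h 0%N x.
Proof.
move=> x0; have d0 := schwartz_jet_dominated0 0 hS.
rewrite -[X in _ --> X](_ : h 0%N x - 0 - 2 * 0 = _); last by ring.
apply: cvgB; last by apply: cvgMr; exact: duhamel_cvg_initial gS.
by apply: cvgB; [exact: heat_conv_cvg_initial hS|exact: heat_conv_reflected_cvg_initial].
Qed.

Lemma heat_solution_boundary t : 0 < t ->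
  heat_solution h g 0 x t @[x --> 0^'+] --> g 0%N t.
Proof.
move=> t0; have d0 := schwartz_jet_dominated0 0 hS.
rewrite -[X in _ --> X](_ : heat_conv (-1) 1 (h 0%N) 0 t - heat_conv 1 1 (h 0%N) 0 t
   - 2 * (- 2^-1 * g 0%N t) = _); last by rewrite heat_conv_boundary_eq; lra.
apply: cvgB; last by apply: cvgMr; exact: duhamel_cvg_boundary gS.
by apply: cvgB; exact: heat_conv_cvg_boundary.
Qed.

End half_line_solution.

(** * Complex-valued functions *)

Section complex_components.
Context {R : realType}.
Local Notation C := (Rcomplex R).
Local Notation Re := complex.Re.
Local Notation Im := complex.Im.
Implicit Types (z w : C) (x t : R).

Lemma complex_eqP z w : Re z = Re w -> Im z = Im w -> z = w.
Proof. by case: z w => [a b] [c d] /= -> ->. Qed.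

Lemma ReM z w : Re (z * w) = Re z * Re w - Im z * Im w.
Proof. by case: z w => [a b] [c d]. Qed.

Lemma ImM z w : Im (z * w) = Re z * Im w + Im z * Re w.
Proof. by case: z w => [a b] [c d]. Qed.

Lemma ReB z w : Re (z - w) = Re z - Re w. Proof. by case: z w => [a b] [c d]. Qed.
Lemma ImB z w : Im (z - w) = Im z - Im w. Proof. by case: z w => [a b] [c d]. Qed.
Lemma ReZ (k : R) z : Re (k *: z) = k * Re z. Proof. by case: z. Qed.
Lemma ImZ (k : R) z : Im (k *: z) = k * Im z. Proof. by case: z. Qed.
Lemma ReN z : Re (- z) = - Re z. Proof. by case: z. Qed.
Lemma ImN z : Im (- z) = - Im z. Proof. by case: z. Qed.

Lemma normCE z : `|z| = Num.sqrt (Re z ^+ 2 + Im z ^+ 2).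
Proof. by case: z. Qed.

Lemma norm_Re_le z : `|Re z| <= `|z|.
Proof. by rewrite normCE -sqrtr_sqr ler_wsqrtr// lerDl sqr_ge0. Qed.

Lemma norm_Im_le z : `|Im z| <= `|z|.
Proof. by rewrite normCE -sqrtr_sqr ler_wsqrtr// lerDr sqr_ge0. Qed.

Lemma norm_le_ReIm z : `|z| <= `|Re z| + `|Im z|.
Proof.
rewrite normCE -[leRHS]ger0_norm ?addr_ge0// -sqrtr_sqr ler_wsqrtr//.
rewrite -(real_normK (num_real (Re z))) -(real_normK (num_real (Im z))).
have := normr_ge0 (Re z); have := normr_ge0 (Im z).
by move: `|Re z| `|Im z| => a b a0 b0; nra.
Qed.

Lemma cvg_complex T (F : set_system T) {FF : Filter F} (f : T -> C) z :
  Re (f s) @[s --> F] --> Re z -> Im (f s) @[s --> F] --> Im z ->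
  f s @[s --> F] --> z.
Proof.
move=> /cvgrPdist_le h1 /cvgrPdist_le h2; apply/cvgrPdist_le => e e0.
have e2 : 0 < e / 2 by rewrite divr_gt0.
near=> s; apply: le_trans (norm_le_ReIm _) _; rewrite ReB ImB.
have -> : e = e / 2 + e / 2 by lra.
by apply: lerD; near: s; [exact: h1|exact: h2].
Unshelve. all: by end_near. Qed.

Lemma cvg_Re T (F : set_system T) {FF : Filter F} (f : T -> C) z :
  f s @[s --> F] --> z -> Re (f s) @[s --> F] --> Re z.
Proof.
move=> /cvgrPdist_le h; apply/cvgrPdist_le => e /h; apply: filterS => s.
by apply: le_trans; rewrite -ReB norm_Re_le.
Qed.

Lemma cvg_Im T (F : set_system T) {FF : Filter F} (f : T -> C) z :
  f s @[s --> F] --> z -> Im (f s) @[s --> F] --> Im z.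
Proof.
move=> /cvgrPdist_le h; apply/cvgrPdist_le => e /h; apply: filterS => s.
by apply: le_trans; rewrite -ImB norm_Im_le.
Qed.

Lemma is_derive_complex (f : R -> C) x (d : C) :
  is_derive x 1 (fun y => Re (f y)) (Re d) ->
  is_derive x 1 (fun y => Im (f y)) (Im d) -> is_derive x 1 f d.
Proof.
move=> [d1 e1] [d2 e2].
have cv : h^-1 *: (f (h *: (1 : R) + x) - f x) @[h --> 0^'] --> d.
  apply: cvg_complex.
    under eq_fun do rewrite ReZ ReB.
    by move: d1 => /cvg_ex [l hl]; rewrite -e1 /derive; have /cvg_lim -> := hl.
  under eq_fun do rewrite ImZ ImB.
  by move: d2 => /cvg_ex [l hl]; rewrite -e2 /derive; have /cvg_lim -> := hl.
apply: DeriveDef; first by apply/cvg_ex; exists d.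
by rewrite /derive; apply/cvg_lim.
Qed.

Lemma derivable_Re_Im (f : R -> C) x : derivable f x 1 ->
  is_derive x 1 (fun y => Re (f y)) (Re (derive1 f x)) /\
  is_derive x 1 (fun y => Im (f y)) (Im (derive1 f x)).
Proof.
move=> df; have cv : h^-1 *: (f (h *: (1 : R) + x) - f x) @[h --> 0^'] --> derive1 f x.
  by rewrite derive1E; exact: df.
have c1 := cvg_Re cv; have c2 := cvg_Im cv.
have E1 : (fun h : R => Re (h^-1 *: (f (h *: 1 + x) - f x))) =
  (fun h : R => h^-1 *: (Re (f (h *: 1 + x)) - Re (f x))).
  by apply/funext => h; rewrite ReZ ReB.
have E2 : (fun h : R => Im (h^-1 *: (f (h *: 1 + x) - f x))) =
  (fun h : R => h^-1 *: (Im (f (h *: 1 + x)) - Im (f x))).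
  by apply/funext => h; rewrite ImZ ImB.
rewrite E1 in c1; rewrite E2 in c2.
split; apply: DeriveDef.
- by apply/cvg_ex; exists (Re (derive1 f x)); exact: c1.
- by rewrite /derive; apply/cvg_lim => //; exact: c1.
- by apply/cvg_ex; exists (Im (derive1 f x)); exact: c2.
- by rewrite /derive; apply/cvg_lim => //; exact: c2.
Qed.

Lemma Cinfty_halfline_jets (f : R -> C) : Cinfty_halfline f ->
  smooth_jet (fun n x => Re (derive1n n f x)) (fun n => Re (deriv_at0 n f)) /\
  smooth_jet (fun n x => Im (derive1n n f x)) (fun n => Im (deriv_at0 n f)).
Proof.
move=> [df cf]; split; split.
- by move=> n x x0; have [] := derivable_Re_Im (df n x x0).
- by move=> n; apply: cvg_Re; exact: cf.
- by move=> n x x0; have [] := derivable_Re_Im (df n x x0).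
- by move=> n; apply: cvg_Im; exact: cf.
Qed.

Lemma Schwartz_halfline_jets (f : R -> C) : Schwartz_halfline f ->
  schwartz_jet (fun n x => Re (derive1n n f x)) (fun n => Re (deriv_at0 n f)) /\
  schwartz_jet (fun n x => Im (derive1n n f x)) (fun n => Im (deriv_at0 n f)).
Proof.
move=> [cf bf]; have [[r1 r2] [i1 i2]] := Cinfty_halfline_jets cf.
have B M n : exists D, forall x, 0 < x -> `|x ^+ M *: derive1n n f x| <= D.
  have [D HD] := bf M n; exists D => x x0; apply: HD; exists x => /=.
    by rewrite in_itv/= andbT ltW.
  by rewrite /deriv_halfline x0.
split; split=> //.
- move=> M n; have [D HD] := B M n; exists D => x x0.
  by apply: le_trans (HD x x0); rewrite -ReZ norm_Re_le.
- move=> M n; have [D HD] := B M n; exists D => x x0.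
  by apply: le_trans (HD x x0); rewrite -ImZ norm_Im_le.
Qed.

End complex_components.

(** * From real heat families to the complex solution *)

Section complex_heat_family.
Context {R : realType}.
Local Notation C := (Rcomplex R).
Local Notation Re := complex.Re.
Local Notation Im := complex.Im.
Implicit Types (x t : R).

Variables (A B : nat -> R -> R -> R) (u : R -> R -> C).
Hypotheses (HA : heat_family A) (HB : heat_family B).
Hypothesis hu : forall x t, 0 < x -> 0 < t -> u x t = Complex (A 0%N x t) (B 0%N x t).

Let G n x t : C := Complex (A n x t) (B n x t).

Let G_dx n x t : 0 < x -> 0 < t -> is_derive x 1 (G n ^~ t) (G n.+1 x t).
Proof.
by move=> x0 t0; apply: is_derive_complex; [exact: (heat_dx HA)|exact: (heat_dx HB)].
Qed.

Let G_dt n x t : 0 < x -> 0 < t -> is_derive t 1 (G n x) (G n.+2 x t).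
Proof.
by move=> x0 t0; apply: is_derive_complex; [exact: (heat_dt HA)|exact: (heat_dt HB)].
Qed.

Lemma is_derive1E (f : R -> C) x (d : C) : is_derive x 1 f d -> derive1 f x = d.
Proof. by move=> [_ <-]; rewrite derive1E. Qed.

(** [u] is known only on the open quadrant; derivatives being local, this is enough to identify
    them. *)
Lemma positive_eq_is_derive (f g : R -> C) x (d : C) : 0 < x ->
  (forall y, 0 < y -> f y = g y) -> is_derive x 1 g d -> is_derive x 1 f d.
Proof.
move=> x0 fg hg; apply: near_eq_is_derive hg; near=> y; rewrite fg//.
by near: y; exact: lt_nbhsr.
Unshelve. all: by end_near. Qed.

Let derive1n_x n x t : 0 < x -> 0 < t -> derive1n n (u ^~ t) x = G n x t.
Proof.
elim: n x => [|n IH] x x0 t0; first by rewrite derive1n0 hu.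
rewrite derive1nS; apply: is_derive1E.
by apply: (positive_eq_is_derive x0 _ (G_dx n x0 t0)) => y y0; exact: IH.
Qed.

Let derive1n_t n x t : 0 < x -> 0 < t -> derive1n n (u x) t = G n.*2 x t.
Proof.
elim: n t => [|n IH] t x0 t0; first by rewrite derive1n0 hu.
rewrite derive1nS; apply: is_derive1E.
by apply: (positive_eq_is_derive t0 _ (G_dt n.*2 x0 t0)) => y y0; exact: IH.
Qed.

(** A [t]-derivative counts as two [x]-derivatives, so every mixed partial derivative, in any order,
    is some [G n]. *)
Let order (s : seq bool) := sumn [seq (if b then 1 else 2)%N | b <- s].

Let iter_partialE s x t : 0 < x -> 0 < t -> iter_partial s u x t = G (order s) x t.
Proof.
elim: s x t => [|b s IH] x t x0 t0; first by rewrite /= hu.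
rewrite /order /= -/(order s); case: b; apply: is_derive1E.
  by apply: (positive_eq_is_derive x0 _ (G_dx _ x0 t0)) => y y0; exact: IH.
by apply: (positive_eq_is_derive t0 _ (G_dt _ x0 t0)) => y y0; exact: IH.
Qed.

Let G_continuous n x t : 0 < x -> 0 < t ->
  {for (x, t), continuous (fun p : R * R => G n p.1 p.2)}.
Proof.
by move=> x0 t0; apply: cvg_complex; exact: heat_family_continuous.
Qed.

Lemma complex_heat_Cinfty : Cinfty_on quadrant u.
Proof.
move=> s x t; rewrite /quadrant/= => -[x0 t0]; set Gs := iter_partial s u; split.
- have h : is_derive x 1 (Gs ^~ t) (G (order s).+1 x t).
    by apply: (positive_eq_is_derive x0 _ (G_dx _ x0 t0)) => y y0; exact: iter_partialE.
  by [].
- have h : is_derive t 1 (Gs x) (G (order s).+2 x t).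
    by apply: (positive_eq_is_derive t0 _ (G_dt _ x0 t0)) => y y0; exact: iter_partialE.
  by [].
- rewrite /prop_for /continuous_at /= /Gs iter_partialE//.
  apply: cvg_trans (G_continuous (n := order s) x0 t0).
  apply: near_eq_cvg; near=> p; rewrite iter_partialE//.
    near: p; have c1 : p.1 @[p --> (x, t)] --> x by exact: cvg_fst.
    exact: (cvgr_gt x c1).
  near: p; have c2 : p.2 @[p --> (x, t)] --> t by exact: cvg_snd.
  exact: (cvgr_gt t c2).
Unshelve. all: by end_near. Qed.

Lemma complex_heat_equation x t : 0 < x -> 0 < t ->
  derive1 (u x) t = derive1n 2 (u ^~ t) x.
Proof. by move=> x0 t0; rewrite derive1n_x// -[LHS]/(derive1n 1 (u x) t) derive1n_t. Qed.

(** [k] is the effect of one derivative on the index: a shift by 1 along [x], by 2 along [t]. *)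
Lemma Cinfty_pos_jet (L : nat -> R -> C) (k : nat -> nat) n (f : R -> C) :
  (forall n x, 0 < x -> is_derive x 1 (L n) (L (k n) x)) ->
  (forall x, 0 < x -> f x = L n x) -> Cinfty_pos f.
Proof.
move=> dL fL m.
have E x : 0 < x -> derive1n m f x = L (iter m k n) x.
  elim: m x => [|m IH] x x0; first by rewrite derive1n0 fL.
  rewrite derive1nS; apply: is_derive1E.
  by apply: (positive_eq_is_derive x0 _ (dL _ x x0)) => y y0; exact: IH.
move=> x x0; have h : is_derive x 1 (derive1n m f) (L (k (iter m k n)) x).
  by apply: (positive_eq_is_derive x0 _ (dL _ x x0)) => y y0; exact: E.
by [].
Qed.

Lemma complex_heat_boundary :
  (forall t, 0 < t -> Cinfty_halfline (u ^~ t)) /\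
  (forall n, Cinfty_pos (fun t => deriv_at0 n (u ^~ t))).
Proof.
have [LA cA dA] := heat_family_boundary HA.
have [LB cB dB] := heat_family_boundary HB.
pose L n t : C := Complex (LA n t) (LB n t).
have cL n t : 0 < t -> derive1n n (u ^~ t) x @[x --> 0^'+] --> L n t.
  move=> t0; apply: (@cvg_trans _ (G n x t @[x --> 0^'+])).
    apply: near_eq_cvg; near=> x; rewrite derive1n_x//.
  by apply: cvg_complex; [exact: cA|exact: cB].
split.
  move=> t t0; split.
    apply: (@Cinfty_pos_jet (fun n x => G n x t) S 0) => //.
      by move=> n x x0; exact: G_dx.
    by move=> x x0; rewrite hu.
  by move=> n; apply/cvg_ex; exists (L n t); exact: cL.
move=> n; apply: (@Cinfty_pos_jet L (fun n => n.+2) n).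
  by move=> m t t0; apply: is_derive_complex; [exact: dA|exact: dB].
by move=> t t0; apply: cvg_lim => //; exact: cL.
Unshelve. all: by end_near. Qed.

Lemma complex_heat_initial :
  (forall x, 0 < x -> Cinfty_halfline (u x)) /\
  (forall n, Cinfty_pos (fun x => deriv_at0 n (u x))).
Proof.
have [LA cA dA] := heat_family_initial HA.
have [LB cB dB] := heat_family_initial HB.
pose L n x : C := Complex (LA n x) (LB n x).
have cL n x : 0 < x -> derive1n n (u x) t @[t --> 0^'+] --> L n.*2 x.
  move=> x0; apply: (@cvg_trans _ (G n.*2 x t @[t --> 0^'+])).
    apply: near_eq_cvg; near=> t; rewrite derive1n_t//.
  by apply: cvg_complex; [exact: cA|exact: cB].
split.
  move=> x x0; split.
    apply: (@Cinfty_pos_jet (fun n t => G n x t) (fun n => n.+2) 0) => //.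
      by move=> n t t0; exact: G_dt.
    by move=> t t0; rewrite hu.
  by move=> n; apply/cvg_ex; exists (L n.*2 x); exact: cL.
move=> n; apply: (@Cinfty_pos_jet L S n.*2).
  by move=> m x x0; apply: is_derive_complex; [exact: dA|exact: dB].
by move=> x x0; apply: cvg_lim => //; exact: cL.
Unshelve. all: by end_near. Qed.

Lemma compact_pos_bounded (K : set R) : compact K -> K `<=` `]0, +oo[ ->
  exists a b, 0 < a /\ forall t, K t -> a <= t <= b.
Proof.
move=> cK Kpos; have [->|/set0P K0] := eqVneq K set0.
  by exists 1, 1; split.
have cid : {within K, continuous (@id R)} by apply: continuous_subspaceT => ?; exact: cvg_id.
have [a Ka Ha] := compact_EVT_min K0 cK cid.
have [b Kb Hb] := compact_EVT_max K0 cK cid.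
exists a, b; split; first by have := Kpos _ (set_mem Ka); rewrite /= in_itv/= andbT.
by move=> t Kt; rewrite Ha ?Hb// inE.
Qed.

Lemma complex_heat_decay : rapidly_decreasing u.
Proof.
move=> M N K cK Kpos e e0.
have [a [b [a0 Kab]]] := compact_pos_bounded cK Kpos.
(* One power of [x] more than required turns a bound into convergence to 0. *)
have [C1 C10 H1] := heat_decay HA N M.+1 b a0.
have [C2 C20 H2] := heat_decay HB N M.+1 b a0.
near=> x => t Kt.
have x0 : 0 < x by near: x; exact: nbhs_pinfty_gt.
have xC : (C1 + C2) / e < x by near: x; apply: nbhs_pinfty_gt; exact: num_real.
have tab := Kab t Kt; have t0 : 0 < t by lra.
rewrite derive1n_x//; apply: le_lt_trans (norm_le_ReIm _) _.
rewrite ReZ ImZ /= !normrM [`|x ^+ M|]ger0_norm ?exprn_ge0 ?(ltW x0)//.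
rewrite -(ltr_pM2l x0) mulrDr !mulrA -exprS.
apply: (@le_lt_trans _ _ (C1 + C2)).
  by apply: lerD; [exact: H1|exact: H2].
by rewrite ltr_pdivrMr// mulrC in xC; rewrite mulrC.
Unshelve. all: by end_near. Qed.

End complex_heat_family.

(** * Complex integrals *)

Section complex_integral.
Context {R : realType}.
Local Notation C := (Rcomplex R).
Local Notation Re := complex.Re.
Local Notation Im := complex.Im.
Local Notation mu := (@lebesgue_measure R).
Local Notation integ A f := (mu.-integrable A (EFin \o f)).
Implicit Types (z w : C) (x y s t : R) (A B : set R) (f g : R -> C).

Definition Cinteg A f :=
  integ A (fun y => Re (f y)) /\ integ A (fun y => Im (f y)).

Lemma eq_Cintegral A f g : (forall y, A y -> f y = g y) -> Cintegral A f = Cintegral A g.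
Proof.
by move=> fg; apply: complex_eqP; apply: eq_Rintegral => y /set_mem Ay; rewrite fg.
Qed.

Lemma CintegralMl A z f : measurable A -> Cinteg A f ->
  Cintegral A (fun y => z * f y) = z * Cintegral A f.
Proof.
move=> mA [fr fi].
have Z (k : R) (h : R -> R) : integ A h ->
    \int[mu]_(y in A) (k * h y) = k * \int[mu]_(y in A) h y.
  by move=> hi; apply: RintegralZl.
apply: complex_eqP; rewrite ?ReM ?ImM /=.
  under eq_Rintegral do rewrite ReM.
  transitivity (\int[mu]_(y in A) (Re z * Re (f y)) - \int[mu]_(y in A) (Im z * Im (f y))).
    by apply: RintegralB => //; exact: integrable_scale.
  by rewrite !Z.
under eq_Rintegral do rewrite ImM.
transitivity (\int[mu]_(y in A) (Re z * Im (f y)) + \int[mu]_(y in A) (Im z * Re (f y))).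
  by apply: RintegralD => //; exact: integrable_scale.
by rewrite !Z.
Qed.

Lemma CintegralB A f g : measurable A -> Cinteg A f -> Cinteg A g ->
  Cintegral A (fun y => f y - g y) = Cintegral A f - Cintegral A g.
Proof.
move=> mA [fr fi] [gr gi]; apply: complex_eqP; rewrite ?ReB ?ImB /=.
  by under eq_Rintegral do rewrite ReB; apply: RintegralB.
by under eq_Rintegral do rewrite ImB; apply: RintegralB.
Qed.

Lemma CintegralN_conj A f g : (forall y, A y -> Re (g y) = - Re (f y)) ->
  (forall y, A y -> Im (g y) = Im (f y)) -> measurable A -> Cinteg A f ->
  Re (Cintegral A g) = - Re (Cintegral A f) /\ Im (Cintegral A g) = Im (Cintegral A f).
Proof.
move=> h1 h2 mA [fr fi]; split => /=.
  rewrite -mulN1r.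
  transitivity (\int[mu]_(y in A) (- 1 * Re (f y))); last by apply: RintegralZl.
  by apply: eq_Rintegral => y /set_mem Ay; rewrite h1// mulN1r.
by apply: eq_Rintegral => y /set_mem Ay; rewrite h2.
Qed.

Lemma Cintegral_conj A f g : (forall y, A y -> Re (g y) = Re (f y)) ->
  (forall y, A y -> Im (g y) = - Im (f y)) -> measurable A -> Cinteg A f ->
  Re (Cintegral A g) = Re (Cintegral A f) /\ Im (Cintegral A g) = - Im (Cintegral A f).
Proof.
move=> h1 h2 mA [fr fi]; split => /=.
  by apply: eq_Rintegral => y /set_mem Ay; rewrite h1.
rewrite -mulN1r.
transitivity (\int[mu]_(y in A) (- 1 * Im (f y))); last by apply: RintegralZl.
by apply: eq_Rintegral => y /set_mem Ay; rewrite h2// mulN1r.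
Qed.

Lemma norm_ReM_le z w (a b : R) : `|Re z| <= a -> `|Im z| <= a ->
  `|Re w| <= b -> `|Im w| <= b ->
  `|Re (z * w)| <= 2 * a * b /\ `|Im (z * w)| <= 2 * a * b.
Proof.
move=> h1 h2 h3 h4; rewrite ReM ImM.
have P (p q p' q' : R) : `|p| <= a -> `|q| <= b -> `|p'| <= a -> `|q'| <= b ->
    `|p| * `|q| + `|p'| * `|q'| <= 2 * a * b.
  move=> ? ? ? ?; have -> : 2 * a * b = a * b + a * b by ring.
  by apply: lerD; apply: ler_pM.
split; [apply: le_trans (ler_normB _ _) _|apply: le_trans (ler_normD _ _) _];
  by rewrite !normrM; exact: P.
Qed.

Lemma measurable_ReM D (T : measurableType D) (A' : set T) (f g : T -> C) :
  measurable_fun A' (fun p => Re (f p)) -> measurable_fun A' (fun p => Im (f p)) ->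
  measurable_fun A' (fun p => Re (g p)) -> measurable_fun A' (fun p => Im (g p)) ->
  measurable_fun A' (fun p => Re (f p * g p)) /\ measurable_fun A' (fun p => Im (f p * g p)).
Proof.
move=> h1 h2 h3 h4; split.
  rewrite (_ : (fun p => _) = fun p => Re (f p) * Re (g p) - Im (f p) * Im (g p)); last first.
    by apply/funext => p; rewrite ReM.
  by apply: measurable_funB; apply: measurable_funM.
rewrite (_ : (fun p => _) = fun p => Re (f p) * Im (g p) + Im (f p) * Re (g p)); last first.
  by apply/funext => p; rewrite ImM.
by apply: measurable_funD; apply: measurable_funM.
Qed.

(** * Exchange of a contour integral with a transform *)

Section exchange.
Variables (A B : set R) (P v : R -> C) (e : R -> R -> C) (a b : R -> R).
Hypotheses (mA : measurable A) (mB : measurable B).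
Hypotheses (mPr : measurable_fun A (fun s => Re (P s)))
  (mPi : measurable_fun A (fun s => Im (P s))).
Hypotheses (mvr : measurable_fun B (fun s => Re (v s)))
  (mvi : measurable_fun B (fun s => Im (v s))).
Hypotheses (mer : measurable_fun setT (fun p : R * R => Re (e p.1 p.2)))
  (mei : measurable_fun setT (fun p : R * R => Im (e p.1 p.2))).
Hypotheses (Pa : forall s, A s -> `|Re (P s)| <= a s /\ `|Im (P s)| <= a s)
  (vb : forall y, B y -> `|Re (v y)| <= b y /\ `|Im (v y)| <= b y)
  (e1 : forall s y, A s -> B y -> `|Re (e s y)| <= 1 /\ `|Im (e s y)| <= 1).
Hypotheses (ia : integ A a) (ib : integ B b).

Let k s y := P s * e s y.
Let f s y := k s y * v y.

Let me1 y : measurable_fun setT (fun s => Re (e s y)) /\ measurable_fun setT (fun s => Im (e s y)).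
Proof.
split.
  exact: (measurable_fun_pair1 y mer).
exact: (measurable_fun_pair1 y mei).
Qed.

Let me2 s : measurable_fun setT (fun y => Re (e s y)) /\ measurable_fun setT (fun y => Im (e s y)).
Proof.
split.
  exact: (measurable_fun_pair2 s mer).
exact: (measurable_fun_pair2 s mei).
Qed.

Let mAB : measurable (A `*` B). Proof. exact: measurableX. Qed.

Let mf : measurable_fun (A `*` B) (fun p : R * R => Re (f p.1 p.2)) /\
  measurable_fun (A `*` B) (fun p : R * R => Im (f p.1 p.2)).
Proof.
have fst_m (h : R -> R) : measurable_fun A h ->
    measurable_fun (A `*` B) (fun p : R * R => h p.1).
  move=> mh; apply: (measurable_comp mA _ mh); last exact: measurable_funTS measurable_fst.
  by move=> _ [[p q] [/= Ap _] <-].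
have snd_m (h : R -> R) : measurable_fun B h ->
    measurable_fun (A `*` B) (fun p : R * R => h p.2).
  move=> mh; apply: (measurable_comp mB _ mh); last exact: measurable_funTS measurable_snd.
  by move=> _ [[p q] [/= _ Bq] <-].
have [h1 h2] := measurable_ReM (f := fun p : R * R => P p.1) (g := fun p : R * R => e p.1 p.2)
  (fst_m _ mPr) (fst_m _ mPi) (measurable_funTS mer) (measurable_funTS mei).
exact: (measurable_ReM h1 h2 (snd_m _ mvr) (snd_m _ mvi)).
Qed.

Let k_bound s y : A s -> B y -> `|Re (k s y)| <= 2 * a s /\ `|Im (k s y)| <= 2 * a s.
Proof.
move=> As By; have [p1 p2] := Pa As; have [q1 q2] := e1 As By.
by have := norm_ReM_le p1 p2 q1 q2; rewrite mulr1.
Qed.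

Let f_bound s y : A s -> B y ->
  `|Re (f s y)| <= (4 * a s) * b y /\ `|Im (f s y)| <= (4 * a s) * b y.
Proof.
move=> As By; have [p1 p2] := k_bound As By; have [q1 q2] := vb By.
by have := norm_ReM_le p1 p2 q1 q2; rewrite mulrA -natrM.
Qed.

Let ia4 : integ A (fun s => 4 * a s). Proof. exact: integrable_scale. Qed.

Let swap_m : measurable_fun (B `*` A) (fun p : R * R => (p.2, p.1)).
Proof.
by apply: measurable_funTS; apply: measurable_fun_pair; [exact: measurable_snd|exact: measurable_fst].
Qed.

Let mf_swap : measurable_fun (B `*` A) (fun p : R * R => Re (f p.2 p.1)) /\
  measurable_fun (B `*` A) (fun p : R * R => Im (f p.2 p.1)).
Proof.
have sub : (fun p : R * R => (p.2, p.1)) @` (B `*` A) `<=` A `*` B.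
  by move=> _ [[p q] [/= Bp Aq] <-].
by split; [exact: (measurable_comp mAB sub mf.1 swap_m)|exact: (measurable_comp mAB sub mf.2 swap_m)].
Qed.

Let swap_bound y s : B y -> A s ->
  `|Re (f s y)| <= b y * (4 * a s) /\ `|Im (f s y)| <= b y * (4 * a s).
Proof. by move=> By As; have := f_bound As By; rewrite [b y * _]mulrC. Qed.

(** The swapped order of integration supplies the integrability over [B] of the inner integral over
    [A]. *)
Let integ_re := (Fubini_set (f := fun y s => Re (f s y)) mB mA mf_swap.1
  (fun y s By As => (swap_bound By As).1) ib ia4).1.
Let integ_im := (Fubini_set (f := fun y s => Im (f s y)) mB mA mf_swap.2
  (fun y s By As => (swap_bound By As).2) ib ia4).1.

Let fubini_re := Fubini_set mA mB mf.1 (fun s y As By => (f_bound As By).1) ia4 ib.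
Let fubini_im := Fubini_set mA mB mf.2 (fun s y As By => (f_bound As By).2) ia4 ib.

Lemma Cinteg_column y : B y -> Cinteg A (fun s => P s * e s y).
Proof.
move=> By; have [n1 n2] := me1 y.
have [h1 h2] := measurable_ReM mPr mPi (measurable_funTS n1) (measurable_funTS n2).
have i2 : integ A (fun s => 2 * a s) by exact: integrable_scale.
split; apply: (integrable_dominated mA _ _ i2) => // s As.
  exact: (k_bound As By).1.
exact: (k_bound As By).2.
Qed.

Let Cinteg_row s : A s -> Cinteg B (fun y => e s y * v y).
Proof.
move=> As; have [n1 n2] := me2 s.
have [h1 h2] := measurable_ReM (measurable_funTS n1) (measurable_funTS n2) mvr mvi.
have i2 : integ B (fun y => 2 * b y) by exact: integrable_scale.
have H y : B y -> `|Re (e s y * v y)| <= 2 * b y /\ `|Im (e s y * v y)| <= 2 * b y.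
  move=> By; have [p1 p2] := e1 As By; have [q1 q2] := vb By.
  by have := norm_ReM_le p1 p2 q1 q2; rewrite mulr1.
by split; apply: (integrable_dominated mB _ _ i2) => // y By; [exact: (H y By).1|exact: (H y By).2].
Qed.

(** The shape common to the three terms of the formula: [P] carries the decay along the contour, [v]
    is the datum, and [e] is an exponential factor with components at most 1. *)
Lemma Cintegral_exchange :
  Cinteg B (fun y => Cintegral A (fun s => P s * e s y) * v y) /\
  Cintegral A (fun s => P s * Cintegral B (fun y => e s y * v y)) =
  Cintegral B (fun y => Cintegral A (fun s => P s * e s y) * v y).
Proof.
have E1 s : A s -> P s * Cintegral B (fun y => e s y * v y) = Cintegral B (f s).
  move=> As; rewrite -CintegralMl//; last exact: Cinteg_row.
  by apply: eq_Cintegral => y _; rewrite /f /k mulrA.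
have E2 y : B y -> Cintegral A (fun s => P s * e s y) * v y = Cintegral A (f ^~ y).
  move=> By; rewrite mulrC -CintegralMl//; last exact: Cinteg_column.
  by apply: eq_Cintegral => s _; rewrite /f /k mulrC.
have [_ r3] := fubini_re; have [_ i3] := fubini_im.
have I (h1 h2 : R -> R) : (forall y, B y -> h1 y = h2 y) -> integ B h1 -> integ B h2.
  by move=> hh; apply: eq_integrable => // y /set_mem By /=; rewrite hh.
split.
  split.
    by apply: (I _ _ _ integ_re) => y By; rewrite E2.
  by apply: (I _ _ _ integ_im) => y By; rewrite E2.
rewrite (eq_Cintegral E1) (eq_Cintegral E2).
by apply: complex_eqP; [exact: r3|exact: i3].
Qed.

End exchange.

End complex_integral.

(** * Evaluation of the transforms *)

Section rays.
Context {R : realType}.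
Local Notation C := (Rcomplex R).
Local Notation Re := complex.Re.
Local Notation Im := complex.Im.
Local Notation mu := (@lebesgue_measure R).
Local Notation integ A f := (mu.-integrable A (EFin \o f)).
Implicit Types (z w : C) (x y s t : R).

Definition rt2V : R := (Num.sqrt 2)^-1.

Local Notation c := rt2V.

Lemma rt2V_gt0 : 0 < c. Proof. by rewrite invr_gt0 sqrtr_gt0. Qed.

Lemma rt2V_sqr : c ^+ 2 = 2^-1. Proof. by rewrite exprVn sqr_sqrtr. Qed.

Lemma rt2V_le1 : c <= 1.
Proof.
rewrite leNgt; apply/negP => h; have := rt2V_sqr.
have : 1 < c ^+ 2 by rewrite expr2; have := rt2V_gt0; nra.
lra.
Qed.

Lemma pos_sqr_half (r : R) : 0 < r -> r ^+ 2 = 2^-1 -> r = c.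
Proof.
move=> r0 r2; apply/eqP; rewrite -(eqrXn2 (n := 2))// ?(ltW r0) ?(ltW rt2V_gt0)//.
by rewrite r2 rt2V_sqr.
Qed.

Lemma pi4_range : 0 < (pi / 4 : R) < pi / 2.
Proof. by have := pi_gt0 R; lra. Qed.

Lemma cos_pi4 : cos (pi / 4) = c :> R.
Proof.
apply: pos_sqr_half; first by apply: cos_gt0_pihalf; have := pi4_range; lra.
have := cos_mulr2n (pi / 4 : R); rewrite (_ : pi / 4 *+ 2 = pi / 2); last by lra.
by rewrite cos_pihalf => /esym; rewrite mulr2n; lra.
Qed.

Lemma sin_pi4 : sin (pi / 4) = c :> R.
Proof.
apply: pos_sqr_half; first by apply: sin_gt0_pihalf; exact: pi4_range.
by have := cos2Dsin2 (pi / 4 : R); rewrite cos_pi4 rt2V_sqr; lra.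
Qed.

Lemma direction_pi4 : expC ((pi / 4) *: Ci) = Complex c c :> C.
Proof.
by rewrite /expC /= mulr0 mulr1 expR0 !mul1r cos_pi4 sin_pi4.
Qed.

Lemma direction_3pi4 : expC ((3 * pi / 4) *: Ci) = Complex (- c) c :> C.
Proof.
rewrite /expC /= mulr0 mulr1 expR0 !mul1r.
rewrite (_ : 3 * pi / 4 = pi / 4 + pi / 2); last by lra.
by rewrite cosDpihalf sinDpihalf cos_pi4 sin_pi4.
Qed.

Lemma expCD z w : expC (z + w) = expC z * expC w.
Proof.
apply: complex_eqP; rewrite ?ReM ?ImM /expC.
  by case: z w => [p q] [p' q'] /=; rewrite expRD cosD; ring.
by case: z w => [p q] [p' q'] /=; rewrite expRD sinD; ring.
Qed.

Lemma kernel_expE x t z : kernel_exp x t z =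
  expC (Complex (- (Im z * x) - (Re z ^+ 2 - Im z ^+ 2) * t) (Re z * x - 2 * Re z * Im z * t)).
Proof.
congr expC; apply: complex_eqP; rewrite ?ReB ?ImB expr2 !(ReM, ImM) /=; ring.
Qed.

(** Parabolic scaling. It reconciles [ray_integral], which runs along the unit vector c (1 + i),
    with the rotated ray, which is parametrized along 1 + i. *)
Lemma Hk1_scale y t : 0 < t -> c * Hk 1 (c * y) (t / 2) = Hk 1 y t.
Proof.
move=> t0; rewrite /Hk sqrtrM ?(ltW t0)// sqrtrV//.
rewrite -/rt2V exprMn rt2V_sqr.
rewrite (_ : 2^-1 * y ^+ 2 / (4 * (t / 2)) = y ^+ 2 / (4 * t)); last first.
  by field; rewrite gt_eqF.
have c0 : c != 0 by rewrite gt_eqF// rt2V_gt0.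
have q0 : Num.sqrt t != 0 by rewrite gt_eqF// sqrtr_gt0.
have p0 : Num.sqrt pi != 0 :> R by rewrite gt_eqF// sqrt_pi_gt0.
by field; rewrite c0 q0 p0.
Qed.

(** Real part of exp(i l y - l^2 t) dl/ds on the ray at pi/4. *)
Definition ray1 y t s :=
  c * (expR (- (s * c * y)) * (cos (s * c * y - s ^+ 2 * t) - sin (s * c * y - s ^+ 2 * t))).

Lemma ray1E y t s : ray1 y t s = c * ray_re (c * y) (t / 2) 1 s.
Proof.
rewrite /ray1 /ray_re mul1r.
rewrite (_ : - (c * y * 1 * s) - t / 2 * (1 - 1 ^+ 2) * s ^+ 2 = - (s * c * y)); last first.
  by rewrite expr1n; ring.
rewrite (_ : c * y * s - 2 * 1 * (t / 2) * s ^+ 2 = s * c * y - s ^+ 2 * t) //.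
by field.
Qed.

Lemma ray1_continuous y t : continuous (ray1 y t).
Proof.
move=> s; have [d hd] : exists d, is_derive s 1 (ray1 y t) d.
  by eexists; rewrite /ray1; drv.
exact: is_derive_cont hd.
Qed.

Lemma exp_ray_dominated k y : 0 < y -> exists2 D, 0 <= D &
  forall y' s, y <= y' -> 0 <= s -> s ^+ k * expR (- (s * c * y')) <= D * (1 + s ^+ 2)^-1.
Proof.
move=> y0; have cy : 0 < c * y by rewrite mulr_gt0// rt2V_gt0.
have [D D0 HD] := pow_exp_dominated k cy; exists D => // y' s yy' s0.
apply: le_trans (HD s s0); rewrite ler_wpM2l ?exprn_ge0// ler_expR lerN2.
have -> : c * y * s = s * c * y by ring.
by rewrite ler_wpM2l// mulr_ge0// ltW// rt2V_gt0.
Qed.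

Lemma ray1_integrable y t : 0 < y -> integ `]0, +oo[ (ray1 y t).
Proof.
move=> y0; have [D D0 HD] := exp_ray_dominated 0 y0.
apply: (integrable_dominated_oneDsqrV (c := 2 * D)) => //.
  by apply: continuous_measurable => //; exact: ray1_continuous.
move=> s; rewrite /= in_itv/= andbT => s0.
have h := HD y s (lexx y) (ltW s0); rewrite expr0 mul1r in h.
rewrite /ray1 normrM normrM [`|expR _|]ger0_norm ?expR_ge0// gtr0_norm ?rt2V_gt0//.
set E := expR _ in h *; set p := s * c * y - s ^+ 2 * t.
have E0 : 0 <= E by exact: expR_ge0.
apply: (@le_trans _ _ (1 * (E * 2))).
  apply: ler_pM; [exact: ltW rt2V_gt0|by rewrite mulr_ge0|exact: rt2V_le1|].
  rewrite ler_wpM2l//; apply: le_trans (ler_normB _ _) _.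
  by have := norm_cos_le1 p; have := norm_sin_le1 p; lra.
by rewrite mul1r -mulrA [leRHS]mulrC ler_wpM2r.
Qed.

Lemma ray1_integral y t : 0 < y -> 0 < t ->
  \int[mu]_(s in `]0, +oo[) ray1 y t s = pi * Hk 1 y t.
Proof.
move=> y0 t0; have cy : 0 < c * y by rewrite mulr_gt0// rt2V_gt0.
have t2 : 0 < t / 2 by rewrite divr_gt0.
have c0 : c != 0 by rewrite gt_eqF// rt2V_gt0.
transitivity (\int[mu]_(s in `]0, +oo[) (c * ray_re (c * y) (t / 2) 1 s)).
  by apply: eq_Rintegral => s _; rewrite ray1E.
have i1 : integ `]0, +oo[ (ray_re (c * y) (t / 2) 1).
  have := integrable_scale c^-1 (measurable_itv _) (ray1_integrable t y0).
  rewrite (_ : (fun s => c^-1 * ray1 y t s) = ray_re (c * y) (t / 2) 1)//.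
  by apply/funext => s; rewrite ray1E mulKf.
transitivity (c * \int[mu]_(s in `]0, +oo[) ray_re (c * y) (t / 2) 1 s).
  by apply: RintegralZl.
by rewrite ray_re_integral// mulrCA Hk1_scale.
Qed.

(** Imaginary part of exp(i l y - l^2 t) l dl/ds on the same ray, where l dl/ds = i s. *)
Definition ray2 y t s := s * expR (- (s * c * y)) * cos (s * c * y - s ^+ 2 * t).

Lemma ray2_continuous y t : continuous (ray2 y t).
Proof.
move=> s; have [d hd] : exists d, is_derive s 1 (ray2 y t) d.
  by eexists; rewrite /ray2; drv.
exact: is_derive_cont hd.
Qed.

Lemma ray2_dominated y : 0 < y -> exists2 D, 0 <= D &
  forall y' t s, y <= y' -> 0 <= s -> `|ray2 y' t s| <= D * (1 + s ^+ 2)^-1.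
Proof.
move=> y0; have [D D0 HD] := exp_ray_dominated 1 y0; exists D => // y' t s yy' s0.
apply: le_trans (HD y' s yy' s0); rewrite expr1 /ray2 !normrM.
rewrite [`|s|]ger0_norm// [`|expR _|]ger0_norm ?expR_ge0//.
by rewrite ler_piMr ?norm_cos_le1// mulr_ge0// expR_ge0.
Qed.

Lemma ray2_integrable y t : 0 < y -> integ `]0, +oo[ (ray2 y t).
Proof.
move=> y0; have [D D0 HD] := ray2_dominated y0.
apply: (integrable_dominated_oneDsqrV (c := D)) => //.
  by apply: continuous_measurable => //; exact: ray2_continuous.
by move=> s; rewrite /= in_itv/= andbT => s0; apply: HD => //; exact: ltW.
Qed.

(** This is [ray1_integral] differentiated in [y]: as 2 c^2 = 1, the derivative of [ray1] is
    [- ray2]. *)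
Lemma ray2_integral y t : 0 < y -> 0 < t ->
  \int[mu]_(s in `]0, +oo[) ray2 y t s = - (pi * Hk 2 y t).
Proof.
move=> y0 t0; have y2 : 0 < y / 2 by rewrite divr_gt0.
have [D D0 HD] := ray2_dominated y2.
have h1 : is_derive y 1 (fun y => \int[mu]_(s in `]0, +oo[) ray1 y t s)
    (\int[mu]_(s in `]0, +oo[) (- 1 * ray2 y t s)).
  apply: (@derive_under_integral R (fun y => ray1 y t) (fun y s => - 1 * ray2 y t s)
    _ (y / 2) (2 * y) y (fun s => D * (1 + s ^+ 2)^-1)) => //.
  - lra.
  - by move=> z zy; apply: ray1_integrable; lra.
  - move=> z s _ _; rewrite /ray1 /ray2; drve.
    set E := expR _; set p := s * c * z - s ^+ 2 * t.
    transitivity (- (2 * c ^+ 2) * (s * E * cos p)); first by ring.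
    by rewrite rt2V_sqr; field.
  - move=> z s zy; rewrite /= in_itv/= andbT => s0; rewrite mulN1r normrN.
    by apply: HD; [lra|exact: ltW].
  - by apply: integrable_scale => //; exact: integrable_oneDsqrV.
have h2 : is_derive y 1 (fun y => \int[mu]_(s in `]0, +oo[) ray1 y t s) (pi * Hk 2 y t).
  apply: (@near_eq_is_derive _ _ _ (fun y => pi * Hk 1 y t)).
    near=> z; rewrite ray1_integral//; near: z; exact: lt_nbhsr.
  by have d := Hk_dx 1 y t0; drve; rewrite mul0r add0r.
have e : \int[mu]_(s in `]0, +oo[) (- 1 * ray2 y t s) = pi * Hk 2 y t.
  by case: h1 => _ <-; case: h2 => _ <-.
rewrite -e; have -> : \int[mu]_(s in `]0, +oo[) (- 1 * ray2 y t s) =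
    - 1 * \int[mu]_(s in `]0, +oo[) ray2 y t s.
  by apply: RintegralZl => //; exact: ray2_integrable.
by rewrite mulN1r opprK.
Unshelve. all: by end_near. Qed.

Lemma measurable_expC d (T : measurableType d) (A : set T) (p q : T -> R) :
  measurable_fun A p -> measurable_fun A q ->
  measurable_fun A (fun i => Re (expC (Complex (p i) (q i)))) /\
  measurable_fun A (fun i => Im (expC (Complex (p i) (q i)))).
Proof.
move=> mp mq; split => /=; apply: measurable_funM.
- by apply: measurableT_comp mp; exact: measurable_expR.
- apply: measurableT_comp mq; exact: continuous_measurable_fun (@continuous_cos R).
- by apply: measurableT_comp mp; exact: measurable_expR.
- apply: measurableT_comp mq; exact: continuous_measurable_fun (@continuous_sin R).
Qed.

Lemma expC_bound (p q : R) : `|Re (expC (Complex p q))| <= expR p /\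
  `|Im (expC (Complex p q))| <= expR p.
Proof.
split; rewrite /= normrM ger0_norm ?expR_ge0//.
  by rewrite ler_piMr ?expR_ge0// norm_cos_le1.
by rewrite ler_piMr ?expR_ge0// norm_sin_le1.
Qed.

Lemma expC_conj (p q : R) : Re (expC (Complex p (- q))) = Re (expC (Complex p q)) /\
  Im (expC (Complex p (- q))) = - Im (expC (Complex p q)).
Proof. by rewrite /= cosN sinN mulrN. Qed.

End rays.

(** * The three terms of the formula as kernel integrals *)

Section transform_evaluation.
Context {R : realType}.
Local Notation C := (Rcomplex R).
Local Notation Re := complex.Re.
Local Notation Im := complex.Im.
Local Notation mu := (@lebesgue_measure R).
Local Notation integ A f := (mu.-integrable A (EFin \o f)).
Local Notation c := rt2V.
Local Notation Cx a b := (Complex a b : Rcomplex R).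
Implicit Types (z w : C) (x y s t : R) (A B : set R) (P v : R -> C) (e : R -> R -> C).

(* The two rays of the contour are mirror images in the imaginary axis, so their
   integrands are related by [z |-> conj z] or [z |-> - conj z]. *)
Definition cj z : C := Cx (Re z) (- Im z).
Definition ncj z : C := Cx (- Re z) (Im z).

Lemma cjM z w : cj z * cj w = cj (z * w).
Proof. by apply: complex_eqP; rewrite ?(ReM, ImM) /= ?(ReM, ImM); ring. Qed.

Lemma ncj_cjM z w : ncj z * cj w = ncj (z * w).
Proof. by apply: complex_eqP; rewrite ?(ReM, ImM) /= ?(ReM, ImM); ring. Qed.

Lemma cj_ncjM z w : cj z * ncj w = ncj (z * w).
Proof. by rewrite mulrC ncj_cjM mulrC. Qed.

Lemma cj_expC z w : Re w = Re z -> Im w = - Im z -> cj (expC z) = expC w.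
Proof.
move: z w => [p q] [p' q'] /= -> ->; have [h1 h2] := expC_conj p q.
by apply: complex_eqP; rewrite ?h1 ?h2.
Qed.

Lemma Re_Cintegral A P : Re (Cintegral A P) = \int[mu]_(s in A) Re (P s).
Proof. by []. Qed.

Lemma Im_Cintegral A P : Im (Cintegral A P) = \int[mu]_(s in A) Im (P s).
Proof. by []. Qed.

Definition dominated_on A P (a : R -> R) :=
  [/\ measurable_fun A (fun s => Re (P s)), measurable_fun A (fun s => Im (P s)) &
      forall s, A s -> `|Re (P s)| <= a s /\ `|Im (P s)| <= a s].

Definition unimodular_on A B e :=
  [/\ measurable_fun setT (fun p : R * R => Re (e p.1 p.2)),
      measurable_fun setT (fun p : R * R => Im (e p.1 p.2)) &
      forall s y, A s -> B y -> `|Re (e s y)| <= 1 /\ `|Im (e s y)| <= 1].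

Lemma dominated_on_cj A P a : dominated_on A P a -> dominated_on A (fun s => cj (P s)) a.
Proof.
move=> [h1 h2 h3]; split => //=; first exact: measurableT_comp h2.
by move=> s As; rewrite normrN; exact: h3.
Qed.

Lemma dominated_on_ncj A P a : dominated_on A P a -> dominated_on A (fun s => ncj (P s)) a.
Proof.
move=> [h1 h2 h3]; split => //=; first exact: measurableT_comp h1.
by move=> s As; rewrite normrN; exact: h3.
Qed.

Lemma unimodular_on_cj A B e : unimodular_on A B e -> unimodular_on A B (fun s y => cj (e s y)).
Proof.
move=> [h1 h2 h3]; split => //=; first exact: measurableT_comp h2.
by move=> s y As By; rewrite normrN; exact: h3.
Qed.

Lemma exchange A B P v e a b : measurable A -> measurable B ->
  dominated_on A P a -> dominated_on B v b -> unimodular_on A B e ->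
  integ A a -> integ B b ->
  [/\ forall y, B y -> Cinteg A (fun s => P s * e s y),
      Cinteg B (fun y => Cintegral A (fun s => P s * e s y) * v y) &
      Cintegral A (fun s => P s * Cintegral B (fun y => e s y * v y)) =
      Cintegral B (fun y => Cintegral A (fun s => P s * e s y) * v y)].
Proof.
move=> mA mB [p1 p2 p3] [v1 v2 v3] [e1 e2 e3] ia ib.
have [h1 h2] := Cintegral_exchange mA mB p1 p2 v1 v2 e1 e2 p3 v3 e3 ia ib.
split=> // y By; exact: (Cinteg_column mA p1 p2 e1 e2 p3 e3 ia By).
Qed.

(** With dl alone, the mirror ray gives minus the conjugate of the kernel, so the difference of the
    two rays is twice a real part. *)
Lemma exchange_ncj A B P v e a b : measurable A -> measurable B ->
  dominated_on A P a -> dominated_on B v b -> unimodular_on A B e ->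
  integ A a -> integ B b ->
  Cintegral A (fun s => P s * Cintegral B (fun y => e s y * v y)) -
  Cintegral A (fun s => ncj (P s) * Cintegral B (fun y => cj (e s y) * v y)) =
  Cintegral B (fun y => RtoC (2 * \int[mu]_(s in A) Re (P s * e s y)) * v y).
Proof.
move=> mA mB hP hv he ia ib.
have [c1 i1 ->] := exchange mA mB hP hv he ia ib.
have [_ i2 ->] := exchange mA mB (dominated_on_ncj hP) hv (unimodular_on_cj he) ia ib.
rewrite -CintegralB//; apply: eq_Cintegral => y By; rewrite -mulrBl; congr (_ * _).
have E s : ncj (P s) * cj (e s y) = ncj (P s * e s y) by exact: ncj_cjM.
have [r1 r2] := @CintegralN_conj R A (fun s => P s * e s y) (fun s => ncj (P s) * cj (e s y))
  (fun s _ => congr1 (@complex.Re R) (E s)) (fun s _ => congr1 (@complex.Im R) (E s)) mA (c1 y By).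
apply: complex_eqP; rewrite ?ReB ?ImB ?r1 ?r2.
  by rewrite opprK /=; ring.
by rewrite subrr.
Qed.

(** With l dl in place of dl, the mirror ray gives the conjugate itself, and the difference is 2 i
    times an imaginary part. *)
Lemma exchange_cj A B P v e a b : measurable A -> measurable B ->
  dominated_on A P a -> dominated_on B v b -> unimodular_on A B e ->
  integ A a -> integ B b ->
  Cintegral A (fun s => P s * Cintegral B (fun y => e s y * v y)) -
  Cintegral A (fun s => cj (P s) * Cintegral B (fun y => cj (e s y) * v y)) =
  Cintegral B (fun y => Cx 0 (2 * \int[mu]_(s in A) Im (P s * e s y)) * v y).
Proof.
move=> mA mB hP hv he ia ib.
have [c1 i1 ->] := exchange mA mB hP hv he ia ib.
have [_ i2 ->] := exchange mA mB (dominated_on_cj hP) hv (unimodular_on_cj he) ia ib.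
rewrite -CintegralB//; apply: eq_Cintegral => y By; rewrite -mulrBl; congr (_ * _).
have E s : cj (P s) * cj (e s y) = cj (P s * e s y) by exact: cjM.
have [r1 r2] := @Cintegral_conj R A (fun s => P s * e s y) (fun s => cj (P s) * cj (e s y))
  (fun s _ => congr1 (@complex.Re R) (E s)) (fun s _ => congr1 (@complex.Im R) (E s)) mA (c1 y By).
apply: complex_eqP; rewrite ?ReB ?ImB ?r1 ?r2.
  by rewrite subrr.
by rewrite opprK /=; ring.
Qed.

Lemma Cintegral_real_kernel B v (M : R) (k : R -> R) : measurable B ->
  integ B (fun y => k y * Re (v y)) -> integ B (fun y => k y * Im (v y)) ->
  Cintegral B (fun y => RtoC (M * k y) * v y) =
  M *: Cx (\int[mu]_(y in B) (k y * Re (v y))) (\int[mu]_(y in B) (k y * Im (v y))).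
Proof.
move=> mB i1 i2; apply: complex_eqP; rewrite ?(ReZ, ImZ) /=.
  transitivity (\int[mu]_(y in B) (M * (k y * Re (v y)))); last by apply: RintegralZl.
  by apply: eq_Rintegral => y _; rewrite ReM /=; ring.
transitivity (\int[mu]_(y in B) (M * (k y * Im (v y)))); last by apply: RintegralZl.
by apply: eq_Rintegral => y _; rewrite ImM /=; ring.
Qed.

Lemma Cintegral_imaginary_kernel B v (M : R) (k : R -> R) : measurable B ->
  integ B (fun y => k y * Re (v y)) -> integ B (fun y => k y * Im (v y)) ->
  Cintegral B (fun y => Cx 0 (M * k y) * v y) =
  M *: Cx (- \int[mu]_(y in B) (k y * Im (v y))) (\int[mu]_(y in B) (k y * Re (v y))).
Proof.
move=> mB i1 i2; apply: complex_eqP; rewrite ?(ReZ, ImZ) /=.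
  rewrite mulrN -mulNr.
  transitivity (\int[mu]_(y in B) (- M * (k y * Im (v y)))); last by apply: RintegralZl.
  by apply: eq_Rintegral => y _; rewrite ReM /=; ring.
transitivity (\int[mu]_(y in B) (M * (k y * Re (v y)))); last by apply: RintegralZl.
by apply: eq_Rintegral => y _; rewrite ImM /=; ring.
Qed.

Lemma dominated_on_halfline v : dominated (fun y => Re (v y)) -> dominated (fun y => Im (v y)) ->
  exists2 b, dominated_on `]0, +oo[ v b & integ `]0, +oo[ b.
Proof.
move=> [m1 [C1 C10 H1]] [m2 [C2 C20 H2]].
exists (fun y => (C1 + C2) * (1 + y ^+ 2)^-1); last first.
  by apply: integrable_scale => //; exact: integrable_oneDsqrV.
split=> // y; rewrite /= in_itv/= andbT => y0.
have w0 : 0 <= (1 + y ^+ 2)^-1 :> R by rewrite invr_ge0 addr_ge0// sqr_ge0.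
split.
  by apply: le_trans (H1 y y0) _; rewrite ler_wpM2r// lerDl.
by apply: le_trans (H2 y y0) _; rewrite ler_wpM2r// lerDr.
Qed.

Lemma line_term v x t : 0 < t ->
  dominated (fun y => Re (v y)) -> dominated (fun y => Im (v y)) ->
  Cintegral setT (fun l => kernel_exp x t (RtoC l) * hat v (RtoC l)) =
  (2 * pi) *: Cx (heat_conv (-1) 1 (fun y => Re (v y)) x t) (heat_conv (-1) 1 (fun y => Im (v y)) x t).
Proof.
move=> t0 dr di; have [b hv ib] := dominated_on_halfline dr di.
pose P (l : R) : C := expC (Cx (- (t * l ^+ 2)) (l * x)).
pose e (l y : R) : C := expC (Cx 0 (- (l * y))).
have mB : measurable (`]0, +oo[ : set R) by [].
(* At [z = 0] the function [gcos 0 t 0] is the Gaussian itself, here the modulus of [P]. *)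
have hP : dominated_on setT P (gcos 0 t 0).
  have [m1 m2] : measurable_fun setT (fun s => Re (P s)) /\ measurable_fun setT (fun s => Im (P s)).
    apply: measurable_expC; last exact: measurable_funM.
    by apply: measurableT_comp => //; apply: measurable_funM => //; exact: measurable_funX.
  split=> // s _; rewrite /gcos mul0r cos0 mulr1 expr0 mul1r; exact: expC_bound.
have he : unimodular_on setT `]0, +oo[ e.
  have [m1 m2] : measurable_fun setT (fun p : R * R => Re (e p.1 p.2)) /\
      measurable_fun setT (fun p : R * R => Im (e p.1 p.2)).
    apply: measurable_expC => //; apply: measurableT_comp => //; apply: measurable_funM.
      exact: measurable_fst.
    exact: measurable_snd.
  by split=> // s y _ _; have := expC_bound 0 (- (s * y)); rewrite expR0.
have [_ _ X] := exchange measurableT mB hP hv he (@integrable_gcos R setT 0 t 0 measurableT t0) ib.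
transitivity (Cintegral setT (fun l => P l * Cintegral `]0, +oo[ (fun y => e l y * v y))).
  apply: eq_Cintegral => l _; congr (_ * _).
    by rewrite kernel_expE; congr expC; apply: complex_eqP; rewrite /=; ring.
  apply: eq_Cintegral => y _; rewrite mulrC; congr (expC _ * _).
  by apply: complex_eqP; rewrite ?(ReN, ImN) !(ReM, ImM) /=; ring.
rewrite X.
(* The inner integral is the Fourier transform of a Gaussian at [x - y]; its sine part vanishes. *)
transitivity (Cintegral `]0, +oo[ (fun y => RtoC ((2 * pi) * Hk 1 (x + -1 * y) t) * v y)).
  apply: eq_Cintegral => y _; congr (_ * _).
  apply: complex_eqP; rewrite ?Re_Cintegral ?Im_Cintegral [RHS]/=.
    rewrite -gcos_integral//; apply: eq_Rintegral => s _; rewrite -expCD /=.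
    by rewrite /gcos expr0 mul1r addr0; congr (_ * cos _); ring.
  rewrite -(gsin_integral (x + -1 * y) t0); apply: eq_Rintegral => s _; rewrite -expCD /=.
  by rewrite /gsin expr0 mul1r addr0; congr (_ * sin _); ring.
by apply: Cintegral_real_kernel => //; exact: integrable_heat_conv.
Qed.

Let pos_itv y : `]0, +oo[%classic y = (0 < y). Proof. by rewrite /= in_itv/= andbT. Qed.

(** The value of [kernel_exp] on the ray at pi/4; on the ray at 3 pi/4 the value is its
    conjugate. *)
Let ker x t s : C := expC (Cx (- (s * c * x)) (s * c * x - s ^+ 2 * t)).

Let ker_measurable x t : measurable_fun (`]0, +oo[ : set R) (fun s => Re (ker x t s)) /\
  measurable_fun (`]0, +oo[ : set R) (fun s => Im (ker x t s)).
Proof.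
have m1 : measurable_fun (`]0, +oo[ : set R) (fun s : R => s * c * x).
  by apply: measurable_funM => //; exact: measurable_funM.
apply: measurable_expC; first exact: measurableT_comp m1.
by apply: measurable_funB => //; apply: measurable_funM => //; exact: measurable_funX.
Qed.

Let kernel_ray1 x t s : kernel_exp x t (s *: Cx c c : C) = ker x t s.
Proof.
rewrite kernel_expE; congr expC; apply: complex_eqP; rewrite /=; first by ring.
transitivity (s * c * x - 2 * c ^+ 2 * (s ^+ 2 * t)); first by ring.
by rewrite rt2V_sqr; field.
Qed.

Let kernel_ray2 x t s : kernel_exp x t (s *: Cx (- c) c : C) = cj (ker x t s).
Proof.
rewrite kernel_expE; symmetry; apply: cj_expC => /=; first by ring.
transitivity (- (s * c * x - 2 * c ^+ 2 * (s ^+ 2 * t))); first by ring.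
by rewrite rt2V_sqr; field.
Qed.

(** The sign in [hat v (- l)] makes exp(i l y) decay on the rays and combine with exp(i l x), so the
    kernel appears at [x + y]: the reflected convolution. *)
Lemma Gamma_hat_term v x t : 0 < x -> 0 < t ->
  dominated (fun y => Re (v y)) -> dominated (fun y => Im (v y)) ->
  Gamma_integral (fun l : C => kernel_exp x t l * hat v (- l)) =
  (2 * pi) *: Cx (heat_conv 1 1 (fun y => Re (v y)) x t) (heat_conv 1 1 (fun y => Im (v y)) x t).
Proof.
move=> x0 t0 dr di; have [b hv ib] := dominated_on_halfline dr di.
have mB : measurable (`]0, +oo[ : set R) by [].
pose w : C := Cx c c.
pose P (s : R) : C := ker x t s * w.
pose e (s y : R) : C := expC (Cx (- (s * c * y)) (s * c * y)).
have c0 := @rt2V_gt0 R.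
have hP : dominated_on `]0, +oo[ P (fun s => 2 * expR (- (s * c * x))).
  have [k1 k2] := ker_measurable x t.
  have [m1 m2] := measurable_ReM (g := fun=> w) k1 k2 (measurable_cst _) (measurable_cst _).
  split=> // s _; have [h1 h2] := expC_bound (- (s * c * x)) (s * c * x - s ^+ 2 * t).
  have cc : `|c| <= 1 :> R by rewrite gtr0_norm// rt2V_le1.
  by have := @norm_ReM_le R (ker x t s) w _ 1 h1 h2 cc cc; rewrite mulr1.
have he : unimodular_on `]0, +oo[ `]0, +oo[ e.
  have m0 : measurable_fun setT (fun p : R * R => p.1 * c * p.2).
    apply: measurable_funM; last exact: measurable_snd.
    by apply: measurable_funM; [exact: measurable_fst|exact: measurable_cst].
  have [m1 m2] : measurable_fun setT (fun p : R * R => Re (e p.1 p.2)) /\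
      measurable_fun setT (fun p : R * R => Im (e p.1 p.2)).
    by apply: measurable_expC => //; exact: measurableT_comp m0.
  split=> // s y; rewrite !pos_itv => s0 y0.
  have E1 : expR (- (s * c * y)) <= 1.
    by rewrite -expR0 ler_expR oppr_le0 !mulr_ge0 ?ltW.
  have [h1 h2] := expC_bound (- (s * c * y)) (s * c * y).
  by split; [exact: le_trans h1 E1|exact: le_trans h2 E1].
have ia : integ `]0, +oo[ (fun s => 2 * expR (- (s * c * x))).
  have [D D0 HD] := exp_ray_dominated 0 x0.
  apply: integrable_scale => //; apply: (integrable_dominated_oneDsqrV (c := D)) => //.
    apply: measurableT_comp => //; apply: measurableT_comp => //.
    by apply: measurable_funM => //; exact: measurable_funM.
  move=> s; rewrite pos_itv => s0; rewrite ger0_norm ?expR_ge0//.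
  by have := HD x s (lexx x) (ltW s0); rewrite expr0 mul1r.
rewrite /Gamma_integral /ray_integral direction_pi4 direction_3pi4.
transitivity (Cintegral `]0, +oo[ (fun s => P s * Cintegral `]0, +oo[ (fun y => e s y * v y)) -
  Cintegral `]0, +oo[ (fun s => ncj (P s) * Cintegral `]0, +oo[ (fun y => cj (e s y) * v y))).
  congr (_ - _); apply: eq_Cintegral => s _; rewrite mulrAC.
    rewrite kernel_ray1; congr (_ * _); apply: eq_Cintegral => y _; rewrite mulrC.
    congr (_ * _); congr expC.
    by apply: complex_eqP; rewrite ?(ReN, ImN) !(ReM, ImM) /=; ring.
  rewrite kernel_ray2 -cj_ncjM; congr (_ * _); apply: eq_Cintegral => y _; rewrite mulrC.
  congr (_ * _); symmetry; apply: cj_expC; rewrite ?(ReN, ImN) !(ReM, ImM) /=; ring.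
rewrite (exchange_ncj mB mB hP hv he ia ib).
transitivity (Cintegral `]0, +oo[ (fun y => RtoC ((2 * pi) * Hk 1 (x + 1 * y) t) * v y)).
  apply: eq_Cintegral => y; rewrite pos_itv => y0; congr (RtoC _ * _).
  rewrite -mulrA -ray1_integral//; last lra.
  congr (_ * _); apply: eq_Rintegral => s _.
  rewrite /P mulrAC /ker /e -expCD ReM /= /ray1.
  rewrite (_ : - (s * c * x) + - (s * c * y) = - (s * c * (x + 1 * y))); last by ring.
  rewrite (_ : s * c * x - s ^+ 2 * t + s * c * y = s * c * (x + 1 * y) - s ^+ 2 * t); last by ring.
  by ring.
by apply: Cintegral_real_kernel => //; exact: integrable_heat_conv.
Qed.

(** On the rays exp(l^2 tau) has modulus 1, so the exchange relies on the decay of exp(i l x) alone.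
    Multiplying the exponentials gives the kernel at time [t - tau], and the factor l produces its
    [x]-derivative. *)
Lemma Gamma_tilde_term (g : nat -> R -> R) (g' : nat -> R -> R) (g0 g0' : nat -> R) v x t :
  0 < x -> 0 < t -> smooth_jet g g0 -> smooth_jet g' g0' ->
  (forall y, Re (v y) = g 0%N y) -> (forall y, Im (v y) = g' 0%N y) ->
  (pi^-1 *: Ci) * Gamma_integral (fun l : C => kernel_exp x t l * l * tilde v l t) =
  2 *: Cx (duhamel 2 (g 0%N) x t) (duhamel 2 (g' 0%N) x t).
Proof.
move=> x0 t0 gS gS' vg vg'.
have mA : measurable (`]0, +oo[ : set R) by [].
have mB : measurable (`]0, t[ : set R) by [].
have [D1 D10 H1] := smooth_jet_bounded 0 t gS.
have [D2 D20 H2] := smooth_jet_bounded 0 t gS'.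
have hv : dominated_on `]0, t[ v (fun=> D1 + D2).
  split.
  - rewrite (_ : (fun s => Re (v s)) = g 0%N); last exact/funext.
    exact: smooth_jet_measurable gS.
  - rewrite (_ : (fun s => Im (v s)) = g' 0%N); last exact/funext.
    exact: smooth_jet_measurable gS'.
  - move=> y yI; rewrite vg vg'; have yt : 0 < y < t by move: yI; rewrite /= in_itv.
    split.
      by apply: le_trans (H1 y yt) _; rewrite lerDl.
    by apply: le_trans (H2 y yt) _; rewrite lerDr.
have ib : integ `]0, t[ (fun=> D1 + D2) by exact: integrable_cst_itv.
pose P (s : R) : C := ker x t s * Cx 0 s.
pose e (s y : R) : C := expC (Cx 0 (s ^+ 2 * y)).
have hP : dominated_on `]0, +oo[ P (fun s => 2 * (s ^+ 1 * expR (- (s * c * x)))).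
  have [k1 k2] := ker_measurable x t.
  have [m1 m2] := measurable_ReM (g := fun s : R => Cx 0 s : C) k1 k2
    (measurable_cst _) (@measurable_id _ _ _).
  split=> // s; rewrite pos_itv => s0.
  have [h1 h2] := expC_bound (- (s * c * x)) (s * c * x - s ^+ 2 * t).
  have p1 : `|Re (Cx 0 s : C)| <= s by rewrite /= normr0 ltW.
  have p2 : `|Im (Cx 0 s : C)| <= s by rewrite /= gtr0_norm.
  have := norm_ReM_le h1 h2 p1 p2.
  by rewrite expr1 [s * expR _]mulrC mulrA.
have he : unimodular_on `]0, +oo[ `]0, t[ e.
  have [m1 m2] : measurable_fun setT (fun p : R * R => Re (e p.1 p.2)) /\
      measurable_fun setT (fun p : R * R => Im (e p.1 p.2)).
    apply: measurable_expC => //; apply: measurable_funM; last exact: measurable_snd.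
    by apply: measurable_funX; exact: measurable_fst.
  by split=> // s y _ _; have := expC_bound 0 (s ^+ 2 * y); rewrite expR0.
have ia : integ `]0, +oo[ (fun s => 2 * (s ^+ 1 * expR (- (s * c * x)))).
  have [D D0 HD] := exp_ray_dominated 1 x0.
  apply: integrable_scale => //; apply: (integrable_dominated_oneDsqrV (c := D)) => //.
    apply: measurable_funM; first exact: measurable_funX.
    apply: measurableT_comp => //; apply: measurableT_comp => //.
    by apply: measurable_funM => //; exact: measurable_funM.
  move=> s; rewrite pos_itv => s0.
  rewrite ger0_norm ?mulr_ge0 ?expR_ge0 ?exprn_ge0 ?(ltW s0)//.
  exact: HD (lexx x) (ltW s0).
have ww : c * c = 2^-1 :> R by rewrite -rt2V_sqr.
(* The remaining factor [i] turns the components (d', -d) into (d, d'). *)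
have -> : Gamma_integral (fun l : C => kernel_exp x t l * l * tilde v l t) =
    (2 * pi) *: Cx (duhamel 2 (g' 0%N) x t) (- duhamel 2 (g 0%N) x t).
  rewrite /Gamma_integral /ray_integral direction_pi4 direction_3pi4.
  transitivity (Cintegral `]0, +oo[ (fun s => P s * Cintegral `]0, t[ (fun y => e s y * v y)) -
    Cintegral `]0, +oo[ (fun s => cj (P s) * Cintegral `]0, t[ (fun y => cj (e s y) * v y))).
    congr (_ - _); apply: eq_Cintegral => s _; rewrite mulrAC -(mulrA (kernel_exp _ _ _)).
      rewrite kernel_ray1; congr (_ * _ * _).
        apply: complex_eqP; rewrite !(ReM, ImM) !(ReZ, ImZ) /=; first by ring.
        by transitivity (2 * s * (c * c)); [ring|rewrite ww; field].
      apply: eq_Cintegral => y _; congr (_ * _); congr expC.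
      apply: complex_eqP; rewrite expr2 !(ReM, ImM) !(ReZ, ImZ) /=; first by ring.
      by transitivity (2 * (c * c) * (s ^+ 2 * y)); [ring|rewrite ww; field].
    rewrite kernel_ray2 -cjM; congr (_ * _ * _).
      apply: complex_eqP; rewrite !(ReM, ImM) !(ReZ, ImZ) /=; first by ring.
      by transitivity (- (2 * s * (c * c))); [ring|rewrite ww; field].
    apply: eq_Cintegral => y _; congr (_ * _).
    symmetry; apply: cj_expC; rewrite expr2 !(ReM, ImM) !(ReZ, ImZ) /=; first by ring.
    by transitivity (- (2 * (c * c) * (s ^+ 2 * y))); [ring|rewrite ww; field].
  rewrite (exchange_cj mA mB hP hv he ia ib).
  transitivity (Cintegral `]0, t[ (fun y => Cx 0 ((- (2 * pi)) * Hz 2 x (t - y)) * v y)).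
    apply: eq_Cintegral => y; rewrite /= in_itv/= => /andP[y0 yt].
    have ty : 0 < t - y by rewrite subr_gt0.
    congr (Complex 0 _ * _); rewrite HzS_pos//.
    rewrite (_ : - (2 * pi) * Hk 2 x (t - y) = 2 * (- (pi * Hk 2 x (t - y)))); last by ring.
    rewrite -ray2_integral//; congr (_ * _); apply: eq_Rintegral => s _.
    rewrite /= /ray2 expR0.
    rewrite (_ : s * c * x - s ^+ 2 * (t - y) = s * c * x - s ^+ 2 * t + s ^+ 2 * y); last by ring.
    by rewrite [cos (_ + s ^+ 2 * y)]cosD; ring.
  have i1 := integrable_duhamel 1 0 t t x0 gS; have i2 := integrable_duhamel 1 0 t t x0 gS'.
  rewrite Cintegral_imaginary_kernel//; last 2 first.
  - by rewrite (_ : (fun y => _) = fun y => Hz 2 x (t - y) * g 0%N y)//; apply/funext => y; rewrite vg.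
  - by rewrite (_ : (fun y => _) = fun y => Hz 2 x (t - y) * g' 0%N y)//; apply/funext => y; rewrite vg'.
  rewrite /duhamel; apply: complex_eqP; rewrite !(ReZ, ImZ) /=.
    rewrite mulrNN; congr (_ * _); apply: eq_Rintegral => y _; by rewrite vg'.
  rewrite mulrN mulNr; congr (- (_ * _)); apply: eq_Rintegral => y _; by rewrite vg.
have p0 : pi != 0 :> R by rewrite gt_eqF// pi_gt0.
have E d : pi^-1 * 1 * (2 * pi * d) = 2 * d :> R by rewrite mulr1 -mulrA mulrCA mulKf.
by apply: complex_eqP; rewrite !(ReM, ImM) !(ReZ, ImZ) /= !E mulr0 mul0r; ring.
Qed.

End transform_evaluation.

(** * Assembly of the solution *)

Theorem theorem1p1 (R : realType) (u0 g0 : R -> Rcomplex R)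
    (u : R -> R -> Rcomplex R)
    (hu0 : Schwartz_halfline u0) (hg0 : Cinfty_halfline g0)
    (hu : forall x t : R, 0 < x -> 0 < t ->
       u x t =
         (2 * pi)^-1 *: Cintegral setT (fun l : R =>
            kernel_exp x t (RtoC l) * hat u0 (RtoC l))
       - (2 * pi)^-1 *: Gamma_integral (fun l : Rcomplex R =>
            kernel_exp x t l * hat u0 (- l))
       - (pi^-1 *: Ci) * Gamma_integral (fun l : Rcomplex R =>
            kernel_exp x t l * l * tilde g0 l t)) :
  Cinfty_on quadrant u /\
  (forall x t : R, 0 < x -> 0 < t -> derive1 (u x) t = derive1n 2 (u ^~ t) x) /\
  ((forall x : R, 0 < x -> u x t @[t --> 0^'+] --> u0 x) /\
   (forall t : R, 0 < t -> u x t @[x --> 0^'+] --> g0 t)) /\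
  ((forall t : R, 0 < t -> Cinfty_halfline (u ^~ t)) /\
   (forall n : nat, Cinfty_pos (fun t => deriv_at0 n (u ^~ t)))) /\
  ((forall x : R, 0 < x -> Cinfty_halfline (u x)) /\
   (forall n : nat, Cinfty_pos (fun x => deriv_at0 n (u x)))) /\
  rapidly_decreasing u.
Proof.
have [hr hi] := Schwartz_halfline_jets hu0.
have [gr gi] := Cinfty_halfline_jets hg0.
(* The kernels being real, the real and imaginary parts of the data give two independent real
   problems. *)
pose A := heat_solution (fun n x => complex.Re (derive1n n u0 x))
  (fun n x => complex.Re (derive1n n g0 x)).
pose B := heat_solution (fun n x => complex.Im (derive1n n u0 x))
  (fun n x => complex.Im (derive1n n g0 x)).
have HA : heat_family A by exact: heat_solution_family hr gr.
have HB : heat_family B by exact: heat_solution_family hi gi.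
have hAB x t : 0 < x -> 0 < t -> u x t = Complex (A 0%N x t) (B 0%N x t).
  move=> x0 t0; have dr := schwartz_jet_dominated0 0 hr.
  have di := schwartz_jet_dominated0 0 hi.
  rewrite hu// line_term// Gamma_hat_term//.
  rewrite (@Gamma_tilde_term R _ _ _ _ g0 x t x0 t0 gr gi (fun=> erefl) (fun=> erefl)).
  have p0 : pi != 0 :> R by rewrite gt_eqF// pi_gt0.
  rewrite !(scalerA (2 * pi)^-1) mulVf ?mulf_neq0// !scale1r.
  by apply: complex_eqP; rewrite ?ReB ?ImB ?ReZ ?ImZ.
split; first exact: complex_heat_Cinfty HA HB hAB.
split; first by move=> x t; exact: complex_heat_equation HA HB hAB x t.
split.
  split.
    move=> x x0; apply: (@cvg_trans _ ((fun t => Complex (A 0%N x t) (B 0%N x t) : Rcomplex R) t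
        @[t --> 0^'+])).
      by apply: near_eq_cvg; near=> t; rewrite hAB.
    by apply: cvg_complex; [exact: (heat_solution_initial hr gr x0)|exact: (heat_solution_initial hi gi x0)].
  move=> t t0; apply: (@cvg_trans _ ((fun x => Complex (A 0%N x t) (B 0%N x t) : Rcomplex R) x
      @[x --> 0^'+])).
    by apply: near_eq_cvg; near=> x; rewrite hAB.
  by apply: cvg_complex; [exact: (heat_solution_boundary hr gr t0)|exact: (heat_solution_boundary hi gi t0)].
split; first exact: complex_heat_boundary HA HB hAB.
split; first exact: complex_heat_initial HA HB hAB.
exact: complex_heat_decay HA HB hAB.
Unshelve. all: by end_near. Qed.
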